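(* Assume conditions [ID], [PEN], [CRIT], [LOC], [PHI] and [LQA], with $|B_n-\|u_n^*\|^2|=o_{P_{Z^\infty}}(1)$ for the random variable $B_n$ in [LQA]. Suppose $\widehat\alpha_n^R\in\mathcal N_{osn}$ with $P_{Z^\infty}$-probability approaching one. Then: (1) under the null hypothesis $H_0:\phi(\alpha_0)=\phi_0$, $$\|u_n^*\|^2\times\widehat{QLR}_n(\phi_0)=(\sqrt n\,\mathbb Z_n)^2+o_{P_{Z^\infty}}(1)\Rightarrow\chi_1^2 .$$ (2) Further, let $\widehat\alpha_n$ be the optimally weighted PSMD estimator, i.e. $\Sigma=\Sigma_0$, and let $\widehat{QLR}{}_n^0(\phi_0)$ denote the corresponding statistic $\widehat{QLR}_n(\phi_0)$. Then under $H_0:\phi(\alpha_0)=\phi_0$, $$\widehat{QLR}{}_n^0(\phi_0)=(\sqrt n\,\mathbb Z_n)^2+o_{P_{Z^\infty}}(1)\Rightarrow\chi_1^2 .$$ (All objects and the bracketed conditions are defined in the context.)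
   Context: MODEL. $Z=(Y',X')'$; $Z_1,Z_2,\dots$ are i.i.d. copies, $Z_i=(Y_i',X_i')'$, $Z^n=(Z_1,\dots,Z_n)$; $P_{Z^\infty}$ is the law of the sequence ($o_P,O_P$ and wpa1 = ''with probability approaching one'' refer to it); $\mathcal X$ is the support of $X$; $\|\cdot\|_e$ is the Euclidean norm; $a_n\asymp b_n$ means $c_1a_n\le b_n\le c_2a_n$ for constants $0<c_1\le c_2<\infty$. $\mathcal A=\Theta\times\mathcal H$ with $\Theta\subset\mathbb R^{d_\theta}$ and $\mathcal H$ a space of functions with norm $\|\cdot\|_{\mathbf H}$; for $\alpha=(\theta',h)$, $\|\alpha\|_s=\|\theta\|_e+\|h\|_{\mathbf H}$. $\rho(Z;\alpha)\in\mathbb R^{d_\rho}$ is a known function, $m(X,\alpha)=E[\rho(Z;\alpha)|X]$, and $\alpha_0=(\theta_0',h_0)\in\mathrm{int}(\Theta)\times\mathcal H$ satisfies $m(X,\alpha_0)=0$ a.s. $\Sigma(X)$ is a positive definite weighting matrix, $\Sigma_0(X)=\mathrm{Var}(\rho(Z;\alpha_0)|X)$, $Q(\alpha)=E[m(X,\alpha)'\Sigma(X)^{-1}m(X,\alpha)]$. ESTIMATOR. $\widehat m(x,\alpha)=\sum_{i=1}^n\rho(Z_i,\alpha)A_n(X_i,x)$ is a consistent estimator of $m$ ($A_n(X_i,x)$ a known measurable function of $X_1,\dots,X_n$), $\widehat\Sigma$ is a consistent estimator of $\Sigma$, $\widehat Q_n(\alpha)=\frac1n\sum_{i=1}^n\widehat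 m(X_i,\alpha)'\widehat\Sigma(X_i)^{-1}\widehat m(X_i,\alpha)$. Sieve: $\mathcal A_{k(n)}=\Theta\times\mathcal H_{k(n)}$, $\mathcal H_{k(n)}=\{h\in\mathcal H:h=\sum_{k\le k(n)}\beta_kq_k\}$ for known basis functions $q_k$, $k(n)\to\infty$. $Pen\ge0$ is a penalty on $\mathcal H$, $\lambda_n=o(1)$. The PSMD (penalized sieve minimum distance) estimator $\widehat\alpha_n=(\widehat\theta_n',\widehat h_n)\in\mathcal A_{k(n)}$ satisfies $\widehat Q_n(\widehat\alpha_n)+\lambda_nPen(\widehat h_n)\le\inf_{\alpha\in\mathcal A_{k(n)}}\{\widehat Q_n(\alpha)+\lambda_nPen(h)\}+o_P(n^{-1})$. RESTRICTED ESTIMATOR. $\mathcal A_{k(n)}^R=\{\alpha\in\mathcal A_{k(n)}:\phi(\alpha)=\phi_0\}$; $\widehat\alpha_n^R\in\mathcal A_{k(n)}^R$ satisfies $\widehat Q_n(\widehat\alpha_n^R)+\lambda_nPen(\widehat h_n^R)\le\inf_{\alpha\in\mathcal A_{k(n)}^R}\{\widehat Q_n(\alpha)+\lambda_nPen(h)\}+o_P(n^{-1})$. $\widehat{QLR}_n(\phi_0)=n(\inf_{\alpha\in\mathcal A_{k(n)}^R}\widehat Q_n(\alpha)-\widehat Q_n(\widehat\alpha_n))$, which the paper uses interchangeably with $n(\widehat Q_n(\widehat\alpha_n^R)-\widehat Q_n(\widehat\alpha_n))$ up to $o_P(1)$. LOCAL OBJECTS. $\dot m_\alpha(X)[v]=\partial_\tau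 m(X,\alpha+\tau v)|_{\tau=0}$, $\dot\phi_\alpha[v]=\partial_\tau\phi(\alpha+\tau v)|_{\tau=0}$ (pathwise derivatives), $\dot m=\dot m_{\alpha_0}$, $\dot\phi=\dot\phi_{\alpha_0}$. $\langle v_1,v_2\rangle=E[\dot m(X)[v_1]'\Sigma(X)^{-1}\dot m(X)[v_2]]$, $\|v\|^2=\langle v,v\rangle$. $\mathcal A_{os}$ is a convex $\|\cdot\|_s$-neighbourhood of $\alpha_0$ contained in $\{\alpha\in\mathcal A:\|\alpha-\alpha_0\|_s<M_0,\ \lambda_nPen(h)<\lambda_nM_0\}$; $\mathcal A_{osn}=\mathcal A_{os}\cap\mathcal A_{k(n)}$. With $\Pi_n h_0$ as in [ID](ii), $\Pi_n\alpha_0=(\theta_0',\Pi_nh_0)$. $\tau_n=\sup\{\|\alpha-\Pi_n\alpha_0\|_s/\|\alpha-\Pi_n\alpha_0\|:\alpha\in\mathcal A_{osn},\|\alpha-\Pi_n\alpha_0\|\ne0\}$. $\bar\delta_{m,n}\downarrow0$ and $\delta_n=o(1)$, $\delta_n\le\bar\delta_{m,n}$, are positive sequences; $\delta_{s,n}=\|h_0-\Pi_nh_0\|_s+\tau_n\delta_n=o(1)$; $M_n=\min\{\log\log(n+1),\log(\delta_{s,n}^{-1}+1)\}$. $\mathcal N_{os}=\{\alpha\in\mathcal A:\|\alpha-\alpha_0\|\le M_n\delta_n,\|\alpha-\alpha_0\|_s\le M_n\delta_{s,n},\lambda_nPen(h)\le\lambda_nM_0\}$, $\mathcal N_{osn}=\mathcal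 N_{os}\cap\mathcal A_{k(n)}$, $\mathcal T_n=\{t\in\mathbb R:|t|\le4M_n^2\delta_n\}$. $\mathcal A_{k(n)}^{M_0}=\{\alpha\in\mathcal A_{k(n)}:\lambda_nPen(h)\le\lambda_nM_0\}$, with $M_0$ finite and so large that it contains $\Pi_n\alpha_0$, and contains $\widehat\alpha_n$ with probability arbitrarily close to one for all large $n$. The sieve space $\mathcal A_{k(n)}$ is convex with nonempty interior. RIESZ REPRESENTER. $\phi:\mathbb R^{d_\theta}\times\mathcal H\to\mathbb R$ is $\|\cdot\|_s$-continuous and $\dot\phi$ is a $\|\cdot\|_s$-bounded linear functional. $\mathbf V$ is the linear span of $\mathcal A_{os}-\{\alpha_0\}$, $\overline{\mathbf V}$ its closure under $\|\cdot\|$; $\alpha_{0,n}$ minimizes $\|\alpha-\alpha_0\|$ over $\mathbb R^{d_\theta}\times\mathcal H_{k(n)}$; $\overline{\mathbf V}_{k(n)}$ is the closed linear span under $\|\cdot\|$ of $\mathcal A_{osn}-\{\alpha_{0,n}\}$, with $\dim\overline{\mathbf V}_{k(n)}=\dim\mathcal A_{k(n)}\asymp k(n)$; $v_n^*\in\overline{\mathbf V}_{k(n)}$ is the unique element with $\dot\phi[v]=\langle v_n^*,v\rangle$ for all $v\in\overline{\mathbf V}_{k(n)}$. $\|v\|_{sd}^2=E[\dot m(X)[v]'\Sigma(X)^{-1}\Sigma_0(X)\Sigma(X)^{-1}\dot m(X)[v]]$, $u_n^*=v_n^*/\|v_n^*\|_{sd}$, $\mathbb Z_n=\frac1n\sum_{i=1}^n\dot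 m(X_i)[u_n^*]'\Sigma(X_i)^{-1}\rho(Z_i,\alpha_0)$. CONDITIONS. [ID] (i) $E[\rho(Z;\alpha)|X]=0$ a.s. iff $\alpha\in\mathcal A$ with $\|\alpha-\alpha_0\|_s=0$; (ii) $\Theta$ is compact with nonempty interior, $\{\mathcal H_k\}_{k\ge1}$ is a non-decreasing sequence of nonempty closed linear subsets of the Banach space $(\mathcal H,\|\cdot\|_{\mathbf H})$ with $\mathcal H=cl(\cup_k\mathcal H_k)$, and there is $\Pi_nh_0\in\mathcal H_{k(n)}$ with $\|\Pi_nh_0-h_0\|_{\mathbf H}=o(1)$; (iii) $Q$ is lower semicontinuous on $(\mathcal A,\|\cdot\|_s)$; (iv) the eigenvalues of $\Sigma(x),\Sigma_0(x)$ are bounded and bounded away from zero uniformly in $x\in\mathcal X$. [PEN] (i) $\lambda_n>0$, $Q(\Pi_n\alpha_0)+o(n^{-1})=O(\lambda_n)=o(1)$; (ii) $|Pen(\Pi_nh_0)-Pen(h_0)|=O(1)$, $Pen(h_0)<\infty$; (iii) for every $M$, $\{h\in\mathcal H:Pen(h)\le M\}$ is compact in $(\mathcal H,\|\cdot\|_{\mathbf H})$. [CRIT] (i) $\widehat Q_n(\Pi_n\alpha_0)\le c_0Q(\Pi_n\alpha_0)+o_P(n^{-1})$ for a finite $c_0>0$; (ii) $\widehat Q_n(\alpha)\ge cQ(\alpha)-O_P(\bar\delta_{m,n}^2)$ uniformly over $\mathcal A_{k(n)}^{M_0}$ for a finite $c>0$. [LOC] (i) $m(\cdot,\alpha)$ is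 continuously pathwise differentiable in $\alpha\in\mathcal A_{os}$ and $\|\alpha-\alpha_0\|\le C\|\alpha-\alpha_0\|_s$ on $\mathcal A_{os}$ for a finite $C$; (ii) $Q(\alpha)\asymp\|\alpha-\alpha_0\|^2$ on $\mathcal A_{os}$; (iii) $\widehat Q_n(\alpha)\ge cQ(\alpha)-O_P(\delta_n^2)$ uniformly over $\mathcal A_{osn}$, and $\max\{\delta_n^2,Q(\Pi_n\alpha_0),\lambda_n,o(n^{-1})\}=\delta_n^2$; (iv) $\lambda_n\sup_{\alpha,\alpha'\in\mathcal A_{os}}|Pen(h)-Pen(h')|=o(n^{-1})$ or $\lambda_n=o(n^{-1})$. [PHI] (i) $\dot\phi$ is a nonzero linear functional on $\mathbf V$; $\{\overline{\mathbf V}_k\}$ is an increasing sequence of finite dimensional Hilbert spaces dense in $(\overline{\mathbf V},\|\cdot\|)$; $\|v_n^*\|/\sqrt n=o(1)$; (ii) $\sup_{(\alpha,t)\in\mathcal N_{osn}\times\mathcal T_n}\sqrt n\,|\phi(\alpha+tu_n^* )-\phi(\alpha_0)-\dot\phi[\alpha+tu_n^*-\alpha_0]|/\|v_n^*\|=o(1)$; (iii) $\sqrt n\,|\dot\phi[\alpha_{0,n}-\alpha_0]|/\|v_n^*\|=o(1)$. [LQA] (i) with $\alpha(t)=\alpha+tu_n^*$, $\alpha(t)\in\mathcal A_{k(n)}$ for all $(\alpha,t)\in\mathcal N_{osn}\times\mathcal T_n$, and with $\widehat\Lambda_n(\alpha(t),\alpha)=\frac12\{\widehat Q_n(\alpha(t))-\widehat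 Q_n(\alpha)\}$ and $r_n(t)=(\max\{t^2,tn^{-1/2},o(n^{-1})\})^{-1}$, $\sup_{(\alpha,t)\in\mathcal N_{osn}\times\mathcal T_n}r_n(t)|\widehat\Lambda_n(\alpha(t),\alpha)-t\{\mathbb Z_n+\langle u_n^*,\alpha-\alpha_0\rangle\}-\frac{B_n}2t^2|=o_P(1)$, where $B_n$ is a positive $Z^n$-measurable random variable, $B_n=O_P(1)$; (ii) $\sqrt n\,\mathbb Z_n\Rightarrow N(0,1)$.
   Formalization: As sets {Pen ≤ M} are compact, A_os is a neighbourhood only relative to {Pen < M_0} (strict bounds for Π_nα_0, α̂_n too); added: n λ_n sup|Pen(α+tu_n* ) − Pen(α')| → 0 over α, α' in N_osn, t in T_n, which [LOC](iv) then no longer gives. *)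

(* Defs.v *)
From HB Require Import structures.
From mathcomp Require Import all_boot all_order all_algebra.
From mathcomp Require Import all_classical all_reals all_analysis.

Set Implicit Arguments.
Unset Strict Implicit.
Unset Printing Implicit Defensive.

Import Order.TTheory GRing.Theory Num.Def Num.Theory.
Import numFieldNormedType.Exports.

Local Open Scope classical_set_scope.
Local Open Scope ring_scope.

Notation borelV R n := (g_sigma_algebraType (@open 'rV[R]_n)).

(* Suprema, infima and approximate minimisers over function spaces need not be
  measurable, so probabilities of events are outer probabilities
  [mu_ext P]; on measurable sets [mu_ext P] agrees with [P]. *)

Section StochasticOrder.
Context (R : realType) (d : measure_display) (T : measurableType d).
Variable P : probability T R.
Local Open Scope ereal_scope.

Definition wpa1 (A : nat -> set T) : Prop :=
  mu_ext P (~` A n) @[n --> \oo] --> 0.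

(* X_n = o_P(a_n) *)
Definition oP (X : nat -> T -> \bar R) (a : nat -> R) : Prop :=
  forall eps : R, (0 < eps)%R ->
    mu_ext P [set w | (eps * a n)%:E <= `|X n w|] @[n --> \oo] --> 0.

(* X_n = O_P(a_n) *)
Definition OP (X : nat -> T -> \bar R) (a : nat -> R) : Prop :=
  forall eps : R, (0 < eps)%R -> exists C : R, \forall n \near \oo,
    mu_ext P [set w | (C * a n)%:E < `|X n w|] <= eps%:E.

(* X_n <= Y_n + o_P(a_n) *)
Definition le_oP (X Y : nat -> T -> \bar R) (a : nat -> R) : Prop :=
  forall eps : R, (0 < eps)%R ->
    mu_ext P [set w | Y n w + (eps * a n)%:E < X n w] @[n --> \oo] --> 0.

(* Convergence of distribution functions at the continuity points of the
   limit.  Asking for both half-lines makes the outer and inner probabilities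
   of [X_n <= x] have the same limit. *)
Definition cvg_dist (X : nat -> T -> \bar R) (mu : set R -> \bar R) : Prop :=
  forall x : R, mu [set x] = 0 ->
    (mu_ext P [set w | X n w <= x%:E] @[n --> \oo]
       --> mu [set y | (y <= x)%R]) /\
    (mu_ext P [set w | x%:E < X n w] @[n --> \oo]
       --> mu [set y | (x < y)%R]).

End StochasticOrder.

(* chi-squared law with one degree of freedom: the law of the square of a
   standard normal variable *)
Definition chi2_1 (R : realType) : set R -> \bar R :=
  fun B => normal_prob (0 : R) 1 [set y | B (y ^+ 2)].

Definition little_o_inv (R : realType) (u : nat -> R) : Prop :=
  n%:R * u n @[n --> \oo] --> (0 : R).

Definition invn (R : realType) (n : nat) : R := n%:R^-1.
Definition one_seq (R : realType) (n : nat) : R := 1.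

Section Linear.
Context (R : realType) (V : lmodType R).

Definition lin_span (S : set V) : set V :=
  [set v | exists n (c : 'I_n -> R) (s : 'I_n -> V),
     (forall i, S (s i)) /\ v = \sum_i c i *: s i].

Definition has_dim (S : set V) (n : nat) : Prop :=
  exists b : 'I_n -> V,
    (forall c : 'I_n -> R, \sum_i c i *: b i = 0 -> forall i, c i = 0) /\
    S = lin_span (range b).

End Linear.

Section Matrices.
Context (R : realType) (n : nat).

Definition enorm (v : 'rV[R]_n) : R := Num.sqrt (\sum_i v ord0 i ^+ 2).

Definition pos_def (S : 'M[R]_n) : Prop :=
  S^T = S /\ forall v : 'cV[R]_n, v != 0 -> 0 < (v^T *m S *m v) ord0 ord0.

Definition eigenvalues_in (S : 'M[R]_n) (c C : R) : Prop :=
  forall a, eigenvalue S a -> c <= a <= C.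

(* v' S^{-1} w *)
Definition wform (S : 'M[R]_n) (v w : 'cV[R]_n) : R :=
  (v^T *m invmx S *m w) ord0 ord0.

End Matrices.

(* [g] is a version of E[f(Z)|X = .], where Z = (Y, X). *)
Definition cond_exp (R : realType) (dY dX : measure_display)
    (YT : measurableType dY) (XT : measurableType dX)
    (L : probability (YT * XT)%type R) (f : YT * XT -> R) (g : XT -> R) : Prop :=
  [/\ L.-integrable setT (fun z => (f z)%:E),
      measurable_fun setT g,
      L.-integrable setT (fun z => (g z.2)%:E) &
      forall B : set XT, measurable B ->
        (\int[L]_(z in setT `*` B) (f z)%:E =
         \int[L]_(z in setT `*` B) (g z.2)%:E)%E].

(* The finite-dimensional and function parameters live in
  [E = R^dth * H]; a parameter is a pair [(theta, h)].  The sequence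
  Z_1, Z_2, ... is [obs 0], [obs 1], ...; estimators are functions of the
  sample Z^n. *)

Record psmd_model (R : realType) (dy dx dth drho : nat)
    (H : completeNormedModType R) (d : measure_display)
    (Omega : measurableType d) := PSMD {
  prob : probability Omega R;
  lawZ : probability (borelV R dy * borelV R dx)%type R;
  obs : nat -> Omega -> borelV R dy * borelV R dx;
  suppX : set (borelV R dx);
  Theta : set 'rV[R]_dth;
  rho : borelV R dy * borelV R dx -> 'rV[R]_dth * H -> 'cV[R]_drho;
  mX : borelV R dx -> 'rV[R]_dth * H -> 'cV[R]_drho;
  Sig : borelV R dx -> 'M[R]_drho;
  Sig0 : borelV R dx -> 'M[R]_drho;
  alpha0 : 'rV[R]_dth * H;
  wgt : forall n, n.-tuple (borelV R dx) -> borelV R dx -> borelV R dx -> R;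
  Sighat : forall n, n.-tuple (borelV R dy * borelV R dx)%type ->
             borelV R dx -> 'M[R]_drho;
  basis : nat -> H;
  kn : nat -> nat;
  Pen : H -> \bar R;
  lam : nat -> R;
  phi : 'rV[R]_dth * H -> R;
  phi0 : R;
  Pih0 : nat -> H;
  hata : forall n, n.-tuple (borelV R dy * borelV R dx)%type ->
           'rV[R]_dth * H;
  hataR : forall n, n.-tuple (borelV R dy * borelV R dx)%type ->
            'rV[R]_dth * H;
  M0 : R;
  Aos : set ('rV[R]_dth * H);
  deltabar : nat -> R;
  delta : nat -> R;
  alpha0k : nat -> 'rV[R]_dth * H;
  vstar : nat -> 'rV[R]_dth * H;
  Bn : forall n, n.-tuple (borelV R dy * borelV R dx)%type -> R
}.

Section Model.
Context (R : realType) (dy dx dth drho : nat)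
  (H : completeNormedModType R) (d : measure_display)
  (Omega : measurableType d).
Variable M : psmd_model dy dx dth drho H Omega.

Local Notation XT := (borelV R dx).
Local Notation ZT := (borelV R dy * borelV R dx)%type.
Local Notation E := ('rV[R]_dth * H)%type.
Local Notation P := (prob M).
Local Notation L := (lawZ M).
Local Notation a0 := (alpha0 M).

Definition sample (n : nat) (w : Omega) : n.-tuple ZT :=
  [tuple obs M i w | i < n].

Definition norm_s (a : E) : R := enorm a.1 + `|a.2|.

Definition Aset : set E := [set a | Theta M a.1].

Definition Q (a : E) : \bar R :=
  (\int[L]_z (wform (Sig M z.2) (mX M z.2 a) (mX M z.2 a))%:E)%E.

Definition Hk (k : nat) : set H :=
  [set h | exists b : 'I_k -> R, h = \sum_(i < k) b i *: basis M i].

Definition hullk (k : nat) : set E := [set a | Hk k a.2].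

Definition Ak (k : nat) : set E := [set a | Theta M a.1 /\ Hk k a.2].

Definition Pia0 (n : nat) : E := (a0.1, Pih0 M n).

(* The condition [lam n * Pen h <= lam n * M0] keeps the form in which it is
   usually written, although [lam n > 0] makes it [Pen h <= M0]. *)
Definition pen_le (n : nat) (a : E) : Prop :=
  ((lam M n)%:E * Pen M a.2 <= (lam M n * M0 M)%:E)%E.

Definition pen_lt (n : nat) (a : E) : Prop :=
  ((lam M n)%:E * Pen M a.2 < (lam M n * M0 M)%:E)%E.

Definition AkM0 (n : nat) : set E := Ak (kn M n) `&` [set a | pen_le n a].

Definition mhat n (zs : n.-tuple ZT) (x : XT) (a : E) : 'cV[R]_drho :=
  \sum_(i < n) wgt M [tuple of map snd zs] (tnth zs i).2 x
     *: rho M (tnth zs i) a.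

Definition Qhat n (zs : n.-tuple ZT) (a : E) : R :=
  n%:R^-1 * \sum_(i < n)
    wform (Sighat M zs (tnth zs i).2)
      (mhat zs (tnth zs i).2 a) (mhat zs (tnth zs i).2 a).

Definition penQ n (zs : n.-tuple ZT) (a : E) : \bar R :=
  ((Qhat zs a)%:E + (lam M n)%:E * Pen M a.2)%E.

Definition AkR (n : nat) : set E := [set a | Ak (kn M n) a /\ phi M a = phi0 M].

Definition hata_w (n : nat) (w : Omega) : E := hata M (sample n w).
Definition hataR_w (n : nat) (w : Omega) : E := hataR M (sample n w).

Definition QLR_inf (n : nat) (w : Omega) : \bar R :=
  (n%:R%:E * (ereal_inf [set (Qhat (sample n w) a)%:E | a in AkR n]
              - (Qhat (sample n w) (hata_w n w))%:E))%E.

Definition QLR_hat (n : nat) (w : Omega) : \bar R :=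
  (n%:R * (Qhat (sample n w) (hataR_w n w)
           - Qhat (sample n w) (hata_w n w)))%:E.

(* The statistic is given by either of two formulas, which are used
   interchangeably up to o_P(1). *)
Definition QLR_statistic (X : nat -> Omega -> \bar R) : Prop :=
  X = QLR_hat \/
  (X = QLR_inf /\
   oP P (fun n w => QLR_inf n w - QLR_hat n w)%E (@one_seq R)).

Definition mdot_at (a : E) (x : XT) (v : E) : 'cV[R]_drho :=
  \col_i 'D_v (fun b : E => mX M x b i ord0) a.

Definition mdot (x : XT) (v : E) : 'cV[R]_drho := mdot_at a0 x v.

Definition phidot (v : E) : R := 'D_v (phi M : E -> R) a0.

Definition ip (v1 v2 : E) : R :=
  \int[L]_z wform (Sig M z.2) (mdot z.2 v1) (mdot z.2 v2).

Definition nrm (v : E) : R := Num.sqrt (ip v v).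

Definition nrm_sd (v : E) : R :=
  Num.sqrt (\int[L]_z
    ((mdot z.2 v)^T *m invmx (Sig M z.2) *m Sig0 M z.2 *m
       invmx (Sig M z.2) *m mdot z.2 v) ord0 ord0).

Definition Aosk (k : nat) : set E := Aos M `&` Ak k.
Definition Aosn (n : nat) : set E := Aosk (kn M n).

Definition Vspan : set E := lin_span [set a - a0 | a in Aos M].

(* All the directions to which [mdot], [phidot] and [nrm] are applied:
   besides those of [Vspan], differences a - a0 with a in R^dth x H_k. *)
Definition Dir : set E :=
  lin_span [set a - a0 | a in Aos M `|` \bigcup_k hullk k].

(* Trace on [Dir] of the completion of [Vspan]; it contains [Vspan], so
   density in it and density in the completion are the same. *)
Definition Vbar : set E :=
  [set v | Dir v /\ forall eps, 0 < eps -> exists2 w, Vspan w & nrm (v - w) < eps].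

(* Closed linear span, inside the finite-dimensional space R^dth x H_k. *)
Definition Vbark (k : nat) : set E :=
  [set v | hullk k v /\ forall eps, 0 < eps ->
     exists2 w, lin_span [set a - alpha0k M k | a in Aosk k] w
              & nrm (v - w) < eps].

Definition ustar (n : nat) : E := (nrm_sd (vstar M n))^-1 *: vstar M n.

Definition Zn (n : nat) (w : Omega) : R :=
  n%:R^-1 * \sum_(i < n)
    wform (Sig M (obs M i w).2) (mdot (obs M i w).2 (ustar n))
      (rho M (obs M i w) a0).

Definition sqrtnZn (n : nat) (w : Omega) : R := Num.sqrt n%:R * Zn n w.

Definition tau_ratios (n : nat) : set R :=
  [set norm_s (a - Pia0 n) / nrm (a - Pia0 n)
     | a in [set a | Aosn n a /\ nrm (a - Pia0 n) != 0]].

Definition tau (n : nat) : R := sup (tau_ratios n).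

Definition delta_s (n : nat) : R :=
  `|a0.2 - Pih0 M n| + tau n * delta M n.

Definition Mn (n : nat) : R :=
  minr (ln (ln (n.+1)%:R)) (ln ((delta_s n)^-1 + 1)).

Definition Nos (n : nat) : set E :=
  [set a | [/\ Aset a, nrm (a - a0) <= Mn n * delta M n,
               norm_s (a - a0) <= Mn n * delta_s n & pen_le n a]].

Definition Nosn (n : nat) : set E := Nos n `&` Ak (kn M n).

Definition Tn (n : nat) : set R :=
  [set t | `|t| <= 4 * Mn n ^+ 2 * delta M n].

Definition NT (n : nat) : set (E * R) := Nosn n `*` Tn n.

Definition pert (n : nat) (a : E) (t : R) : E := a + t *: ustar n.

Definition iid_sampling : Prop :=
  [/\ forall i, measurable_fun setT (obs M i),
      forall i (B : set ZT), measurable B -> P (obs M i @^-1` B) = L B &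
      forall n (B : 'I_n -> set ZT), (forall i, measurable (B i)) ->
        P (\bigcap_(i in [set: 'I_n]) (obs M i @^-1` B i))
        = (\prod_(i < n) P (obs M i @^-1` B i))%E].

(* The support is the smallest closed set of probability one. *)
Definition is_support : Prop :=
  [/\ closed (suppX M : set 'rV[R]_dx),
      L (setT `*` suppX M) = 1%E &
      forall C : set XT, closed (C : set 'rV[R]_dx) ->
        L (setT `*` C) = 1%E -> suppX M `<=` C].

(* Consistency at a point X drawn independently of the sample, in
   probability. *)
Definition consistent m n
    (ghat : forall k, k.-tuple ZT -> XT -> 'M[R]_(m, n))
    (g : XT -> 'M[R]_(m, n)) : Prop :=
  forall eps : R, 0 < eps ->
    (\int[L]_z mu_ext P
       [set w | (eps <= `|ghat k (sample k w) z.2 - g z.2|)%R])%E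
      @[k --> \oo] --> (0 : \bar R).

Definition model_setup : Prop :=
  iid_sampling /\ is_support /\
  (forall a, Aset a -> forall i,
     cond_exp L (fun z => rho M z a i ord0) (fun x => mX M x a i ord0)) /\
  (interior (Theta M) a0.1 /\ {ae L, forall z, mX M z.2 a0 = 0}) /\
  ((forall i j, measurable_fun setT (fun x => Sig M x i j)) /\
   forall x, suppX M x -> pos_def (Sig M x)) /\
  (forall i j, cond_exp L
     (fun z => (rho M z a0 i ord0 - mX M z.2 a0 i ord0)
               * (rho M z a0 j ord0 - mX M z.2 a0 j ord0))
     (fun x => Sig0 M x i j)).

Definition estimator_setup : Prop :=
  (forall n, measurable_fun setT
     (fun p : n.-tuple XT * XT * XT => wgt M p.1.1 p.1.2 p.2)) /\
  (forall a, Aset a ->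
     consistent (fun n (zs : n.-tuple ZT) x => mhat zs x a)
                (fun x => mX M x a)) /\
  consistent (fun n (zs : n.-tuple ZT) x => Sighat M zs x) (Sig M) /\
  (kn M n @[n --> \oo] --> \oo) /\
  (forall h, (0 <= Pen M h)%E) /\
  (lam M n @[n --> \oo] --> (0 : R)) /\
  (forall n, convex_set (Ak (kn M n) : set (convex_lmodType E)) /\
     exists2 a, Ak (kn M n) a & exists2 eps, 0 < eps &
       forall b, hullk (kn M n) b -> norm_s (b - a) < eps -> Ak (kn M n) b) /\
  (forall n zs, Ak (kn M n) (hata M (zs : n.-tuple ZT))) /\
  le_oP P (fun n w => penQ (sample n w) (hata_w n w))
    (fun n w => ereal_inf [set penQ (sample n w) a | a in Ak (kn M n)])
    (@invn R).

Definition restricted_estimator_setup : Prop :=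
  (\forall n \near \oo, forall zs : n.-tuple ZT, AkR n (hataR M zs)) /\
  le_oP P (fun n w => penQ (sample n w) (hataR_w n w))
    (fun n w => ereal_inf [set penQ (sample n w) a | a in AkR n])
    (@invn R).

(* [Aos] is a neighbourhood of a0 relative to the elements of penalty less
   than M0: as the sets of bounded penalty are compact, it could not contain a
   whole ball of an infinite-dimensional H.  Consistently, "M0 is large" is
   read with strict inequalities on penalties. *)
Definition local_setup : Prop :=
  (convex_set (Aos M : set (convex_lmodType E)) /\
   Aos M a0 /\
   (forall n a, Aos M a -> Aset a /\ norm_s (a - a0) < M0 M /\ pen_lt n a) /\
   exists2 eps, 0 < eps & forall n a, Aset a -> norm_s (a - a0) < eps ->
     pen_lt n a -> Aos M a) /\
  ((forall n, pen_lt n (Pia0 n)) /\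
   wpa1 P (fun n => [set w | pen_lt n (hata_w n w)])) /\
  (nonincreasing_seq (deltabar M) /\ (forall n, 0 < deltabar M n) /\
   (deltabar M n @[n --> \oo] --> (0 : R))) /\
  ((forall n, 0 < delta M n <= deltabar M n) /\
   (delta M n @[n --> \oo] --> (0 : R))) /\
  ((\forall n \near \oo, has_ubound (tau_ratios n)) /\
   (delta_s n @[n --> \oo] --> (0 : R))).

Definition riesz_setup : Prop :=
  continuous (phi M : E -> R) /\
  ((forall v, Dir v -> derivable (phi M : E -> R) a0 v) /\
   (forall (c : R) v w, Dir v -> Dir w ->
      phidot (c *: v + w) = c * phidot v + phidot w) /\
   (exists C : R, forall v, Dir v -> `|phidot v| <= C * norm_s v)) /\
  (forall k, hullk k (alpha0k M k) /\
     forall a, hullk k a -> nrm (alpha0k M k - a0) <= nrm (a - a0)) /\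
  (exists2 dm : nat -> nat,
     (\forall n \near \oo, has_dim (Vbark (kn M n)) (dm n) /\
        has_dim (lin_span (Ak (kn M n))) (dm n)) &
     exists c C : R, 0 < c /\ \forall n \near \oo,
       c * (kn M n)%:R <= (dm n)%:R <= C * (kn M n)%:R) /\
  (forall n, Vbark (kn M n) (vstar M n) /\
     forall v, Vbark (kn M n) v -> phidot v = ip (vstar M n) v).

Definition cond_ID : Prop :=
  (forall a, Aset a ->
     ({ae L, forall z, mX M z.2 a = 0} <-> norm_s (a - a0) = 0)) /\
  (compact (Theta M) /\ interior (Theta M) !=set0 /\
   (forall j k, (j <= k)%N -> Hk j `<=` Hk k) /\
   (forall k, Hk k !=set0 /\ closed (Hk k)) /\
   closure (\bigcup_k Hk k) = setT /\
   (forall n, Hk (kn M n) (Pih0 M n)) /\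
   (`|Pih0 M n - a0.2| @[n --> \oo] --> (0 : R))) /\
  (forall a, Aset a -> forall y : R, (y%:E < Q a)%E ->
     exists2 eps : R, 0 < eps & forall b, Aset b -> norm_s (b - a) < eps ->
       (y%:E < Q b)%E) /\
  (exists c C : R, 0 < c /\ forall x, suppX M x ->
     eigenvalues_in (Sig M x) c C /\ eigenvalues_in (Sig0 M x) c C).

(* the o(n^{-1}) term added to Q(Pi_n alpha_0) is some such sequence *)
Definition cond_PEN : Prop :=
  ((forall n, 0 < lam M n) /\
   (exists2 e : nat -> R, (forall n, 0 <= e n) /\ little_o_inv e &
      exists C : R, \forall n \near \oo,
        (Q (Pia0 n) + (e n)%:E <= (C * lam M n)%:E)%E)) /\
  ((exists C : R, \forall n \near \oo,
      (`|Pen M (Pih0 M n) - Pen M a0.2| <= C%:E)%E) /\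
   (Pen M a0.2 < +oo)%E) /\
  (forall C : R, compact [set h | (Pen M h <= C%:E)%E]).

(* Qhat_n(a) >= c Q(a) - O_P(r_n) uniformly over a in S_n *)
Definition unif_lower_bound (S : nat -> set E) (r : nat -> R) : Prop :=
  exists2 c : R, 0 < c & forall eps : R, 0 < eps ->
    exists C : R, \forall n \near \oo,
      (mu_ext P [set w | exists2 a, S n a &
         (Qhat (sample n w) a)%:E < c%:E * Q a - (C * r n)%:E] <= eps%:E)%E.

Definition cond_CRIT : Prop :=
  (exists2 c0 : R, 0 < c0 &
     le_oP P (fun n w => (Qhat (sample n w) (Pia0 n))%:E)
       (fun n _ => c0%:E * Q (Pia0 n))%E (@invn R)) /\
  unif_lower_bound AkM0 (fun n => deltabar M n ^+ 2).

(* The derivative at a0 exists, is linear and square integrable along [Dir];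
   elsewhere in [Aos] paths are the segments of [Aos], along which the
   derivative is continuous, up to a0. *)
Definition pathwise_diff : Prop :=
  (forall v, Dir v ->
     {ae L, forall z, forall i,
        derivable (fun b : E => mX M z.2 b i ord0) a0 v}) /\
  (forall (c : R) v w, Dir v -> Dir w ->
     {ae L, forall z, mdot z.2 (c *: v + w) = c *: mdot z.2 v + mdot z.2 w}) /\
  (forall v, Dir v -> forall i,
     measurable_fun setT (fun x => mdot x v i ord0) /\
     L.-integrable setT (fun z => (mdot z.2 v i ord0 ^+ 2)%:E)) /\
  (forall a b, Aos M a -> Aos M b ->
     {ae L, forall z, forall i,
        (forall t : R, 0 < t < 1 ->
           derivable (fun e : E => mX M z.2 e i ord0)
             (a + t *: (b - a)) (b - a)) /\
        {in `]0, 1[, continuous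
           (fun t : R => mdot_at (a + t *: (b - a)) z.2 (b - a) i ord0)}}) /\
  (forall a, Aos M a ->
     {ae L, forall z, forall i,
        mdot_at (a0 + t *: (a - a0)) z.2 (a - a0) i ord0
          @[t --> (0 : R)^'+] --> mdot z.2 (a - a0) i ord0}).

Definition cond_LOC : Prop :=
  (pathwise_diff /\
   exists C : R, forall a, Aos M a -> nrm (a - a0) <= C * norm_s (a - a0)) /\
  (exists c1 c2 : R, 0 < c1 /\ forall a, Aos M a ->
     ((c1 * nrm (a - a0) ^+ 2)%:E <= Q a <= (c2 * nrm (a - a0) ^+ 2)%:E)%E) /\
  (unif_lower_bound Aosn (fun n => delta M n ^+ 2) /\
   (* the o(n^{-1}) term of the maximum ranges over all such sequences, i.e.
      delta_n is not of smaller order than n^{-1/2} *)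
   forall e : nat -> R, little_o_inv e -> \forall n \near \oo,
     maxe (delta M n ^+ 2)%:E
       (maxe (Q (Pia0 n)) (maxe (lam M n)%:E (e n)%:E))
     = (delta M n ^+ 2)%:E) /\
  (((n%:R * lam M n)%:E *
      ereal_sup [set `|Pen M ab.1.2 - Pen M ab.2.2|%E | ab in Aos M `*` Aos M])%E
      @[n --> \oo] --> (0 : \bar R)
   \/ little_o_inv (lam M)).

Definition cond_PHI : Prop :=
  ((exists2 v, Vspan v & phidot v != 0) /\
   (forall j k, (j <= k)%N -> Vbark j `<=` Vbark k) /\
   (forall k, (exists n, has_dim (Vbark k) n) /\
      forall v, Vbark k v -> nrm v = 0 -> v = 0) /\
   ((forall k, Vbark k `<=` Vbar) /\
    forall v, Vbar v -> forall eps : R, 0 < eps ->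
      exists2 w, (\bigcup_k Vbark k) w & nrm (v - w) < eps) /\
   (nrm (vstar M n) / Num.sqrt n%:R @[n --> \oo] --> (0 : R))) /\
  (ereal_sup [set (Num.sqrt n%:R
       * `|phi M (pert n p.1 p.2) - phi M a0
           - phidot (pert n p.1 p.2 - a0)|
       / nrm (vstar M n))%:E | p in NT n] @[n --> \oo] --> (0 : \bar R)) /\
  (Num.sqrt n%:R * `|phidot (alpha0k M (kn M n) - a0)| / nrm (vstar M n)
     @[n --> \oo] --> (0 : R)).

Definition Lamhat n (zs : n.-tuple ZT) (a b : E) : R :=
  2^-1 * (Qhat zs a - Qhat zs b).

Definition LQA_rem n (w : Omega) (a : E) (t : R) : R :=
  Lamhat (sample n w) (pert n a t) a
  - t * (Zn n w + ip (ustar n) (a - a0))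
  - Bn M (sample n w) / 2 * t ^+ 2.

(* r_n(t) involves some positive o(n^{-1}) sequence; t is signed in
   [t n^{-1/2}]. *)
Definition cond_LQA : Prop :=
  ((\forall n \near \oo, forall p, NT n p -> Ak (kn M n) (pert n p.1 p.2)) /\
   (exists2 e : nat -> R, (forall n, 0 < e n) /\ little_o_inv e &
      oP P (fun n w => ereal_sup
        [set ((maxr (p.2 ^+ 2) (maxr (p.2 / Num.sqrt n%:R) (e n)))^-1
              * `|LQA_rem n w p.1 p.2|)%:E | p in NT n]) (@one_seq R)) /\
   (forall n, measurable_fun setT (@Bn _ _ _ _ _ _ _ _ M n)) /\
   (forall n (zs : n.-tuple ZT), 0 < Bn M zs) /\
   OP P (fun n w => (Bn M (sample n w))%:E) (@one_seq R)) /\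
  cvg_dist P (fun n w => (sqrtnZn n w)%:E) (normal_prob 0 1).

Definition Bn_consistent : Prop :=
  oP P (fun n w => (`|Bn M (sample n w) - nrm (ustar n) ^+ 2|)%:E)
    (@one_seq R).

(* The oscillation of lam_n Pen over the shrinking neighbourhood and over the
   perturbed points a + t u_n^* is o(n^{-1}).  The penalty need not be
   continuous, so the value of Pen at a + t u_n^* is controlled neither by
   membership in the sieve nor by the oscillation of Pen over [Aos], while
   the approximate minimisers have to be compared with these points. *)
Definition pen_perturbation : Prop :=
  ((n%:R * lam M n)%:E *
     ereal_sup [set `|Pen M (pert n p.1.1 p.1.2).2 - Pen M p.2.2|%E
                  | p in NT n `*` Nosn n])%E
    @[n --> \oo] --> (0 : \bar R).

Definition wilks (X : nat -> Omega -> \bar R) : Prop :=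
  oP P (fun n w => X n w - (sqrtnZn n w ^+ 2)%:E)%E (@one_seq R) /\
  cvg_dist P X (@chi2_1 R).

End Model.

(* Main.v *)
Require Import Defs.
From HB Require Import structures.
From mathcomp Require Import all_boot all_order all_algebra.
From mathcomp Require Import all_classical all_reals all_analysis measurable_realfun.
From mathcomp Require Import ring lra.

Set Implicit Arguments.
Unset Strict Implicit.
Unset Printing Implicit Defensive.

Import Order.TTheory GRing.Theory Num.Theory.
Import numFieldNormedType.Exports.
Local Open Scope classical_set_scope.
Local Open Scope ring_scope.


(** The theorem holds because the sample criterion is, near alpha0 and along the
    direction ustar, a quadratic function of the step with the same curvature
    at every local point; a profile likelihood ratio of such a criterion is the
    square of the score divided by the curvature.

    Write z for sqrt(n) Z_n, U for the squared norm of ustar, and y(a) for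
    sqrt(n) times the inner product of ustar with a - alpha0. In the scale
    t = tau / sqrt(n), the local quadratic approximation says that
    n (Qhat(a + t ustar) - Qhat(a)) is 2 tau (z + y(a)) + U tau^2 up to a small
    error, and the Riesz representation says that phi(a + t ustar) - phi(alpha0)
    is proportional to y(a) + tau U up to a small error. Three comparisons of
    approximate minimisers then determine the statistic
    ([qlr_expansion]): the unrestricted estimator against its own small
    perturbations gives the first-order condition y = - z; the unrestricted
    estimator against the restricted one moved by the Newton step - z / U
    bounds the statistic from below by z^2 / U, because y vanishes to first order
    at the restricted estimator; and the restricted estimator against the
    unrestricted one, moved by about z / U back to the constraint (the
    intermediate value theorem supplies the exact step), bounds it from above.

    The rest makes these comparisons legitimate. The weighted inner product is
    well behaved on all directions in use since the weights have eigenvalues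
    bounded away from 0 and infinity ([weight_bounds]). The closed span of the
    local sieve fills the sieve space by a dimension count
    ([near_Vbark_hullk]), so the Riesz identity applies to every local point
    ([ip_ustar]). The unrestricted estimator is consistent, since Q stays away
    from 0 outside neighbourhoods of alpha0 ([Q_separated]), and then falls into
    the shrinking neighbourhood ([hata_Nosn]). The perturbations of order
    n^{-1/2} are allowed because delta_n is not of smaller order
    ([near_delta_rate]) and M_n tends to infinity ([near_Mn_ge]). The limit law
    follows by squaring an asymptotically normal variable
    ([cvg_dist_chi2]). Under optimal weighting the norm of ustar is 1
    ([ustar_opt]), so no rescaling is left. *)

(** * Quadratic expansions of profiled criteria *)

(** The intermediate value theorem between the two points where the affine
    approximation takes the values e and - e. *)
Lemma zero_of_sandwich (R : realType) (F : R -> R) (y U e : R) :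
  continuous F -> 0 < U -> 0 <= e ->
  (forall t, `|t| <= (`|y| + e) / U -> `|F t - (y + t * U)| <= e) ->
  exists2 t, F t = 0 & `|U * t + y| <= e.
Proof.
move=> cF U0 e0 HF.
have bd (a : R) : `|a| <= e -> `|(- y + a) / U| <= (`|y| + e) / U.
  move=> ae; rewrite normrM [ `|U^-1|]gtr0_norm ?invr_gt0 //.
  rewrite ler_pM2r ?invr_gt0 //; apply: (le_trans (ler_normD _ _)).
  by rewrite normrN lerD2l.
have h1 := HF _ (bd e (etrans (congr1 (fun x => x <= e) (ger0_norm e0)) (lexx e))).
have h2 : `|F ((- y + - e) / U) - (y + (- y + - e) / U * U)| <= e.
  by apply: HF; apply: bd; rewrite normrN ger0_norm.
move: h1 h2; rewrite !divfK ?gt_eqF // !ler_norml => /andP[h1 _] /andP[_ h2].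
have le12 : (- y + - e) / U <= (- y + e) / U by rewrite ler_pM2r ?invr_gt0 //; lra.
have [| |t t12 Ft] := @IVT R F _ _ 0 le12.
- by apply: continuous_subspaceT.
- by rewrite ge_min le_max; apply/andP; split; apply/orP; [left|right]; lra.
exists t => //; move: t12; rewrite in_itv /= => /andP[].
rewrite ler_pdivrMr // ler_pdivlMr // => h3 h4.
by rewrite ler_norml; lra.
Qed.

(** Here D and DR are the increments of the scaled criterion from the
    unrestricted and the restricted estimator, X is the scaled difference of the
    criterion between the two, and F is the scaled constraint along the
    perturbations of the unrestricted estimator. *)
Lemma qlr_expansion (R : realType) (k1 k2 K eta : R) :
  0 < k1 -> k1 <= k2 -> 0 <= K -> 0 < eta ->
  exists e T : R, [/\ 0 < e, 0 < T &
  forall (U B z y yR X : R) (D DR F : R -> R),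
    k1 <= U <= k2 -> `|B - U| <= e -> `|z| <= K -> `|yR| <= e ->
    (forall t, `|t| <= T ->
       `|D t - (2 * t * (z + y) + B * t ^+ 2)| <= e * (1 + t ^+ 2)) ->
    (forall t, `|t| <= T ->
       `|DR t - (2 * t * (z + yR) + B * t ^+ 2)| <= e * (1 + t ^+ 2)) ->
    (forall t, `|t| <= T -> - e <= D t) ->
    (forall t, `|t| <= T -> - e <= X + DR t) ->
    continuous F ->
    (forall t, `|t| <= T -> `|F t - (y + t * U)| <= e) ->
    (forall t, `|t| <= T -> F t = 0 -> X - D t <= e) ->
    `|U * X - z ^+ 2| < eta].
Proof.
move=> k10 k12 K0 eta0.
have k20 : 0 < k2 by apply: lt_le_trans k12.
pose C1 := (k2 + 4) / 2; pose C2 := 1 + C1; pose T2 := (K + C2) / k1.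
have C10 : 0 < C1 by rewrite divr_gt0 //; lra.
have C20 : 0 < C2 by rewrite /C2; lra.
have T20 : 0 < T2 by rewrite divr_gt0 //; lra.
pose C := k2 * (2 * T2 * C1 + 2 * T2 ^+ 2 + 2 * T2 + 2) + 2 * K * C2 + C2 ^+ 2.
have C0 : 0 < C.
  have := sqr_ge0 T2; have := sqr_ge0 C2 => a b.
  have : 0 <= T2 * C1 by rewrite mulr_ge0 ?ltW.
  move=> c; rewrite /C; apply: ltr_pwDr; first by rewrite exprn_gt0.
  apply: addr_ge0; last by do ?[exact: ltW | apply: mulr_ge0].
  by apply: mulr_ge0; [rewrite ltW | lra].
(* The first-order condition holds up to the square root of the error e, hence
   e = x^2 while the final error is C x. *)
pose x := Num.min 1 (eta / (2 * C)).
have x0 : 0 < x by rewrite lt_min ltr01 divr_gt0 // mulr_gt0.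
have x1 : x <= 1 by rewrite ge_min lexx.
have xC : C * x < eta.
  have : x <= eta / (2 * C) by rewrite ge_min lexx orbT.
  rewrite ler_pdivlMr ?mulr_gt0 // => h; lra.
have x2 : x ^+ 2 <= x by rewrite expr2 ler_piMr // ltW.
have x20 : 0 < x ^+ 2 by rewrite exprn_gt0.
exists (x ^+ 2), (1 + T2); split => //; first lra.
move=> U B z y yR X D DR F /andP[U1 U2] BU zK yRe HD HDR HD0 HX cF HF HF0.
have U0 : 0 < U by apply: lt_le_trans U1.
have B2 : B <= k2 + 1 by move: BU; rewrite ler_norml => /andP[]; lra.
have foc : `|z + y| <= C1 * x.
  have nx : `|x| <= 1 + T2 by rewrite gtr0_norm //; lra.
  have nx' : `|- x| <= 1 + T2 by rewrite normrN.
  have := HD _ nx; have := HD _ nx'; have := HD0 _ nx; have := HD0 _ nx'.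
  rewrite !ler_norml sqrrN => a1 a2 /andP[_ a3] /andP[_ a4].
  have Bx : B * x ^+ 2 <= (k2 + 1) * x ^+ 2 by rewrite ler_wpM2r // ltW.
  have x4 : x ^+ 2 * (1 + x ^+ 2) <= 2 * x ^+ 2.
    by rewrite mulrC ler_wpM2r ?(ltW x20) //; lra.
  have h1 : x * (z + y) <= x * (C1 * x) by rewrite /C1; lra.
  have h2 : x * - (z + y) <= x * (C1 * x) by rewrite /C1; lra.
  by move: h1 h2; rewrite !ler_pM2l // => h1 h2; apply/andP; split; lra.
have KT : (K / k1) <= T2 by rewrite ler_pM2r ?invr_gt0 //; lra.
(* The restricted estimator is moved by the Newton step - z / U. *)
have lower : z ^+ 2 - C * x <= U * X.
  pose t := - z / U.
  have Ut : U * t = - z by rewrite /t mulrC divfK // gt_eqF.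
  have tT : `|t| <= T2.
    apply: le_trans KT; rewrite /t normrM normrN [ `|U^-1|]gtr0_norm ?invr_gt0 //.
    by apply: ler_pM => //; [rewrite invr_ge0 ltW | rewrite lef_pV2].
  have tT' : `|t| <= 1 + T2 by lra.
  have := HDR _ tT'; have := HX _ tT'; rewrite ler_norml => a1 /andP[_ a2].
  have t2 : t ^+ 2 <= T2 ^+ 2 by rewrite -real_normK ?num_real // lerXn2r // nnegrE ?ltW.
  have tyR : t * yR <= T2 * x ^+ 2.
    by apply: (le_trans (ler_norm _)); rewrite normrM ler_pM.
  have Bt : B * t ^+ 2 <= (U + x ^+ 2) * t ^+ 2.
    by rewrite ler_wpM2r ?sqr_ge0 //; move: BU; rewrite ler_norml; lra.
  have xt : x ^+ 2 * t ^+ 2 <= x ^+ 2 * T2 ^+ 2 by rewrite ler_pM2l.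
  have X1 : X >= - (2 * t * z + U * t ^+ 2) - x ^+ 2 * (2 * T2 + 2 * T2 ^+ 2 + 2).
    by lra.
  have X2 : U * X >= z ^+ 2 - U * (x ^+ 2 * (2 * T2 + 2 * T2 ^+ 2 + 2)).
    have : U * X >= U * (- (2 * t * z + U * t ^+ 2) - x ^+ 2 * (2 * T2 + 2 * T2 ^+ 2 + 2)).
      by rewrite ler_pM2l.
    have -> : U * (- (2 * t * z + U * t ^+ 2) - x ^+ 2 * (2 * T2 + 2 * T2 ^+ 2 + 2))
      = - (2 * (U * t) * z + (U * t) ^+ 2) - U * (x ^+ 2 * (2 * T2 + 2 * T2 ^+ 2 + 2)) by ring.
    by rewrite Ut; have -> : - (2 * - z * z + (- z) ^+ 2) = z ^+ 2 by ring.
  apply: le_trans X2; rewrite lerD2l lerN2 /C.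
  have w0 : 0 <= 2 * T2 + 2 * T2 ^+ 2 + 2 by have := sqr_ge0 T2; lra.
  have : U * (x ^+ 2 * (2 * T2 + 2 * T2 ^+ 2 + 2)) <= k2 * (x * (2 * T2 + 2 * T2 ^+ 2 + 2)).
    apply: ler_pM => //; [lra | by rewrite mulr_ge0 // ltW | by rewrite ler_wpM2r].
  have p1 : 0 <= k2 * (T2 * C1) * x by do ?[exact: ltW | apply: mulr_ge0].
  have p2 : 0 <= K * C2 * x by do ?[exact: ltW | apply: mulr_ge0].
  have p3 : 0 <= C2 ^+ 2 * x by rewrite mulr_ge0 ?sqr_ge0 ?(ltW x0).
  by move=> h; lra.
(* The unrestricted estimator is moved onto the constraint. *)
have upper : U * X <= z ^+ 2 + C * x.
  have yK : `|y| + x ^+ 2 <= K + C2.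
    have -> : y = (z + y) - z by ring.
    have := ler_normB (z + y) z => h.
    have : C1 * x <= C1 by rewrite ler_piMr // ltW.
    by rewrite /C2; lra.
  have [|t Ft Uty] := @zero_of_sandwich R F y U (x ^+ 2) cF U0 (ltW x20).
    move=> t tb; apply: HF; apply: (le_trans tb).
    apply: (@le_trans _ _ T2); last lra.
    apply: ler_pM => //; first by rewrite addr_ge0 // ltW.
    - by rewrite invr_ge0 ltW.
    - by rewrite lef_pV2.
  have Utz : `|U * t - z| <= C2 * x.
    have -> : U * t - z = (U * t + y) - (z + y) by ring.
    by apply: (le_trans (ler_normB _ _)); rewrite /C2; lra.
  have UtK : `|U * t| <= K + C2.
    have -> : U * t = (U * t - z) + z by ring.
    apply: (le_trans (ler_normD _ _)).
    have : C2 * x <= C2 by rewrite ler_piMr // ltW.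
    lra.
  have tT : `|t| <= T2.
    rewrite /T2 ler_pdivlMr // mulrC; apply: le_trans UtK.
    by rewrite normrM (gtr0_norm U0) ler_wpM2r.
  have tT' : `|t| <= 1 + T2 by lra.
  have := HD _ tT'; have := HF0 _ tT' Ft; rewrite ler_norml => a1 /andP[_ a2].
  have t2 : t ^+ 2 <= T2 ^+ 2 by rewrite -real_normK ?num_real // lerXn2r // nnegrE ?ltW.
  have tzy : t * (z + y) <= T2 * (C1 * x).
    by apply: (le_trans (ler_norm _)); rewrite normrM ler_pM.
  have Bt : B * t ^+ 2 <= (U + x ^+ 2) * t ^+ 2.
    by rewrite ler_wpM2r ?sqr_ge0 //; move: BU; rewrite ler_norml; lra.
  have xt : x ^+ 2 * t ^+ 2 <= x * T2 ^+ 2.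
    by apply: ler_pM => //; rewrite ?sqr_ge0 // ltW.
  have X1 : X <= U * t ^+ 2 + x * (2 * T2 * C1 + 2 * T2 ^+ 2 + 2) by lra.
  have X2 : U * X <= (U * t) ^+ 2 + k2 * (x * (2 * T2 * C1 + 2 * T2 ^+ 2 + 2)).
    have : U * X <= U * (U * t ^+ 2 + x * (2 * T2 * C1 + 2 * T2 ^+ 2 + 2)).
      by rewrite ler_pM2l.
    have w0 : 0 <= 2 * T2 * C1 + 2 * T2 ^+ 2 + 2.
      have := sqr_ge0 T2; have : 0 <= T2 * C1 by rewrite mulr_ge0 ?ltW.
      lra.
    have w1 : U * (x * (2 * T2 * C1 + 2 * T2 ^+ 2 + 2)) <=
      k2 * (x * (2 * T2 * C1 + 2 * T2 ^+ 2 + 2)).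
      by rewrite ler_wpM2r // mulr_ge0 // ltW.
    by move=> h; rewrite exprMn [U ^+ 2]expr2 -mulrA; rewrite mulrDr in h; lra.
  apply: (le_trans X2).
  have Ut2 : (U * t) ^+ 2 <= z ^+ 2 + 2 * K * C2 * x + C2 ^+ 2 * x.
    have -> : (U * t) ^+ 2 = z ^+ 2 + 2 * (z * (U * t - z)) + (U * t - z) ^+ 2 by ring.
    have c1 : z * (U * t - z) <= K * (C2 * x).
      by apply: (le_trans (ler_norm _)); rewrite normrM ler_pM.
    have c2 : (U * t - z) ^+ 2 <= (C2 * x) ^+ 2.
      by rewrite -real_normK ?num_real // lerXn2r // nnegrE // ?mulr_ge0 // ltW.
    have c3 : (C2 * x) ^+ 2 <= C2 ^+ 2 * x by rewrite exprMn ler_pM2l // exprn_gt0.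
    lra.
  have p2 : 0 <= k2 * T2 * x by do ?[exact: ltW | apply: mulr_ge0].
  by rewrite /C; lra.
by rewrite ltr_norml; lra.
Qed.

(** * Spans, dimensions and Rayleigh quotients *)

(** A quadratic polynomial that is nonnegative and vanishes at 0 has no linear
    term: evaluate it at - b / (q + 1). *)
Lemma quad_nonneg_linear0 (R : realType) (b q : R) :
  (forall t, 0 <= 2 * t * b + t ^+ 2 * q) -> b = 0.
Proof.
move=> H; have q0 : 0 <= q by have := H 1; have := H (-1); rewrite sqrrN; lra.
apply/eqP; rewrite -sqrf_eq0 eq_le sqr_ge0 andbT leNgt; apply/negP => b0.
have := H (- b / (q + 1)); have q1 : q + 1 != 0 by lra.
have -> : 2 * (- b / (q + 1)) * b + (- b / (q + 1)) ^+ 2 * q =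
  - (b ^+ 2 * (q + 2)) / (q + 1) ^+ 2 by field.
rewrite leNgt pmulr_llt0 ?invr_gt0 ?exprn_gt0 //; last lra.
by rewrite oppr_lt0 mulr_gt0 //; lra.
Qed.

Section Span.
Context (R : realType) (V : lmodType R).

Definition subspace (P : set V) : Prop :=
  P 0 /\ forall c v w, P v -> P w -> P (c *: v + w).

Lemma subspaceD (P : set V) v w : subspace P -> P v -> P w -> P (v + w).
Proof. by move=> [_ H] Pv Pw; rewrite -[v]scale1r; apply: H. Qed.

Lemma subspaceZ (P : set V) c v : subspace P -> P v -> P (c *: v).
Proof. by move=> [P0 H] Pv; rewrite -[c *: v]addr0; apply: H. Qed.

Lemma subspaceB (P : set V) v w : subspace P -> P v -> P w -> P (v - w).
Proof.
move=> sP Pv Pw; apply: subspaceD => //.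
by rewrite -scaleN1r; apply: subspaceZ.
Qed.

Lemma subspace_sum (P : set V) n (f : 'I_n -> V) :
  subspace P -> (forall i, P (f i)) -> P (\sum_i f i).
Proof.
move=> sP Pf; elim/big_ind : _ => //; first by case: sP.
by move=> x y; apply: subspaceD.
Qed.

Lemma lin_span_min (S P : set V) : subspace P -> S `<=` P -> lin_span S `<=` P.
Proof.
move=> sP SP v [n [c [s [Ss ->]]]]; apply: subspace_sum => // i.
by apply: subspaceZ => //; apply/SP/Ss.
Qed.

Lemma sub_lin_span (S : set V) : S `<=` lin_span S.
Proof.
move=> v Sv; exists 1%N, (fun=> 1), (fun=> v); split => //.
by rewrite big_ord1 scale1r.
Qed.

Lemma subspace_lin_span (S : set V) : subspace (lin_span S).
Proof.
split; first by exists 0%N, (fun=> 0), (fun=> 0); split=> [[]//|]; rewrite big_ord0.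
move=> a v w [n [c [s [Ss ->]]]] [m [d [t [St ->]]]].
exists (n + m)%N,
  (fun i => match fintype.split i with inl j => a * c j | inr k => d k end),
  (fun i => match fintype.split i with inl j => s j | inr k => t k end); split.
  by move=> i; case: fintype.split.
rewrite big_split_ord /= scaler_sumr; congr (_ + _); apply: eq_bigr => i _.
  by rewrite (unsplitK (inl i)) scalerA.
by rewrite (unsplitK (inr i)).
Qed.

Lemma lin_span_rangeP n (b : 'I_n -> V) v :
  lin_span (range b) v <-> exists c : 'rV[R]_n, v = \sum_i c ord0 i *: b i.
Proof.
split; last first.
  move=> [c ->]; apply: subspace_sum; first exact: subspace_lin_span.
  move=> i; apply: subspaceZ; first exact: subspace_lin_span.
  by apply: sub_lin_span; exists i.
move: v; apply: (@lin_span_min _ [set v | exists c : 'rV[R]_n, v = \sum_i c ord0 i *: b i]).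
  split.
    by exists 0; rewrite big1 // => i _; rewrite mxE scale0r.
  move=> a _ _ [c ->] [d ->]; exists (a *: c + d).
  rewrite scaler_sumr -big_split; apply: eq_bigr => i _ /=.
  by rewrite !mxE scalerDl scalerA.
move=> _ [i _ <-]; exists (delta_mx ord0 i); rewrite (bigD1 i) //= mxE !eqxx scale1r.
by rewrite big1 ?addr0 // => j ji; rewrite mxE eqxx (negbTE ji) scale0r.
Qed.

(** Coordinates of the [b i] on the [b' j] form a row-free matrix: a vanishing
    combination of its rows is a vanishing combination of the [b i]. *)
Lemma free_in_span m k (b : 'I_m -> V) (b' : 'I_k -> V) :
  (forall c : 'I_m -> R, \sum_i c i *: b i = 0 -> forall i, c i = 0) ->
  (forall i, lin_span (range b') (b i)) ->
  (m <= k)%N /\ (m = k -> forall j, lin_span (range b) (b' j)).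
Proof.
move=> free sub.
have [A Ab] : exists A : 'M[R]_(m, k), forall i, b i = \sum_j A i j *: b' j.
  have /choice[f Hf] : forall i, exists c : 'rV[R]_k, b i = \sum_j c ord0 j *: b' j.
    by move=> i; apply/lin_span_rangeP/sub.
  by exists (\matrix_(i, j) f i ord0 j) => i; rewrite Hf; apply: eq_bigr => j _; rewrite mxE.
have Aul (u : 'rV[R]_m) : \sum_i u ord0 i *: b i = \sum_j (u *m A) ord0 j *: b' j.
  under eq_bigr do rewrite Ab scaler_sumr.
  rewrite exchange_big; apply: eq_bigr => j _; rewrite mxE scaler_suml.
  by apply: eq_bigr => i _; rewrite scalerA.
have rfA : row_free A.
  apply: inj_row_free => u uA0; apply/rowP => i; rewrite mxE.
  apply: (free (fun i => u ord0 i)); rewrite Aul uA0.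
  by rewrite big1 // => j _; rewrite mxE scale0r.
split; first by move: rfA; rewrite /row_free => /eqP <-; exact: rank_leq_col.
move=> mk; subst k => j; apply/lin_span_rangeP.
exists (delta_mx ord0 j *m invmx A); rewrite Aul mulmxKV -?row_free_unit //.
rewrite (bigD1 j) //= mxE !eqxx scale1r.
by rewrite big1 ?addr0 // => i ji; rewrite mxE eqxx (negbTE ji) scale0r.
Qed.

Lemma has_dim_sub_eq (S S' : set V) n :
  has_dim S n -> has_dim S' n -> S `<=` S' -> S = S'.
Proof.
move=> [b [fb ->]] [b' [fb' ->]] sub; apply/seteqP; split => // v.
have [_ /(_ erefl) H] := @free_in_span _ _ b b' fb
  (fun i => sub _ (@sub_lin_span (range b) _ (imageT b i))).
apply: lin_span_min; first exact: subspace_lin_span.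
by move=> _ [j _ <-].
Qed.

(** Exchange argument against the one-vector family w. *)
Lemma has_dim_line (S : set V) n w :
  has_dim S n -> (forall v, S v -> exists c, v = c *: w) -> (n <= 1)%N.
Proof.
move=> [b [fb eS]] line.
suff [] : (n <= 1)%N /\ (n = 1%N -> forall j : 'I_1, lin_span (range b) w) by [].
apply: (@free_in_span n 1 b (fun=> w) fb) => i.
have [|c ->] := line (b i).
  by rewrite eS; apply: sub_lin_span; exists i.
by apply/lin_span_rangeP; exists (const_mx c); rewrite big_ord1 mxE.
Qed.

End Span.

Lemma continuous_sum (R : realType) (T : topologicalType) (I : Type)
    (r : seq I) (F : I -> T -> R) :
  (forall i, continuous (F i)) -> continuous (fun x => \sum_(i <- r) F i x).
Proof.
move=> cF; apply: continuous_big => //; exact: add_continuous.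
Qed.

Section Rayleigh.
Context (R : realType) (n : nat).
Implicit Types (S : 'M[R]_n) (x y : 'rV[R]_n).

Let qf S x := (x *m S *m x^T) ord0 ord0.
Let sq x := \sum_i x ord0 i ^+ 2.

Let qfE S x : qf S x = \sum_j (\sum_i x ord0 i * S i j) * x ord0 j.
Proof. by rewrite /qf mxE; apply: eq_bigr => j _; rewrite !mxE. Qed.

Let sqE x : sq x = (x *m x^T) ord0 ord0.
Proof. by rewrite mxE; apply: eq_bigr => i _; rewrite mxE. Qed.

Let sq_ge0 x : 0 <= sq x.
Proof. by apply: sumr_ge0 => i _; apply: sqr_ge0. Qed.

Let sq_eq0 x : sq x = 0 -> x = 0.
Proof.
move=> /eqP; rewrite psumr_eq0; last by move=> i _; apply: sqr_ge0.
move=> /allP H; apply/rowP => i; rewrite mxE; apply/eqP.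
by rewrite -sqrf_eq0; apply: (H i); rewrite mem_index_enum.
Qed.

Let cont_coord i : continuous (fun x => x ord0 i).
Proof. by move=> x; apply: coord_continuous. Qed.

Let cont_sq : continuous sq.
Proof.
apply: continuous_sum => i x.
by apply: (@continuous_comp _ _ _ (fun y => y ord0 i) (fun a : R => a ^+ 2));
  [exact: cont_coord|exact: exprn_continuous].
Qed.

Let cont_qf S : continuous (qf S).
Proof.
have -> : qf S = fun x => \sum_j (\sum_i x ord0 i * S i j) * x ord0 j.
  by apply/funext => x; rewrite qfE.
have cont_col j : continuous (fun x => \sum_i x ord0 i * S i j).
  apply: continuous_sum => i x.
  by apply: continuousM; [exact: cont_coord|exact: cst_continuous].
apply: continuous_sum => j x.
by apply: continuousM; [exact: cont_col|exact: cont_coord].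
Qed.

Let qfD S x y t : qf S (x + t *: y) = qf S x + t * (x *m S *m y^T) ord0 ord0
   + t * (y *m S *m x^T) ord0 ord0 + t ^+ 2 * qf S y.
Proof.
have trD : (x + t *: y)^T = x^T + t *: y^T by apply/matrixP => i j; rewrite !mxE.
rewrite /qf trD !mulmxDl !mulmxDr -!scalemxAl -!scalemxAr.
move: (x *m S *m x^T) (x *m S *m y^T) (y *m S *m x^T) (y *m S *m y^T).
by move=> M1 M2 M3 M4; rewrite !mxE; ring.
Qed.

(** A minimiser of [x S x^T] on the unit sphere is an eigenvector, because the
    form minus its minimum is nonnegative and vanishes there. *)
Lemma rayleigh_ge S c : S^T = S -> (forall a, eigenvalue S a -> c <= a) ->
  forall x, c * \sum_i x ord0 i ^+ 2 <= (x *m S *m x^T) ord0 ord0.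
Proof.
move=> symS Hc x; rewrite -/(sq x) -/(qf S x).
have [->|x0] := eqVneq x 0.
  by rewrite /qf !mul0mx mxE /sq big1 ?mulr0 // => i _; rewrite mxE expr0n.
have sqx0 : 0 < sq x.
  by rewrite lt_neqAle sq_ge0 andbT eq_sym; apply: contra x0 => /eqP/sq_eq0 ->.
have qfZ a y : qf S (a *: y) = a ^+ 2 * qf S y.
  by rewrite /qf linearZ /= -scalemxAl -scalemxAl -scalemxAr scalerA mxE expr2.
have sqZ a y : sq (a *: y) = a ^+ 2 * sq y.
  by rewrite /sq mulr_sumr; apply: eq_bigr => i _; rewrite mxE exprMn.
pose nz y : 'rV[R]_n := (Num.sqrt (sq y))^-1 *: y.
have nz1 y : 0 < sq y -> sq (nz y) = 1.
  by move=> y0; rewrite sqZ exprVn sqr_sqrtr ?(ltW y0) // mulVf // gt_eqF.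
pose A := [set y | sq y = 1].
have cA : compact A.
  apply: bounded_closed_compact.
    exists 1; split => // M M1 y /= Ay; apply: le_trans (ltW M1).
    rewrite [leLHS]/Num.Def.normr /= mx_normrE; apply/bigmax_leP; split => // -[i j] _ /=.
    rewrite (ord1 i) -(@ler_pXn2r _ 2) // ?nnegrE // expr1n real_normK ?num_real //.
    rewrite -Ay /sq (bigD1 j) //= lerDl sumr_ge0 // => k _; exact: sqr_ge0.
  have -> : A = sq @^-1` [set 1] by [].
  by apply: closed_comp; [move=> y _; exact: cont_sq|exact: closed_eq].
have A0 : A !=set0 by exists (nz x); apply: nz1.
have [v /set_mem vA vmin] := compact_EVT_min A0 cA (continuous_subspaceT (@cont_qf S)).
pose mu := qf S v.
have muP y : 0 <= qf (S - mu%:M) y.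
  have -> : qf (S - mu%:M) y = qf S y - mu * sq y.
    by rewrite sqE /qf mulmxBr mulmxBl mul_mx_scalar -scalemxAl !mxE.
  have [y0|] := ltP 0 (sq y); last first.
    move=> y0; have /sq_eq0 -> : sq y = 0 by apply/eqP; rewrite eq_le y0 sq_ge0.
    by rewrite /qf !mul0mx mxE /sq big1 ?mulr0 ?subr0 // => i _; rewrite mxE expr0n.
  have := vmin (nz y) (mem_set (nz1 _ y0)); rewrite -/mu qfZ exprVn sqr_sqrtr ?(ltW y0) //.
  by rewrite [_^-1 * _]mulrC ler_pdivlMr // subr_ge0.
have vz : v *m (S - mu%:M) = 0.
  pose T := S - mu%:M.
  have symT : T^T = T by rewrite /T linearB /= symS tr_scalar_mx.
  have qv : qf T v = 0.
    rewrite /qf mulmxBr mulmxBl mul_mx_scalar -scalemxAl !mxE.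
    move: vA; rewrite /A /= sqE mxE => ->; rewrite mulr1.
    by apply/eqP; rewrite subr_eq0 /mu /qf mxE.
  have orth (w : 'rV[R]_n) : (v *m T *m w^T) ord0 ord0 = 0.
    have := @quad_nonneg_linear0 R ((v *m T *m w^T) ord0 ord0) (qf T w); apply => t.
    have := muP (v + t *: w); rewrite -/T.
    have sym2 : (w *m T *m v^T) ord0 ord0 = (v *m T *m w^T) ord0 ord0.
      have -> : w *m T *m v^T = (v *m T *m w^T)^T.
        by rewrite !trmx_mul trmxK symT mulmxA.
      by rewrite mxE.
    rewrite qfD.
    by rewrite qv sym2 => h; lra.
  apply/rowP => j; have := orth (delta_mx ord0 j).
  by rewrite trmx_delta -colE mxE => ->; rewrite mxE.
have : eigenvalue S mu.
  apply/eigenvalueP; exists v.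
    by move: vz; rewrite mulmxBr mul_mx_scalar => /eqP; rewrite subr_eq0 => /eqP.
  apply/eqP => v0; move: vA; rewrite /A /= v0 /sq big1 => [/eqP|i _].
    by rewrite eq_sym oner_eq0.
  by rewrite mxE expr0n.
move=> /Hc cmu.
have := muP x.
have -> : qf (S - mu%:M) x = qf S x - mu * sq x.
  by rewrite sqE /qf mulmxBr mulmxBl mul_mx_scalar -scalemxAl !mxE.
rewrite subr_ge0; apply: le_trans.
by rewrite ler_pM2r.
Qed.

Lemma rayleigh_le S C : S^T = S -> (forall a, eigenvalue S a -> a <= C) ->
  forall x, (x *m S *m x^T) ord0 ord0 <= C * \sum_i x ord0 i ^+ 2.
Proof.
move=> symS HC x.
have := @rayleigh_ge (- S) (- C) _ _ x.
rewrite mulmxN mulNmx mxE mulNr lerN2; apply; first by rewrite linearN /= symS.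
move=> a /eigenvalueP[v va v0]; rewrite lerNl; apply: HC.
by apply/eigenvalueP; exists v => //; rewrite scaleNr -va mulmxN opprK.
Qed.

End Rayleigh.

(** * Quadratic forms of positive definite weights *)

Section SPD.
Context (R : realType) (n : nat).
Implicit Types (S : 'M[R]_n) (v w m : 'cV[R]_n).

Definition sqn v : R := \sum_i v i ord0 ^+ 2.

Lemma sqn_ge0 v : 0 <= sqn v.
Proof. by apply: sumr_ge0 => i _; apply: sqr_ge0. Qed.

Lemma sqn_eq0 v : sqn v = 0 -> v = 0.
Proof.
move=> /eqP; rewrite psumr_eq0; last by move=> i _; apply: sqr_ge0.
move=> /allP H; apply/colP => i; rewrite mxE; apply/eqP.
by rewrite -sqrf_eq0; apply: (H i); rewrite mem_index_enum.
Qed.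

(** Young's inequality, weighted so that the second term can be absorbed. *)
Lemma dot_le v w a : 0 < a ->
  `|(v^T *m w) ord0 ord0| <= (sqn v / a + a * sqn w) / 2.
Proof.
move=> a0; rewrite mxE; apply: (le_trans (ler_norm_sum _ _ _)).
rewrite /sqn mulr_suml mulr_sumr -big_split mulr_suml.
apply: ler_sum => i _ /=; rewrite mxE normrM.
have := sqr_ge0 (`|v i ord0| - a * `|w i ord0|).
rewrite sqrrB exprMn !real_normK ?num_real // => h.
rewrite -(@ler_pM2l _ (2 * a)) ?mulr_gt0 //.
have -> : 2 * a * ((v i ord0 ^+ 2 / a + a * w i ord0 ^+ 2) / 2) =
  v i ord0 ^+ 2 + a ^+ 2 * w i ord0 ^+ 2 by field; rewrite gt_eqF.
lra.
Qed.

Definition spd_bounded S (c C : R) : Prop :=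
  S^T = S /\ forall v, c * sqn v <= (v^T *m S *m v) ord0 ord0 <= C * sqn v.

Lemma eigenvalues_spd S c C : S^T = S -> eigenvalues_in S c C -> spd_bounded S c C.
Proof.
move=> symS ev; split => // v.
have -> : sqn v = \sum_i v^T ord0 i ^+ 2 by apply: eq_bigr => i _; rewrite mxE.
have := @rayleigh_ge _ _ S c symS (fun a Ha => proj1 (andP (ev a Ha))) v^T.
have := @rayleigh_le _ _ S C symS (fun a Ha => proj2 (andP (ev a Ha))) v^T.
by rewrite trmxK => -> ->.
Qed.

Lemma spd_unit S c C : 0 < c -> spd_bounded S c C -> S \in unitmx.
Proof.
move=> c0 [symS bS]; rewrite -row_free_unit; apply: inj_row_free => v vS.
have /andP[+ _] := bS v^T; rewrite trmxK vS mul0mx mxE pmulr_rle0 // => h.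
have /sqn_eq0 /(congr1 trmx) : sqn v^T = 0 by apply/eqP; rewrite eq_le h sqn_ge0.
by rewrite trmxK trmx0.
Qed.

Section Bounded.
Variables (S : 'M[R]_n) (c C : R).
Hypotheses (c0 : 0 < c) (SS : spd_bounded S c C).
Let symS : S^T = S. Proof. by case: SS. Qed.
Let unS : S \in unitmx. Proof. exact: spd_unit SS. Qed.

Lemma spd_inv_sym : (invmx S)^T = invmx S.
Proof. by rewrite trmx_inv symS. Qed.

Lemma wformE m : wform S m m =
  ((invmx S *m m)^T *m S *m (invmx S *m m)) ord0 ord0.
Proof.
by rewrite /wform trmx_mul spd_inv_sym -!mulmxA mulKVmx.
Qed.

Lemma wform_dot m1 m2 : wform S m1 m2 = (m1^T *m (invmx S *m m2)) ord0 ord0.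
Proof. by rewrite /wform mulmxA. Qed.

Lemma wform_bounds m :
  c * sqn (invmx S *m m) <= wform S m m <= C * sqn (invmx S *m m).
Proof. by rewrite wformE; case: SS => _; apply. Qed.

(** Cauchy-Schwarz in the form c |w|^2 <= w' S w = m' w for w = S^{-1} m, where
    Young's inequality absorbs half of the left side. *)
Lemma sqn_inv_le m : sqn (invmx S *m m) <= sqn m / c ^+ 2.
Proof.
have := wform_bounds m => /andP[h _].
have := le_trans (ler_norm _) (dot_le m (invmx S *m m) c0).
rewrite -wform_dot => h2.
have h3 : c * sqn (invmx S *m m) <= sqn m / c by lra.
rewrite ler_pdivlMr ?exprn_gt0 //; rewrite ler_pdivlMr // in h3.
by rewrite expr2; lra.
Qed.

Lemma wform_ge0 m : 0 <= wform S m m.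
Proof.
have /andP[+ _] := wform_bounds m; apply: le_trans.
by rewrite mulr_ge0 ?sqn_ge0 // ltW.
Qed.

Lemma wform_eq0 m : wform S m m = 0 -> m = 0.
Proof.
move=> w0; have /andP[+ _] := wform_bounds m; rewrite w0 pmulr_rle0 // => h.
have /sqn_eq0 h' : sqn (invmx S *m m) = 0 by apply/eqP; rewrite eq_le h sqn_ge0.
by rewrite -(mulKVmx unS m) h' mulmx0.
Qed.

Lemma wform_sym m1 m2 : wform S m1 m2 = wform S m2 m1.
Proof.
rewrite /wform; have -> : m2^T *m invmx S *m m1 = (m1^T *m invmx S *m m2)^T.
  by rewrite !trmx_mul trmxK spd_inv_sym mulmxA.
by rewrite [in RHS]mxE.
Qed.

Lemma wform_abs_le m1 m2 : `|wform S m1 m2| <= sqn m1 / c + sqn m2 / c.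
Proof.
rewrite wform_dot; apply: (le_trans (dot_le _ _ c0)).
have := sqn_inv_le m2 => h.
have h1 : c * sqn (invmx S *m m2) <= sqn m2 / c.
  have -> : sqn m2 / c = c * (sqn m2 / c ^+ 2) by field; rewrite gt_eqF.
  by rewrite ler_pM2l.
have : 0 <= sqn m1 / c by rewrite divr_ge0 ?sqn_ge0 // ltW.
have : 0 <= sqn m2 / c by rewrite divr_ge0 ?sqn_ge0 // ltW.
lra.
Qed.

End Bounded.

Lemma wform_lin S a m1 m2 m : wform S (a *: m1 + m2) m = a * wform S m1 m + wform S m2 m.
Proof.
have e : (a *: m1 + m2)^T = a *: m1^T + m2^T by apply/matrixP => i j; rewrite !mxE.
rewrite /wform e !mulmxDl -!scalemxAl.
by move: (_ *m m) (m2^T *m _ *m m) => A B; rewrite !mxE.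
Qed.

End SPD.

(** * Measurability and integrals up to null sets *)

Section MeasurableMatrix.
Context (R : realType) (d : measure_display) (T : measurableType d).

Definition mxmeas m n (F : T -> 'M[R]_(m, n)) : Prop :=
  forall i j, measurable_fun setT (fun x => F x i j).

Lemma measurable_inv : measurable_fun setT (GRing.inv : R -> R).
Proof.
have -> : [set: R] = [set 0] `|` ~` [set 0] by rewrite setUv.
apply/measurable_funU => //; first exact: measurableC.
split; first exact: measurable_fun_set1.
apply: open_continuous_measurable_fun; first by apply: closed_openC; exact: closed_eq.
by move=> x /set_mem /eqP x0; apply: inv_continuous.
Qed.

Lemma mxmeas_mul m n p (F : T -> 'M[R]_(m, n)) (G : T -> 'M[R]_(n, p)) :
  mxmeas F -> mxmeas G -> mxmeas (fun x => F x *m G x).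
Proof.
move=> mF mG i j; under eq_fun do rewrite mxE.
by apply: measurable_sum => k; apply: measurable_funM.
Qed.

Lemma mxmeas_tr m n (F : T -> 'M[R]_(m, n)) : mxmeas F -> mxmeas (fun x => (F x)^T).
Proof. by move=> mF i j; under eq_fun do rewrite mxE; exact: mF. Qed.

Lemma measurable_det n (F : T -> 'M[R]_n) :
  mxmeas F -> measurable_fun setT (fun x => \det (F x)).
Proof.
move=> mF; apply: measurable_sum => s; apply: measurable_funM => //.
by apply: measurable_prod => i _.
Qed.

(** Entries of the inverse are cofactors over the determinant. *)
Lemma mxmeas_inv n (F : T -> 'M[R]_n) : mxmeas F -> mxmeas (fun x => invmx (F x)).
Proof.
move=> mF i j.
have mdet := measurable_det mF.
have -> : (fun x => invmx (F x) i j) =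
  (fun x => if \det (F x) == 0 then F x i j
            else (\det (F x))^-1 * cofactor (F x) j i).
  apply/funext => x; rewrite /invmx unitmxE unitfE.
  by case: eqP => // _; rewrite /= !mxE.
apply: measurable_fun_ifT => //.
- by apply: measurable_fun_eqr.
- apply: measurable_funM; first by apply: (measurableT_comp measurable_inv).
  apply: measurable_funM => //; apply: measurable_det => k l.
  by under eq_fun do rewrite !mxE; exact: mF.
Qed.

Lemma measurable_wform n (S : T -> 'M[R]_n) (v w : T -> 'cV[R]_n) :
  mxmeas S -> mxmeas v -> mxmeas w ->
  measurable_fun setT (fun x => wform (S x) (v x) (w x)).
Proof.
move=> mS mv mw; apply: mxmeas_mul => //; apply: mxmeas_mul; first exact: mxmeas_tr.
exact: mxmeas_inv.
Qed.

End MeasurableMatrix.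

Section AlmostEverywhere.
Context (R : realType) (d : measure_display) (T : measurableType d).
Variable mu : {measure set T -> \bar R}.
Implicit Types f g : T -> R.

Lemma ae_Rintegral_eq f g : measurable_fun setT f -> measurable_fun setT g ->
  {ae mu, forall x, f x = g x} -> \int[mu]_x f x = \int[mu]_x g x.
Proof.
move=> mf mg fg; rewrite /Rintegral; congr fine; apply: ae_eq_integral => //.
- exact/measurable_EFinP.
- exact/measurable_EFinP.
- by apply: filterS fg => x /= -> _.
Qed.

Lemma ae_Rintegral_ge0 f : measurable_fun setT f ->
  {ae mu, forall x, 0 <= f x} -> 0 <= \int[mu]_x f x.
Proof.
move=> mf f0; have -> : \int[mu]_x f x = \int[mu]_x `|f x|.
  apply: ae_Rintegral_eq => //; first exact: measurableT_comp.
  by apply: filterS f0 => x /ger0_norm.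
by apply: Rintegral_ge0 => x _.
Qed.

Lemma ae_integrable_le f g : measurable_fun setT f ->
  mu.-integrable setT (EFin \o g) ->
  {ae mu, forall x, `|f x| <= g x} -> mu.-integrable setT (EFin \o f).
Proof.
move=> mf ig fg; apply/integrableP; split; first exact/measurable_EFinP.
move/integrableP : ig => [mg]; apply: le_lt_trans.
apply: ae_ge0_le_integral => //.
- by apply: measurableT_comp => //; exact/measurable_EFinP.
- exact: measurableT_comp.
- by apply: filterS fg => x /= h _; rewrite lee_fin (le_trans h) // ler_norm.
Qed.

Lemma ae_Rintegral_le f g : mu.-integrable setT (EFin \o f) ->
  mu.-integrable setT (EFin \o g) ->
  {ae mu, forall x, f x <= g x} -> \int[mu]_x f x <= \int[mu]_x g x.
Proof.
move=> fi gi fg; rewrite -subr_ge0 -RintegralB //.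
apply: ae_Rintegral_ge0.
  apply: measurable_funB; apply/measurable_EFinP; exact: (measurable_int mu).
by apply: filterS fg => x; rewrite subr_ge0.
Qed.

End AlmostEverywhere.

(** * Semi-inner products *)

Section Form.
Context (R : realType) (V : lmodType R).
Variables (D : set V) (b : V -> V -> R).
Hypotheses (sD : subspace D)
  (b_sym : forall v w, D v -> D w -> b v w = b w v)
  (b_lin : forall c v w x, D v -> D w -> D x -> b (c *: v + w) x = c * b v x + b w x)
  (b_ge0 : forall v, D v -> 0 <= b v v).

Definition fnorm v : R := Num.sqrt (b v v).

Lemma fnorm_sqr v : D v -> fnorm v ^+ 2 = b v v.
Proof. by move=> Dv; rewrite sqr_sqrtr ?b_ge0. Qed.

Lemma fnorm_ge0 v : 0 <= fnorm v. Proof. exact: sqrtr_ge0. Qed.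

Lemma form_addl v w x : D v -> D w -> D x -> b (v + w) x = b v x + b w x.
Proof. by move=> Dv Dw Dx; rewrite -{1}[v]scale1r b_lin // mul1r. Qed.

Lemma form_0l x : D x -> b 0 x = 0.
Proof.
move=> Dx; have [D0 _] := sD; have := form_addl D0 D0 Dx.
by rewrite addr0 -{1}[b 0 x]addr0 => /addrI ->.
Qed.

Lemma form_scalel c v x : D v -> D x -> b (c *: v) x = c * b v x.
Proof.
by move=> Dv Dx; have [D0 _] := sD; rewrite -[c *: v]addr0 b_lin // form_0l // addr0.
Qed.

Lemma form_scaler c v x : D v -> D x -> b x (c *: v) = c * b x v.
Proof.
move=> Dv Dx; have Dcv := subspaceZ c sD Dv.
by rewrite b_sym // form_scalel // b_sym.
Qed.

Lemma form_expand t v w : D v -> D w ->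
  b (v + t *: w) (v + t *: w) = b v v + 2 * t * b w v + t ^+ 2 * b w w.
Proof.
move=> Dv Dw; have Dtw := subspaceZ t sD Dw; have Dvw := subspaceD sD Dv Dtw.
rewrite form_addl // form_scalel // (b_sym Dv) // (b_sym Dw) //.
rewrite !form_addl // !form_scalel // (b_sym Dv Dw); ring.
Qed.

Lemma form_cauchy_schwarz v w : D v -> D w -> b v w ^+ 2 <= b v v * b w w.
Proof.
move=> Dv Dw.
have pos t x y : D x -> D y -> 0 <= b x x + 2 * t * b y x + t ^+ 2 * b y y.
  move=> Dx Dy; rewrite -form_expand //; apply: b_ge0.
  by apply: subspaceD => //; apply: subspaceZ.
have [w0|w0] := eqVneq (b w w) 0.
  rewrite w0 mulr0; have -> : b v w = 0; last by rewrite expr0n.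
  rewrite b_sym //.
  have [//|n0] := eqVneq (b w v) 0.
  have := pos (- (b v v + 1) / (2 * b w v)) v w Dv Dw; rewrite w0 mulr0 addr0.
  have -> : b v v + 2 * (- (b v v + 1) / (2 * b w v)) * b w v = - 1 by field.
  by rewrite lerNr oppr0 ler10.
have w1 : 0 < b w w by rewrite lt_neqAle eq_sym w0 b_ge0.
have := pos (- b w v / b w w) v w Dv Dw.
have -> : b v v + 2 * (- b w v / b w w) * b w v + (- b w v / b w w) ^+ 2 * b w w
  = (b v v * b w w - b w v ^+ 2) / b w w by field.
by rewrite pmulr_lge0 ?invr_gt0 // subr_ge0 (b_sym Dv Dw).
Qed.

Lemma fnormD_le v w : D v -> D w -> fnorm (v + w) <= fnorm v + fnorm w.
Proof.
move=> Dv Dw; rewrite -(@ler_pXn2r _ 2) ?nnegrE ?addr_ge0 ?fnorm_ge0 //.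
rewrite fnorm_sqr; last exact: subspaceD.
rewrite sqrrD !fnorm_sqr //.
have := form_expand 1 Dv Dw; rewrite scale1r => ->.
suff : b w v <= fnorm v * fnorm w by rewrite mulr2n => h; lra.
apply: (le_trans (ler_norm _)); rewrite -(@ler_pXn2r _ 2) ?nnegrE ?mulr_ge0 ?fnorm_ge0 //.
by rewrite real_normK ?num_real // exprMn !fnorm_sqr // b_sym // form_cauchy_schwarz.
Qed.

Lemma fnormB_le v w : D v -> D w -> fnorm (v - w) <= fnorm v + fnorm w.
Proof.
move=> Dv Dw; rewrite -scaleN1r; have Dw' := subspaceZ (-1) sD Dw.
apply: (le_trans (fnormD_le Dv Dw')); rewrite lerD2l /fnorm.
by rewrite form_scaler // form_scalel // !mulN1r opprK.
Qed.

(** First-order condition of the distance minimisation over a subspace. *)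
Lemma form_orth (S : set V) x : subspace S -> S `<=` D -> D x ->
  (forall s, S s -> fnorm x <= fnorm (x + s)) -> forall s, S s -> b s x = 0.
Proof.
move=> sS SD Dx xmin s Ss; have Ds := SD _ Ss.
apply: (@quad_nonneg_linear0 _ _ (b s s)) => t.
have Sts := subspaceZ t sS Ss.
have := xmin _ Sts; rewrite -(@ler_pXn2r _ 2) ?nnegrE ?fnorm_ge0 //.
rewrite !fnorm_sqr //; last by apply: subspaceD => //; apply: SD.
by rewrite form_expand // => h; lra.
Qed.

(** The distance to a line is attained at the projection, even when the
    seminorm of w vanishes. *)
Lemma form_line_closed v w : D v -> D w ->
  (forall eps, 0 < eps -> exists c, fnorm (v - c *: w) < eps) ->
  exists c, fnorm (v - c *: w) = 0.
Proof.
move=> Dv Dw near; pose c0 := b v w / b w w; exists c0.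
have orth : b w (v - c0 *: w) = 0.
  have -> : b w (v - c0 *: w) = b v w - c0 * b w w.
    rewrite b_sym //; last by apply: subspaceB => //; apply: subspaceZ.
    by rewrite addrC -scaleNr b_lin // mulNr addrC.
  have [w0|w0] := eqVneq (b w w) 0; last by rewrite /c0 divfK // subrr.
  rewrite w0 mulr0 subr0; apply/eqP; rewrite -sqrf_eq0 eq_le sqr_ge0 andbT.
  by have := form_cauchy_schwarz Dv Dw; rewrite w0 mulr0.
have Dvc : D (v - c0 *: w) by apply: subspaceB => //; apply: subspaceZ.
apply/eqP; rewrite eq_le fnorm_ge0 andbT leNgt; apply/negP => /near[c].
apply/negP; rewrite -leNgt -(@ler_pXn2r _ 2) ?nnegrE ?fnorm_ge0 // !fnorm_sqr //.
  have -> : v - c *: w = (v - c0 *: w) + (c0 - c) *: w.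
    by rewrite scalerBl addrA subrK.
  by rewrite form_expand // orth mulr0 addr0 lerDl mulr_ge0 ?sqr_ge0 // b_ge0.
by apply: subspaceB => //; apply: subspaceZ.
Qed.

End Form.

(** * The weighted inner product of the model *)

Section CondExp.
Context (R : realType) (dY dX : measure_display)
    (YT : measurableType dY) (XT : measurableType dX)
    (L : probability (YT * XT)%type R).

(** The integral of g' - g over the cylinder where it is positive vanishes. *)
Lemma cond_exp_le (f : YT * XT -> R) (g g' : XT -> R) :
  cond_exp L f g -> cond_exp L f g' -> {ae L, forall z, g' z.2 <= g z.2}.
Proof.
move=> [_ mg ig eg] [_ mg' ig' eg'].
pose B := [set x | g x < g' x].
have mB : measurable B.
  have -> : B = (fun x => g x < g' x) @^-1` [set true] by [].
  by rewrite -[X in measurable X]setTI; apply: measurable_fun_ltr.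
pose D : set (YT * XT) := setT `*` B.
have mD : measurable D by exact: measurableX.
have iDg : L.-integrable D (fun z => (g z.2)%:E) by apply: integrableS ig.
have iDg' : L.-integrable D (fun z => (g' z.2)%:E) by apply: integrableS ig'.
have int0 : (\int[L]_(z in D) `| (g' z.2)%:E - (g z.2)%:E | = 0)%E.
  under eq_integral => z /set_mem [_ zB].
    rewrite gee0_abs; last by rewrite -EFinB lee_fin subr_ge0 ltW.
    over.
  by rewrite integralB // -eg' // -eg // subee // eg //; apply: integrable_fin_num.
have mh : measurable_fun D (fun z => (g' z.2)%:E - (g z.2)%:E)%E.
  by apply: emeasurable_funB; exact: (measurable_int L).
have := (ae_eq_integral_abs L mD mh).1 int0; apply: filterS.
move=> z /= h; rewrite leNgt; apply/negP => lt.
have /eqP : ((g' z.2)%:E - (g z.2)%:E = 0)%E by apply: h; split.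
by rewrite -EFinB eqe subr_eq0 gt_eqF.
Qed.

Lemma cond_exp_unique (f : YT * XT -> R) (g g' : XT -> R) :
  cond_exp L f g -> cond_exp L f g' -> {ae L, forall z, g z.2 = g' z.2}.
Proof.
move=> h h'; have := cond_exp_le h' h; apply: filterS2 (cond_exp_le h h') => z.
by move=> a b; apply/eqP; rewrite eq_le a b.
Qed.

End CondExp.

Section InnerProduct.
Context (R : realType) (dy dx dth drho : nat)
  (H : completeNormedModType R) (d : measure_display)
  (Omega : measurableType d).
Variable M : psmd_model dy dx dth drho H Omega.
Local Notation L := (lawZ M).
Local Notation a0 := (alpha0 M).
Local Notation E := ('rV[R]_dth * H)%type.
Hypotheses (Hmodel : model_setup M) (HID : cond_ID M) (Hpd : pathwise_diff M).

Lemma subspace_hullk k : subspace (@hullk _ _ _ _ _ _ _ _ M k : set E).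
Proof.
split; first by exists (fun=> 0); rewrite /= big1 // => i _; rewrite scale0r.
move=> c v w [f fv] [g gw]; exists (fun i => c * f i + g i) => /=.
rewrite fv gw scaler_sumr -big_split; apply: eq_bigr => i _ /=.
by rewrite scalerDl scalerA.
Qed.

Lemma subspace_Dir : subspace (Dir M).
Proof. exact: subspace_lin_span. Qed.

Lemma hullk_subDir k a : hullk M k a -> Dir M (a - a0).
Proof. by move=> ha; apply: sub_lin_span; exists a => //; right; exists k. Qed.

Lemma hullk_Dir k : hullk M k `<=` Dir M.
Proof.
move=> v hv; have [h0 _] := subspace_hullk k.
have -> : v = (v - a0) - (0 - a0) by rewrite sub0r opprK subrK.
by apply: subspaceB; [exact: subspace_Dir|exact: hullk_subDir hv|exact: hullk_subDir h0].
Qed.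

Lemma Aos_Dir a : Aos M a -> Dir M (a - a0).
Proof. by move=> ha; apply: sub_lin_span; exists a => //; left. Qed.

Lemma ae_suppX : {ae L, forall z, suppX M z.2}.
Proof.
have [_ [[cl L1 _] _]] := Hmodel.
have mS : measurable (suppX M).
  rewrite -[suppX M]setCK; apply: measurableC; apply: sub_sigma_algebra.
  exact: closed_openC.
have mT : measurable ([set: borelV R dy] `*` suppX M).
  exact: measurableX.
exists (~` ([set: borelV R dy] `*` suppX M)); split.
- exact: measurableC.
- by rewrite probability_setC // L1 subee.
- by move=> z nz [_ zS]; apply: nz.
Qed.

Lemma spd_bounded_weaken n (S : 'M[R]_n) c C C' :
  C <= C' -> spd_bounded S c C -> spd_bounded S c C'.
Proof.
move=> CC [sS bS]; split => // v; have /andP[-> h] := bS v.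
by apply: (le_trans h); rewrite ler_wpM2r ?sqn_ge0.
Qed.

(** The matrix Sig0, known only as a conditional expectation, is symmetric
    outside a null set because both entries are versions of the same one. *)
Lemma weight_bounds : exists c C : R, [/\ 0 < c, 0 < C,
  {ae L, forall z, spd_bounded (Sig M z.2) c C} &
  {ae L, forall z, spd_bounded (Sig0 M z.2) c C}].
Proof.
have [_ [_ [_ [_ [[_ Spos] S0]]]]] := Hmodel.
have [_ [_ [_ [c [C [c0 ev]]]]]] := HID.
exists c, (Num.max C 1); split => //; first by rewrite lt_max ltr01 orbT.
  apply: filterS ae_suppX => z zS.
  apply: (@spd_bounded_weaken _ _ _ C); first by rewrite le_max lexx.
  by apply: eigenvalues_spd; [exact: (Spos _ zS).1|exact: (ev _ zS).1].
have sym : {ae L, forall z, forall i j, Sig0 M z.2 i j = Sig0 M z.2 j i}.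
  have ij i j : {ae L, forall z, Sig0 M z.2 i j = Sig0 M z.2 j i}.
    apply: (cond_exp_unique (g' := fun x => Sig0 M x j i) (S0 i j)).
    have := S0 j i.
    by under eq_fun do rewrite mulrC.
  apply: (@filter_forall _ _ (fun i z => forall j, Sig0 M z.2 i j = Sig0 M z.2 j i)).
  move=> i; exact: (@filter_forall _ _ (fun j z => Sig0 M z.2 i j = Sig0 M z.2 j i)).
apply: filterS2 sym ae_suppX => z sz zS.
apply: (@spd_bounded_weaken _ _ _ C); first by rewrite le_max lexx.
apply: eigenvalues_spd; last exact: (ev _ zS).2.
by apply/matrixP => i j; rewrite mxE sz.
Qed.

Lemma Sig_meas : mxmeas (fun z : borelV R dy * borelV R dx => Sig M z.2).
Proof.
have [_ [_ [_ [_ [[mS _] _]]]]] := Hmodel => i j.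
by apply: (measurableT_comp (mS i j)).
Qed.

Lemma Sig0_meas : mxmeas (fun z : borelV R dy * borelV R dx => Sig0 M z.2).
Proof.
have [_ [_ [_ [_ [_ S0]]]]] := Hmodel => i j.
by have [_ m _ _] := S0 i j; apply: (measurableT_comp m).
Qed.

Lemma mX_meas a : Aset M a -> mxmeas (fun z : borelV R dy * borelV R dx => mX M z.2 a).
Proof.
have [_ [_ [ce _]]] := Hmodel => Aa i j.
by have [_ m _ _] := ce _ Aa i; rewrite (ord1 j); apply: (measurableT_comp m).
Qed.

Lemma mdot_meas v : Dir M v ->
  mxmeas (fun z : borelV R dy * borelV R dx => mdot M z.2 v).
Proof.
have [_ [_ [sq _]]] := Hpd => Dv i j.
by have [m _] := sq _ Dv i; rewrite (ord1 j); apply: (measurableT_comp m).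
Qed.

Lemma sqn_mdot_integrable v : Dir M v ->
  L.-integrable setT (fun z => (sqn (mdot M z.2 v))%:E).
Proof.
have [_ [_ [sq _]]] := Hpd => Dv; rewrite /sqn.
under eq_fun do rewrite -sumEFin.
by apply: integrable_sum => // i _; have [] := sq _ Dv i.
Qed.

Section Bounds.
Variables (c C : R).
Hypotheses (c0 : 0 < c) (C0 : 0 < C)
  (bS : {ae L, forall z, spd_bounded (Sig M z.2) c C})
  (bS0 : {ae L, forall z, spd_bounded (Sig0 M z.2) c C}).

Let wf v1 v2 (z : borelV R dy * borelV R dx) :=
  wform (Sig M z.2) (mdot M z.2 v1) (mdot M z.2 v2).

Let wf_meas v1 v2 : Dir M v1 -> Dir M v2 -> measurable_fun setT (wf v1 v2).
Proof.
by move=> D1 D2; apply: measurable_wform; [exact: Sig_meas|exact: mdot_meas..].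
Qed.

(* The weight is bounded below, so the form is dominated by the squares of the
   derivatives, which are integrable. *)
Let wf_integrable v1 v2 : Dir M v1 -> Dir M v2 ->
  L.-integrable setT (EFin \o wf v1 v2).
Proof.
move=> D1 D2.
apply: (@ae_integrable_le _ _ _ _ _
  (fun z => sqn (mdot M z.2 v1) / c + sqn (mdot M z.2 v2) / c)).
- exact: wf_meas.
- have i1 v : Dir M v -> L.-integrable setT (fun z => (c^-1%:E * (sqn (mdot M z.2 v))%:E)%E).
    by move=> Dv; apply: integrableZl => //; exact: sqn_mdot_integrable.
  have := integrableD measurableT (i1 _ D1) (i1 _ D2).
  by apply: eq_integrable => // z _ /=; rewrite EFinD !EFinM !(muleC (c^-1)%:E).
- by apply: filterS bS => z Sz; apply: (wform_abs_le c0 Sz).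
Qed.

Lemma ip_ge0 v : Dir M v -> 0 <= ip M v v.
Proof.
move=> Dv; apply: ae_Rintegral_ge0; first exact: wf_meas.
by apply: filterS bS => z Sz; apply: (wform_ge0 c0 Sz).
Qed.

Lemma ip_sym v w : Dir M v -> Dir M w -> ip M v w = ip M w v.
Proof.
move=> Dv Dw; apply: ae_Rintegral_eq; [exact: wf_meas|exact: wf_meas|].
by apply: filterS bS => z Sz; apply: (wform_sym Sz).
Qed.

Lemma ip_lin a v w x : Dir M v -> Dir M w -> Dir M x ->
  ip M (a *: v + w) x = a * ip M v x + ip M w x.
Proof.
move=> Dv Dw Dx; have Dvw : Dir M (a *: v + w) by have [_] := subspace_Dir; apply.
have [_ [lin _]] := Hpd.
transitivity (\int[L]_z (a * wf v x z + wf w x z)).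
  apply: ae_Rintegral_eq; first exact: wf_meas.
    apply: measurable_funD; last exact: wf_meas.
    by apply: measurable_funM => //; exact: wf_meas.
  by apply: filterS (lin a _ _ Dv Dw) => z ->; rewrite wform_lin.
rewrite RintegralD //; first 1 last.
- have := integrableZl measurableT a (wf_integrable Dv Dx).
  by apply: eq_integrable.
- exact: wf_integrable.
by rewrite RintegralZl //; exact: wf_integrable.
Qed.

Let sdf v (z : borelV R dy * borelV R dx) := ((mdot M z.2 v)^T *m invmx (Sig M z.2) *m Sig0 M z.2 *m
       invmx (Sig M z.2) *m mdot M z.2 v) ord0 ord0.

Let sdf_meas v : Dir M v -> measurable_fun setT (sdf v).
Proof.
move=> Dv; have mm := mdot_meas Dv; have mi := mxmeas_inv Sig_meas.
have m0 := Sig0_meas; have mt := mxmeas_tr mm.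
exact: (mxmeas_mul (mxmeas_mul (mxmeas_mul (mxmeas_mul mt mi) m0) mi) mm).
Qed.

Let sdf_bounds v :
  {ae L, forall z, c / C * wf v v z <= sdf v z <= C / c * wf v v z}.
Proof.
apply: filterS2 bS bS0 => z Sz S0z; rewrite /sdf /wf.
set m := mdot _ _ _; pose w := invmx (Sig M z.2) *m m.
have -> : m^T *m invmx (Sig M z.2) *m Sig0 M z.2 *m invmx (Sig M z.2) *m m
  = w^T *m Sig0 M z.2 *m w.
  by rewrite /w trmx_mul (spd_inv_sym Sz) !mulmxA.
have /andP[h1 h2] := S0z.2 w; have /andP[h3 h4] := wform_bounds c0 Sz m.
apply/andP; split.
  apply: le_trans h1; rewrite -mulrA ler_pM2l //.
  by rewrite mulrC ler_pdivrMr // mulrC.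
apply: (le_trans h2); rewrite -mulrA ler_pM2l //.
by rewrite mulrC ler_pdivlMr // mulrC.
Qed.

Let sdf_integrable v : Dir M v -> L.-integrable setT (EFin \o sdf v).
Proof.
move=> Dv; apply: (@ae_integrable_le _ _ _ _ _ (fun z => C / c * wf v v z)).
- exact: sdf_meas.
- have := integrableZl measurableT (C / c) (wf_integrable Dv Dv).
  by apply: eq_integrable.
- apply: filterS2 bS (sdf_bounds v) => z Sz /andP[h1 h2].
  rewrite ger0_norm //; apply: le_trans h1.
  by rewrite mulr_ge0 ?divr_ge0 ?(ltW c0) ?(ltW C0) // (wform_ge0 c0 Sz).
Qed.

(** With w = Sig^{-1} mdot[v], both squared norms are integrals of forms in w whose
    matrices, Sig and Sig0, have eigenvalues between c and C. *)
Lemma nrm_sd_bounds v : Dir M v ->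
  c / C * ip M v v <= nrm_sd M v ^+ 2 <= C / c * ip M v v.
Proof.
move=> Dv.
have iZ k : L.-integrable setT (EFin \o (fun z => k * wf v v z)).
  have := integrableZl measurableT k (wf_integrable Dv Dv).
  by apply: eq_integrable.
have lo : c / C * ip M v v <= \int[L]_z sdf v z.
  rewrite -RintegralZl //; last exact: wf_integrable.
  apply: ae_Rintegral_le; [exact: iZ|exact: sdf_integrable|].
  by apply: filterS (sdf_bounds v) => z /andP[].
rewrite sqr_sqrtr.
  rewrite lo /= -RintegralZl //; last exact: wf_integrable.
  apply: ae_Rintegral_le; [exact: sdf_integrable|exact: iZ|].
  by apply: filterS (sdf_bounds v) => z /andP[].
apply: le_trans lo; rewrite mulr_ge0 ?ip_ge0 // divr_ge0 ?ltW //.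
Qed.

Lemma nrm_sd_opt v : Dir M v -> (forall x, suppX M x -> Sig M x = Sig0 M x) ->
  nrm_sd M v = nrm M v.
Proof.
move=> Dv SS; congr Num.sqrt.
apply: ae_Rintegral_eq; [exact: sdf_meas|exact: wf_meas|].
apply: filterS2 bS ae_suppX => z Sz /SS SS0.
rewrite /wform -SS0 mulmxKV //; exact: spd_unit c0 Sz.
Qed.

End Bounds.
End InnerProduct.

(** * Rates and the strong norm *)

Section Rates.
Context (R : realType).

(** A sequence that eventually dominates every null sequence stays away from 0:
    otherwise twice its running minimum would be a null sequence that exceeds
    it at each new minimum. *)
Lemma dominates_null_lower_bound (x : nat -> R) :
  (forall n, 0 < x n) ->
  (forall g : nat -> R, g n @[n --> \oo] --> (0 : R) -> \forall n \near \oo, g n <= x n) ->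
  exists2 c : R, 0 < c & \forall n \near \oo, c <= x n.
Proof.
move=> x0 dom.
pose m := fix m n := if n is n'.+1 then Num.min (m n') (x n) else x 0%N.
have m0 n : 0 < m n by elim: n => [|n IH] //=; rewrite lt_min IH x0.
have mx n : m n <= x n by case: n => [|n] //=; rewrite ge_min lexx orbT.
have mni : nonincreasing_seq m.
  by apply/nonincreasing_seqP => n /=; rewrite ge_min lexx.
have mlb : has_lbound (range m) by exists 0 => _ [n _ <-]; apply: ltW.
have mcv : m n @[n --> \oo] --> inf (range m) := nonincreasing_cvgn mni mlb.
have infle n : inf (range m) <= m n by apply: ge_inf => //; exists n.
have inf0 : 0 <= inf (range m).
  by apply: lb_le_inf; [exists (m 0%N), 0%N|move=> _ [n _ <-]; apply: ltW].
have [l0|] := ltP 0 (inf (range m)).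
  by exists (inf (range m)) => //; apply: nearW => n; apply: le_trans (mx n).
move=> l0; have linf : inf (range m) = 0 by apply/eqP; rewrite eq_le l0.
have m2 : (2 * m n) @[n --> \oo] --> (0 : R).
  by rewrite -(mulr0 2) -linf; apply: cvgMr.
have [N _ HN] := dom _ m2.
have mN k : m (N + k)%N = m N.
  elim: k => [|k IH]; first by rewrite addn0.
  rewrite addnS /= -IH; apply/min_idPl; rewrite leNgt; apply/negP => lt.
  have := HN (N + k).+1 (leq_trans (leq_addr k N) (leqnSn _)); rewrite /= (min_idPr (ltW lt)).
  by apply/negP; rewrite -ltNge; have := x0 (N + k).+1; lra.
exists (m N) => //; exists N => // n /= Nn.
by rewrite -(mN (n - N)%N) subnKC.
Qed.

End Rates.

Section Norms.
Context (R : realType) (n : nat) (H : completeNormedModType R).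

Let dot (v w : 'rV[R]_n) := \sum_i v ord0 i * w ord0 i.

Let dot_sym (v w : 'rV[R]_n) : setT v -> setT w -> dot v w = dot w v.
Proof. by move=> _ _; apply: eq_bigr => i _; rewrite mulrC. Qed.

Let dot_lin c (v w x : 'rV[R]_n) : setT v -> setT w -> setT x ->
  dot (c *: v + w) x = c * dot v x + dot w x.
Proof.
move=> _ _ _; rewrite mulr_sumr -big_split; apply: eq_bigr => i _.
by rewrite !mxE mulrDl mulrA.
Qed.

Let dot_ge0 (v : 'rV[R]_n) : setT v -> 0 <= dot v v.
Proof. by move=> _; apply: sumr_ge0 => i _; rewrite -expr2 sqr_ge0. Qed.

Let subT : subspace [set: 'rV[R]_n]. Proof. by split. Qed.

Lemma enormE (v : 'rV[R]_n) : enorm v = fnorm dot v.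
Proof. by congr Num.sqrt; apply: eq_bigr => i _; rewrite expr2. Qed.

Lemma enorm_ge0 (v : 'rV[R]_n) : 0 <= enorm v.
Proof. exact: sqrtr_ge0. Qed.

Lemma enormD_le (v w : 'rV[R]_n) : enorm (v + w) <= enorm v + enorm w.
Proof. by rewrite !enormE (fnormD_le subT dot_sym dot_lin dot_ge0). Qed.

Lemma enormZ c (v : 'rV[R]_n) : enorm (c *: v) = `|c| * enorm v.
Proof.
rewrite /enorm -sqrtr_sqr -sqrtrM ?sqr_ge0 // mulr_sumr; congr Num.sqrt.
by apply: eq_bigr => i _; rewrite mxE exprMn.
Qed.

Lemma enorm_eq0 (v : 'rV[R]_n) : enorm v = 0 -> v = 0.
Proof.
move=> v0; have e : sqn v^T = \sum_i v ord0 i ^+ 2.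
  by apply: eq_bigr => i _; rewrite mxE.
have : sqn v^T = 0.
  have := congr1 (fun x => x ^+ 2) v0; rewrite /enorm sqr_sqrtr ?expr0n -?e //.
  exact: sqn_ge0.
by move/sqn_eq0/(congr1 trmx); rewrite trmxK trmx0.
Qed.

Lemma continuous_enorm : continuous (@enorm R n).
Proof.
move=> v; apply: (@continuous_comp _ _ _ (fun v : 'rV[R]_n => \sum_i v ord0 i ^+ 2)
  (@Num.sqrt R)); last exact: sqrt_continuous.
have : continuous (fun v : 'rV[R]_n => \sum_i v ord0 i ^+ 2); last exact.
apply: continuous_sum => i x.
by apply: (@continuous_comp _ _ _ (fun y : 'rV[R]_n => y ord0 i) (fun a : R => a ^+ 2));
  [exact: coord_continuous|exact: exprn_continuous].
Qed.

Local Notation E := ('rV[R]_n * H)%type.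
Implicit Types a b : E.

Lemma norm_s_ge0 a : 0 <= norm_s a.
Proof. by rewrite addr_ge0 // enorm_ge0. Qed.

Lemma norm_sD_le a b : norm_s (a + b) <= norm_s a + norm_s b.
Proof.
rewrite /norm_s addrACA lerD //; [exact: enormD_le|exact: ler_normD].
Qed.

Lemma norm_sZ c a : norm_s (c *: a) = `|c| * norm_s a.
Proof. by rewrite /norm_s enormZ normrZ mulrDr. Qed.

Lemma norm_s_eq0 a : norm_s a = 0 -> a = 0.
Proof.
move=> /eqP; rewrite paddr_eq0 // ?enorm_ge0 // => /andP[/eqP/enorm_eq0 a1].
by rewrite normr_eq0 => /eqP a2; case: a a1 a2 => /= x y -> ->.
Qed.

Lemma continuous_norm_s_dist b : continuous (fun a => norm_s (a - b)).
Proof.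
have -> : (fun a => norm_s (a - b)) =
  (fun a : E => enorm (a.1 - b.1)) \+ (fun a : E => `|a.2 - b.2|) by [].
move=> a; apply: continuousD.
  apply: (@continuous_comp _ _ _ (fun a : E => a.1 - b.1) (@enorm R n));
    last exact: continuous_enorm.
  by apply: continuousB; [exact: cvg_fst|exact: cst_continuous].
apply: (@continuous_comp _ _ _ (fun a : E => a.2 - b.2) (@Num.norm _ H));
  last exact: norm_continuous.
by apply: continuousB; [exact: cvg_snd|exact: cst_continuous].
Qed.

End Norms.

(** * Geometry of the sieve *)

Section Geometry.
Context (R : realType) (dy dx dth drho : nat)
  (H : completeNormedModType R) (d : measure_display)
  (Omega : measurableType d).
Variable M : psmd_model dy dx dth drho H Omega.
Local Notation L := (lawZ M).
Local Notation a0 := (alpha0 M).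
Local Notation E := ('rV[R]_dth * H)%type.
Hypotheses (Hm : model_setup M) (He : estimator_setup M) (Hl : local_setup M)
  (Hrz : riesz_setup M) (HID : cond_ID M) (HPEN : cond_PEN M) (HLOC : cond_LOC M)
  (HPHI : cond_PHI M).

Let Hpd : pathwise_diff M. Proof. by have [[]] := HLOC. Qed.

Lemma near_kn_ge N : \forall n \near \oo, (N <= kn M n)%N.
Proof.
have [_ [_ [_ [+ _]]]] := He; move/cvgnyPge; exact.
Qed.

Lemma lin_span_Ak n : lin_span (Ak M (kn M n)) = hullk M (kn M n).
Proof.
have [_ [_ [_ [_ [_ [_ [int _]]]]]]] := He.
apply/seteqP; split.
  by apply: lin_span_min; [exact: subspace_hullk|move=> a []].
move=> v hv; have [_ [a Aa [e e0 ball]]] := int n.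
have ha : hullk M (kn M n) a by case: Aa.
pose t := e / (2 * (norm_s v + 1)).
have nv : 0 < norm_s v + 1 by rewrite ltr_wpDl ?norm_s_ge0.
have t0 : 0 < t by rewrite divr_gt0 // mulr_gt0.
have Aat : Ak M (kn M n) (a + t *: v).
  apply: ball; first by apply: subspaceD => //; [exact: subspace_hullk|
    apply: subspaceZ => //; exact: subspace_hullk].
  rewrite addrC addKr norm_sZ gtr0_norm // /t mulrAC ltr_pdivrMr ?mulr_gt0 //.
  rewrite ltr_pM2l //; have := norm_s_ge0 v; lra.
have -> : v = t^-1 *: ((a + t *: v) - a).
  by rewrite addrC addKr scalerA mulVf ?scale1r // gt_eqF.
apply: subspaceZ; first exact: subspace_lin_span.
by apply: subspaceB; [exact: subspace_lin_span|exact: sub_lin_span..].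
Qed.

(** The closed span of the local sieve lies in the sieve hull and has its
    dimension, so the Riesz identity holds on the whole hull. *)
Lemma near_Vbark_hullk : \forall n \near \oo,
  Vbark M (kn M n) = hullk M (kn M n) /\
  exists2 m, (1 < m)%N & has_dim (hullk M (kn M n)) m.
Proof.
have [_ [_ [_ [[dm dims [c [C [c0 growth]]]] _]]]] := Hrz.
have [N _ kN] := near_kn_ge (Num.truncn (1 / c)).+1.
near=> n.
have [dV] : has_dim (Vbark M (kn M n)) (dm n) /\ has_dim (lin_span (Ak M (kn M n))) (dm n).
  by near: n.
rewrite lin_span_Ak => dh; split.
  by apply: has_dim_sub_eq dV dh _ => v [].
exists (dm n) => //.
have : c * (kn M n)%:R <= (dm n)%:R.
  by have /andP[] : c * (kn M n)%:R <= (dm n)%:R <= C * (kn M n)%:R by near: n.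
have nk : (Num.truncn (1 / c)).+1%:R <= (kn M n)%:R :> R.
  by rewrite ler_nat; apply: kN; near: n; exists N.
have k1 : 1 / c < (kn M n)%:R.
  by apply: lt_le_trans nk; exact: truncnS_gt.
move=> h; rewrite -(ltr_nat R); apply: lt_le_trans h.
by rewrite mulrC -ltr_pdivrMr.
Unshelve. all: by end_near. Qed.

Lemma nrm_hullk_eq0 n v : Vbark M (kn M n) = hullk M (kn M n) ->
  hullk M (kn M n) v -> nrm M v = 0 -> v = 0.
Proof.
move=> eV hv; have [[_ [_ [def _]]] _] := HPHI.
by apply: (def (kn M n)).2; rewrite eV.
Qed.

Lemma nrm_ge0 v : 0 <= nrm M v. Proof. exact: sqrtr_ge0. Qed.


Lemma ip_props :
  [/\ forall v w, Dir M v -> Dir M w -> ip M v w = ip M w v,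
    forall c v w x, Dir M v -> Dir M w -> Dir M x ->
       ip M (c *: v + w) x = c * ip M v x + ip M w x &
    forall v, Dir M v -> 0 <= ip M v v].
Proof.
have [c [C [c0 C0 b1 b2]]] := weight_bounds Hm HID.
by split=> *; [apply: (ip_sym Hm Hpd b1)|apply: (ip_lin Hm Hpd c0 b1)|apply: (ip_ge0 Hm Hpd c0 b1)].
Qed.

Let ipS : forall v w, Dir M v -> Dir M w -> ip M v w = ip M w v.
Proof. by case: ip_props. Qed.

Let ipL : forall c v w x, Dir M v -> Dir M w -> Dir M x ->
  ip M (c *: v + w) x = c * ip M v x + ip M w x.
Proof. by case: ip_props. Qed.

Let ipG : forall v, Dir M v -> 0 <= ip M v v.
Proof. by case: ip_props. Qed.

Let sDir : subspace (Dir M). Proof. exact: subspace_Dir. Qed.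

Lemma nrm_sqr v : Dir M v -> nrm M v ^+ 2 = ip M v v.
Proof. by move=> Dv; rewrite sqr_sqrtr // ipG. Qed.

Lemma nrmZ c v : Dir M v -> nrm M (c *: v) = `|c| * nrm M v.
Proof.
move=> Dv; have Dcv := subspaceZ c sDir Dv.
rewrite /nrm (form_scalel sDir ipL) // (form_scaler sDir ipS ipL) // mulrA -expr2.
by rewrite sqrtrM ?sqr_ge0 // sqrtr_sqr.
Qed.

Lemma nrmB_le v w : Dir M v -> Dir M w -> nrm M (v - w) <= nrm M v + nrm M w.
Proof. by move=> Dv Dw; apply: (fnormB_le sDir ipS ipL ipG Dv Dw). Qed.

Lemma vstar_hullk n : hullk M (kn M n) (vstar M n).
Proof. by have [_ [_ [_ [_ /(_ n) [[]]]]]] := Hrz. Qed.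

Lemma vstar_Dir n : Dir M (vstar M n).
Proof. exact: hullk_Dir (vstar_hullk n). Qed.

Lemma ustar_hullk n : hullk M (kn M n) (ustar M n).
Proof. by apply: subspaceZ; [exact: subspace_hullk|exact: vstar_hullk]. Qed.

Lemma ustar_Dir n : Dir M (ustar M n).
Proof. exact: hullk_Dir (ustar_hullk n). Qed.

Lemma phidot_lin c v w : Dir M v -> Dir M w ->
  phidot M (c *: v + w) = c * phidot M v + phidot M w.
Proof. by move=> Dv Dw; have [_ [[_ [+ _]] _]] := Hrz; apply. Qed.

(** Split a - alpha0 at the projection alpha0k of alpha0: the part in the sieve
    space is handled by the Riesz identity and the residual is orthogonal to it. *)
Lemma ip_ustar n a : Vbark M (kn M n) = hullk M (kn M n) -> hullk M (kn M n) a ->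
  ip M (ustar M n) (a - a0) =
  (phidot M (a - a0) - phidot M (alpha0k M (kn M n) - a0)) / nrm_sd M (vstar M n).
Proof.
move=> eV ha; set al := alpha0k M (kn M n).
have [_ [_ [proj [_ rep]]]] := Hrz; have [hal almin] := proj (kn M n).
have shull := subspace_hullk M (kn M n).
have hb : hullk M (kn M n) (a - al) by apply: subspaceB.
have Dv := vstar_Dir n; have Db := hullk_Dir hb.
have Dal : Dir M (al - a0) := hullk_subDir hal.
have Da : Dir M (a - a0) := hullk_subDir ha.
have eab : a - a0 = (a - al) + (al - a0) by rewrite addrA subrK.
have orth : ip M (vstar M n) (al - a0) = 0.
  apply: (form_orth sDir ipS ipL ipG shull (@hullk_Dir _ _ _ _ _ _ _ _ M _) Dal);
    last exact: vstar_hullk.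
  move=> s hs; have -> : al - a0 + s = (al + s) - a0 by rewrite addrAC.
  by apply: almin; apply: subspaceD.
rewrite /ustar (form_scalel sDir ipL) // mulrC; congr (_ / _).
rewrite ipS // {1}eab (form_addl ipL) // -(ipS Dv) // -(ipS Dv) // orth addr0.
have -> : ip M (vstar M n) (a - al) = phidot M (a - al).
  by rewrite (rep n).2 // eV.
have := phidot_lin 1 Db Dal; rewrite scale1r mul1r -eab => ->.
by rewrite addrK.
Qed.

Lemma phidot_ustar n : nrm_sd M (vstar M n) != 0 ->
  phidot M (ustar M n) = nrm_sd M (vstar M n) * nrm M (ustar M n) ^+ 2.
Proof.
move=> sd0; have [_ [_ [_ [_ rep]]]] := Hrz; have [vV repv] := rep n.
have Dv := vstar_Dir n; have Du := ustar_Dir n.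
have -> : phidot M (ustar M n) = (nrm_sd M (vstar M n))^-1 * phidot M (vstar M n).
  have D0 : Dir M 0 by case: sDir.
  have p0 : phidot M 0 = 0.
    by have := phidot_lin (-1) D0 D0; rewrite scaler0 addr0 mulN1r addNr.
  by have := phidot_lin (nrm_sd M (vstar M n))^-1 Dv D0; rewrite !addr0 p0 addr0.
rewrite nrm_sqr // /ustar (form_scalel sDir ipL) // (form_scaler sDir ipS ipL) //.
by rewrite (repv _ vV); field.
Qed.

Lemma nrm_ustar n : nrm M (ustar M n) = nrm M (vstar M n) / nrm_sd M (vstar M n).
Proof.
rewrite nrmZ; last exact: vstar_Dir.
by rewrite mulrC ger0_norm // invr_ge0 sqrtr_ge0.
Qed.

(** The two norms of vstar are equivalent, so the curvature of the criterion
    along ustar is of exact order 1. *)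
Lemma nrm_ustar_bounds : exists k1 k2 : R, [/\ 0 < k1, k1 <= k2 &
  forall n, nrm_sd M (vstar M n) != 0 -> k1 <= nrm M (ustar M n) ^+ 2 <= k2].
Proof.
have [c [C [c0 C0 b1 b2]]] := weight_bounds Hm HID.
exists (c / C), (Num.max (c / C) (C / c)); split; first by rewrite divr_gt0.
  by rewrite le_max lexx.
move=> n sd0; have Dv := vstar_Dir n.
have /andP[h1 h2] := nrm_sd_bounds Hm Hpd c0 C0 b1 b2 Dv.
have s0 : 0 < nrm_sd M (vstar M n) ^+ 2 by rewrite exprn_even_gt0 //= sd0 orbT.
rewrite nrm_ustar expr_div_n nrm_sqr //; apply/andP; split.
  rewrite ler_pdivlMr //; rewrite -ler_pdivrMl ?divr_gt0 // in h2.
  by move: h2; rewrite invf_div.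
rewrite le_max ler_pdivrMr // ler_pdivrMr //; apply/orP; right.
rewrite -ler_pdivlMl ?divr_gt0 // in h1.
by move: h1; rewrite invf_div.
Qed.

Lemma ustar_opt n : (forall x, suppX M x -> Sig M x = Sig0 M x) ->
  nrm_sd M (vstar M n) != 0 -> nrm M (ustar M n) = 1.
Proof.
move=> SS sd0; have [c [C [c0 C0 b1 b2]]] := weight_bounds Hm HID.
by rewrite nrm_ustar -(nrm_sd_opt Hm Hpd c0 b1 (vstar_Dir n) SS) divff.
Qed.

Lemma Hk_Pih0 n : Hk M (kn M n) (Pih0 M n).
Proof. by have [_ [[_ [_ [_ [_ [_ [+ _]]]]]] _]] := HID; apply. Qed.

Lemma Theta_a0 : Theta M a0.1.
Proof. by have [_ [_ [_ [[int _] _]]]] := Hm; apply: interior_subset. Qed.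

Lemma lam_gt0 n : 0 < lam M n.
Proof. by have [[+ _] _] := HPEN; apply. Qed.

Lemma pen_leE n a : pen_le M n a <-> (Pen M a.2 <= (M0 M)%:E)%E.
Proof. by rewrite /pen_le EFinM lee_pmul2l // lte_fin lam_gt0. Qed.

Lemma norm_s_Pia0 n : norm_s (Pia0 M n - a0) = `|a0.2 - Pih0 M n|.
Proof.
rewrite /norm_s /= subrr distrC /enorm big1 ?sqrtr0 ?add0r // => i _.
by rewrite mxE expr0n.
Qed.

Lemma near_Pia0_Aosn : \forall n \near \oo, Aosn M n (Pia0 M n).
Proof.
have [[_ [_ [_ [e e0 nb]]]] [[Plt _] _]] := Hl.
have [_ [[_ [_ [_ [_ [_ [_ cv]]]]]] _]] := HID.
have small : \forall n \near \oo, `| `|Pih0 M n - a0.2| | < e by exact: cvgr0_norm_lt.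
near=> n; have lt : `| `|Pih0 M n - a0.2| | < e by near: n.
 split; last by split; [exact: Theta_a0|exact: Hk_Pih0].
apply: (nb n); [exact: Theta_a0| |exact: Plt].
by rewrite norm_s_Pia0 distrC; move: lt; rewrite normr_id.
Unshelve. all: by end_near. Qed.

Lemma near_delta_dom (e : nat -> R) : little_o_inv e ->
  \forall n \near \oo, [/\ (Q M (Pia0 M n) <= (delta M n ^+ 2)%:E)%E,
    lam M n <= delta M n ^+ 2 & e n <= delta M n ^+ 2].
Proof.
move=> oe; have [_ [_ [[_ mx] _]]] := HLOC.
apply: filterS (mx e oe) => n eq.
have : (delta M n ^+ 2)%:E = (delta M n ^+ 2)%:E :> \bar R by [].
rewrite -{1}eq => /eqP; rewrite eq_le => /andP[+ _].
by rewrite !ge_max !lee_fin => /andP[_ /andP[-> /andP[-> ->]]].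
Qed.

Lemma delta_gt0 n : 0 < delta M n.
Proof. by have [_ [_ [_ [[+ _] _]]]] := Hl; move/(_ n)/andP => []. Qed.

(** As delta_n^2 dominates every o(1/n) sequence, it is at least of order 1/n. *)
Lemma near_delta_rate :
  exists2 k : R, 0 < k & \forall n \near \oo, k <= Num.sqrt n%:R * delta M n.
Proof.
pose x n := if n is 0%N then 1 else n%:R * delta M n ^+ 2.
have x0 n : 0 < x n.
  by case: n => [|n] //=; rewrite mulr_gt0 ?ltr0n // exprn_gt0 // delta_gt0.
have [|k k0 Hk] := @dominates_null_lower_bound _ x x0.
  move=> g g0.
  have oe : little_o_inv (fun n => g n / n%:R).
    apply: cvg_trans g0; apply: near_eq_cvg; near=> n.
    by rewrite mulrC divfK // pnatr_eq0 -lt0n; near: n; exists 1%N.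
  have nd := near_delta_dom oe; near=> n.
  have [_ _] : [/\ (Q M (Pia0 M n) <= (delta M n ^+ 2)%:E)%E,
    lam M n <= delta M n ^+ 2 & g n / n%:R <= delta M n ^+ 2] by near: n.
  have n0 : (0 < n)%N by near: n; exists 1%N.
  rewrite ler_pdivrMr ?ltr0n // mulrC.
  suff -> : x n = n%:R * delta M n ^+ 2 by [].
  by rewrite /x; move: n0; clear; case: n.
exists (Num.sqrt k); first by rewrite sqrtr_gt0.
near=> n; have n0 : (0 < n)%N by near: n; exists 1%N.
have : k <= x n by near: n.
have -> : x n = n%:R * delta M n ^+ 2 by rewrite /x; move: n0; clear; case: n.
move=> h; have -> : Num.sqrt n%:R * delta M n = Num.sqrt (n%:R * delta M n ^+ 2).
  by rewrite sqrtrM ?ler0n // sqrtr_sqr gtr0_norm // delta_gt0.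
by rewrite ler_wsqrtr.
Unshelve. all: by end_near. Qed.

Lemma Pia0_hullk n : hullk M (kn M n) (Pia0 M n).
Proof. exact: Hk_Pih0. Qed.

(** If the local sieve were reduced to the single point Pi_n alpha0, its span would
    be a line, while the dimension of the sieve space grows to infinity. *)
Lemma near_Aosn_nontrivial : \forall n \near \oo,
  exists2 a, Aosn M n a & nrm M (a - Pia0 M n) != 0.
Proof.
have nV := near_Vbark_hullk; have nP := near_Pia0_Aosn.
near=> n; have [eV [m m1 dimV]] : Vbark M (kn M n) = hullk M (kn M n) /\
  exists2 m, (1 < m)%N & has_dim (hullk M (kn M n)) m by near: n.
have PA : Aosn M n (Pia0 M n) by near: n.
apply: contrapT => no.
have triv a : Aosn M n a -> a = Pia0 M n.
  move=> Aa; have ha : hullk M (kn M n) (a - Pia0 M n).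
    by apply: subspaceB; [exact: subspace_hullk|case: Aa => _ []|exact: Pia0_hullk].
  apply/eqP; rewrite -subr_eq0; apply/eqP; apply: (nrm_hullk_eq0 eV ha).
  by apply/eqP; apply: contra_notT no => n0; exists a.
have [_ [_ [proj _]]] := Hrz; have [hal _] := proj (kn M n).
pose w := Pia0 M n - alpha0k M (kn M n).
have hw : hullk M (kn M n) w.
  by apply: subspaceB; [exact: subspace_hullk|exact: Pia0_hullk|].
suff : (m <= 1)%N by rewrite leqNgt m1.
apply: (has_dim_line (w := w) dimV) => v hv.
have Dv := hullk_Dir hv; have Dw := hullk_Dir hw.
have [|c vc] := form_line_closed sDir ipS ipL ipG Dv Dw.
  move=> eps eps0; have : Vbark M (kn M n) v by rewrite eV.
  move=> [_ /(_ _ eps0)[y ly vy]].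
  have [c yc] : exists c, y = c *: w; last by exists c; rewrite -yc.
  apply: (@lin_span_min _ _ _ [set y | exists c, y = c *: w] _ _ _ ly).
    split; first by exists 0; rewrite scale0r.
    by move=> a _ _ [b ->] [c ->]; exists (a * b + c); rewrite scalerDl scalerA.
  by move=> _ [a Aa <-]; exists 1; rewrite scale1r (triv a Aa).
exists c; apply/eqP; rewrite -subr_eq0; apply/eqP.
apply: (nrm_hullk_eq0 eV _ vc).
by apply: subspaceB => //; [exact: subspace_hullk|apply: subspaceZ => //; exact: subspace_hullk].
Unshelve. all: by end_near. Qed.

(** The supremum tau_n is finite for large n, and it is positive because the
    local sieve has a point other than Pi_n alpha0. *)
Lemma near_tau : \forall n \near \oo, 0 < tau M n /\
  forall a, Aosn M n a -> nrm M (a - Pia0 M n) != 0 ->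
    norm_s (a - Pia0 M n) <= tau M n * nrm M (a - Pia0 M n).
Proof.
have nn := near_Aosn_nontrivial; have [_ [_ [_ [_ [nu _]]]]] := Hl.
near=> n; have ub : has_ubound (tau_ratios M n) by near: n.
have [a Aa na] : exists2 a, Aosn M n a & nrm M (a - Pia0 M n) != 0 by near: n.
have le b : Aosn M n b -> nrm M (b - Pia0 M n) != 0 ->
    norm_s (b - Pia0 M n) / nrm M (b - Pia0 M n) <= tau M n.
  by move=> Ab nb; apply: ub_le_sup => //; exists b.
have pos b : nrm M (b - Pia0 M n) != 0 -> 0 < nrm M (b - Pia0 M n).
  by move=> nb; rewrite lt_neqAle eq_sym nb nrm_ge0.
split; last by move=> b Ab nb; rewrite -ler_pdivrMr ?pos //; apply: le.
apply: lt_le_trans (le a Aa na); rewrite divr_gt0 ?pos //.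
rewrite lt_neqAle norm_s_ge0 andbT eq_sym; apply: contra na => /eqP/norm_s_eq0 ->.
rewrite /nrm; have D0 : Dir M 0 by case: sDir.
by rewrite (form_0l sDir ipL) // sqrtr0.
Unshelve. all: by end_near. Qed.

Lemma near_delta_s_gt0 : \forall n \near \oo, 0 < delta_s M n.
Proof.
apply: filterS near_tau => n [t0 _].
by rewrite ltr_wpDl // mulr_gt0 // delta_gt0.
Qed.

(** Both logarithms in M_n diverge; for the second one delta_s must be positive,
    as its inverse is 0 otherwise. *)
Lemma near_Mn_ge K : \forall n \near \oo, K <= Mn M n.
Proof.
have [_ [_ [_ [_ [_ cv]]]]] := Hl; have ds := near_delta_s_gt0.
near=> n; rewrite le_min; apply/andP; split.
  have : expR (expR K) <= n.+1%:R.
    have : (Num.truncn (expR (expR K)) <= n)%N.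
      by near: n; exists (Num.truncn (expR (expR K))).
    rewrite -ltnS -(ltr_nat R) => h; apply/ltW.
    apply: lt_le_trans (truncnS_gt _) _; rewrite ler_nat ltnS.
    by move: h; rewrite ltr_nat ltnS.
  move=> h; rewrite -[K]expRK ler_ln ?posrE ?expR_gt0 //.
    by rewrite -[expR K]expRK ler_ln ?posrE ?expR_gt0 // ltr0n.
  rewrite ln_gt0 //; apply: lt_le_trans h.
  by rewrite -expR0 ltr_expR expR_gt0.
have d0 : 0 < delta_s M n by near: n.
have : delta_s M n < expR (- K).
  have : `|delta_s M n| < expR (- K).
    by near: n; apply: cvgr0_norm_lt => //; exact: expR_gt0.
  by rewrite gtr0_norm.
rewrite expRN => h; rewrite -[K]expRK ler_ln ?posrE ?expR_gt0 //; last first.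
  by rewrite ltr_wpDl // invr_ge0 ltW.
apply: (@le_trans _ _ (delta_s M n)^-1); last by rewrite lerDl.
by rewrite -[leLHS]invrK lef_pV2 ?posrE ?invr_gt0 ?expR_gt0 // ltW.
Unshelve. all: by end_near. Qed.

Lemma near_Tn T : 0 < T -> \forall n \near \oo,
  forall t, `|t| <= T -> Tn M n (t / Num.sqrt n%:R).
Proof.
move=> T0; have [k k0 nk] := near_delta_rate.
have nM := near_Mn_ge (Num.max 1 (T / k)).
near=> n => t tT; rewrite /Tn /=.
have n0 : (0 < n)%N by near: n; exists 1%N.
have s0 : 0 < Num.sqrt n%:R :> R by rewrite sqrtr_gt0 ltr0n.
have : Num.max 1 (T / k) <= Mn M n by near: n.
rewrite ge_max => /andP[M1 MT].
have kd : k <= Num.sqrt n%:R * delta M n by near: n.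
rewrite normrM [ `|_^-1|]gtr0_norm ?invr_gt0 // ler_pdivrMr //.
apply: (le_trans tT).
have -> : 4 * Mn M n ^+ 2 * delta M n * Num.sqrt n%:R =
  4 * Mn M n ^+ 2 * (Num.sqrt n%:R * delta M n) by ring.
apply: (@le_trans _ _ (Mn M n * k)); first by rewrite -ler_pdivrMr.
have M2 : Mn M n <= 4 * Mn M n ^+ 2.
  by rewrite expr2 mulrA ler_peMl //; lra.
by apply: ler_pM => //; lra.
Unshelve. all: by end_near. Qed.

(** If Q vanishes, so does the conditional moment m(X, a), and identification
    applies. *)
Lemma Q_pos a : Aset M a -> a <> a0 -> (0 < Q M a)%E.
Proof.
move=> Aa na; have [c [C [c0 C0 bS _]]] := weight_bounds Hm HID.
pose f (z : borelV R dy * borelV R dx) := (wform (Sig M z.2) (mX M z.2 a) (mX M z.2 a))%:E.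
have mf : measurable_fun setT f.
  by apply/measurable_EFinP; apply: measurable_wform; [exact: Sig_meas|exact: mX_meas..].
have Qabs : Q M a = (\int[L]_z `|f z|)%E.
  apply: ae_eq_integral => //; first exact: measurableT_comp.
  by apply: filterS bS => z Sz _; rewrite gee0_abs // lee_fin (wform_ge0 c0 Sz).
rewrite lt_neqAle Qabs integral_ge0 ?andbT; last by move=> z _; exact: abse_ge0.
apply/negP => /eqP Q0; apply: na; have [ident _] := HID.
apply/eqP; rewrite -subr_eq0; apply/eqP; apply: norm_s_eq0; apply/(ident a Aa).
have := (ae_eq_integral_abs L measurableT mf).1 (esym Q0).
move=> fz; apply: filterS2 bS fz => z Sz /(_ Logic.I) [fz].
exact: (wform_eq0 c0 Sz fz).
Qed.

(** Q is lower semicontinuous and positive off alpha0, hence bounded away from 0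
    on the compact set of parameters of bounded penalty at a distance from
    alpha0: a sequence along which Q tends to 0 would cluster at a zero of Q. *)
Lemma Q_separated eps : 0 < eps -> exists2 q : R, 0 < q & forall a,
  Aset M a -> (Pen M a.2 <= (M0 M)%:E)%E -> eps <= norm_s (a - a0) -> (q%:E <= Q M a)%E.
Proof.
move=> eps0; apply: contrapT => no.
have bad k : exists a, [/\ Aset M a, (Pen M a.2 <= (M0 M)%:E)%E,
    eps <= norm_s (a - a0) & (Q M a < (k.+1%:R^-1)%:E)%E].
  apply: contrapT => nk; apply: no; exists k.+1%:R^-1; first by rewrite invr_gt0.
  by move=> a Aa Pa na; rewrite leNgt; apply/negP => lt; apply: nk; exists a.
have [s Hs] := choice bad.
have [_ [[cTh _] [lsc _]]] := HID; have [_ [_ cPen]] := HPEN.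
have cK := compact_setX cTh (cPen (M0 M)).
have Ks : (s @ \oo) (Theta M `*` [set h | (Pen M h <= (M0 M)%:E)%E]).
  by exists 0%N => // k _; have [] := Hs k.
have [p [[Tp _] clp]] := cK _ _ Ks.
have meet (B : set E) N : nbhs p B -> exists2 k, (N <= k)%N & B (s k).
  move=> nB; have nA : (s @ \oo) (s @` [set k | (N <= k)%N]).
    by exists N => // k Nk; exists k.
  by have [_ [[k Nk <-] Bk]] := clp _ _ nA nB; exists k.
have near_p b r : norm_s (p - b) < r -> nbhs p [set a | norm_s (a - b) < r].
  by move=> lt; have /cvgr_lt := @continuous_norm_s_dist _ _ _ b p; apply.
have pfar : eps <= norm_s (p - a0).
  rewrite leNgt; apply/negP => /near_p /(meet _ 0%N)[k _ /=].
  by have [_ _ + _] := Hs k; rewrite leNgt => /negP.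
have np : p <> a0.
  move=> pa; move: pfar; rewrite pa subrr -[0](scale0r (0 : E)) norm_sZ normr0 mul0r.
  by rewrite leNgt eps0.
have Qp := Q_pos Tp np.
have [y y0 yQ] : exists2 y : R, 0 < y & (y%:E < Q M p)%E.
  case: (Q M p) Qp => [r|_|//]; last by exists 1; rewrite ?ltry.
  by rewrite lte_fin => r0; exists (r / 2); rewrite ?lte_fin; lra.
have [e e0 ball] := lsc p Tp y yQ.
have nb : nbhs p [set a | norm_s (a - p) < e].
  by apply: near_p; rewrite subrr -[0](scale0r (0 : E)) norm_sZ normr0 mul0r.
have [k Nk /= ke] := meet _ (Num.truncn (1 / y)) nb.
have [As _ _ Qs] := Hs k.
have := lt_trans (ball _ As ke) Qs; rewrite lte_fin.
apply/negP; rewrite -leNgt invf_ple ?posrE // -div1r ltW //.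
apply: lt_le_trans (truncnS_gt _) _; by rewrite ler_nat ltnS.
Qed.

End Geometry.

(** * Outer probabilities *)

Section OuterProbability.
Context (R : realType) (d : measure_display) (T : measurableType d).
Variable P : probability T R.
Implicit Types A B : set T.

Definition pr A : R := fine (mu_ext P A).

Lemma mu_ext_le1 A : (mu_ext P A <= 1)%E.
Proof.
rewrite -(probability_setT P) -(measurable_mu_extE P measurableT).
by apply: le_mu_ext.
Qed.

Lemma mu_extE A : mu_ext P A = (pr A)%:E.
Proof.
rewrite /pr fineK // ge0_fin_numE; last exact: mu_ext_ge0.
by apply: (le_lt_trans (mu_ext_le1 A)); rewrite ltry.
Qed.

Lemma pr_ge0 A : 0 <= pr A.
Proof. by apply: fine_ge0; exact: mu_ext_ge0. Qed.

Lemma pr_le1 A : pr A <= 1.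
Proof. by rewrite -lee_fin -mu_extE mu_ext_le1. Qed.

Lemma pr_mono A B : A `<=` B -> pr A <= pr B.
Proof. by move=> AB; rewrite -lee_fin -!mu_extE; apply: le_mu_ext. Qed.

Lemma prU A B : pr (A `|` B) <= pr A + pr B.
Proof.
rewrite -lee_fin EFinD -!mu_extE.
exact: (@outer_measureU2 _ _ (mu_ext P)).
Qed.

Lemma pr_meas A : measurable A -> P A = (pr A)%:E.
Proof. by move=> mA; rewrite -mu_extE measurable_mu_extE. Qed.

Lemma pr0 : pr set0 = 0.
Proof. by rewrite /pr mu_ext0. Qed.

Lemma prT : pr setT = 1.
Proof. by apply: EFin_inj; rewrite -pr_meas // probability_setT. Qed.

Lemma prC_ge A : 1 <= pr A + pr (~` A).
Proof. by rewrite -prT -(setUv A) prU. Qed.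

Lemma prC A : measurable A -> pr (~` A) = 1 - pr A.
Proof.
move=> mA; apply: EFin_inj; rewrite -pr_meas; last exact: measurableC.
by rewrite probability_setC // pr_meas.
Qed.

Lemma prD A B : measurable A -> measurable B -> A `<=` B -> pr (B `\` A) = pr B - pr A.
Proof.
move=> mA mB AB; apply: EFin_inj; rewrite -pr_meas; last exact: measurableD.
rewrite measureD //; last by apply: (le_lt_trans (probability_le1 P mB)); rewrite ltry.
by rewrite (setIidr AB) EFinB -!pr_meas.
Qed.

Lemma mu_ext_cvgP (A : nat -> set T) (l : R) :
  mu_ext P (A n) @[n --> \oo] --> l%:E <->
  forall eta, 0 < eta -> \forall n \near \oo, `|pr (A n) - l| <= eta.
Proof.
have -> : (fun n => mu_ext P (A n)) = (fun n => (pr (A n))%:E).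
  by apply/funext => n; rewrite mu_extE.
split.
  move=> /fine_cvgP[_ /= cv] eta eta0.
  near=> n; rewrite distrC; near: n; exact: cvgr_dist_le.
move=> h; apply: cvg_EFin; first by apply: nearW.
apply/cvgrPdist_le => eta eta0; near=> n; rewrite distrC; near: n; exact: h.
Unshelve. all: by end_near. Qed.

(** Besides wpa1, an event that holds up to outer probability eta: a bound
    in probability comes with a constant that depends on eta, and the events of
    both kinds have to be intersected. *)
Definition hp (eta : R) (A : nat -> set T) : Prop :=
  \forall n \near \oo, pr (~` A n) <= eta.

Lemma wpa1P (A : nat -> set T) : wpa1 P A <-> forall eta, 0 < eta -> hp eta A.
Proof.
apply: (iff_trans (mu_ext_cvgP _ 0)); split => h eta /h; apply: filterS => n.
  by rewrite subr0 ger0_norm // pr_ge0.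
by rewrite subr0 ger0_norm // pr_ge0.
Qed.

Lemma hp_sub (eta : R) (A B : nat -> set T) :
  (\forall n \near \oo, A n `<=` B n) -> hp eta A -> hp eta B.
Proof.
move=> AB hA; near=> n; apply: (@le_trans _ _ (pr (~` A n))).
  by apply: pr_mono; apply: subsetC; near: n.
by near: n.
Unshelve. all: by end_near. Qed.

Lemma hpI (a b : R) (A B : nat -> set T) :
  hp a A -> hp b B -> hp (a + b) (fun n => A n `&` B n).
Proof.
move=> hA hB; near=> n; rewrite setCI; apply: (le_trans (prU _ _)).
by apply: lerD; near: n.
Unshelve. all: by end_near. Qed.

Lemma wpa1_sub (A B : nat -> set T) :
  (\forall n \near \oo, A n `<=` B n) -> wpa1 P A -> wpa1 P B.
Proof. by move=> AB /wpa1P hA; apply/wpa1P => eta /hA; apply: hp_sub. Qed.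

Lemma wpa1I (A B : nat -> set T) :
  wpa1 P A -> wpa1 P B -> wpa1 P (fun n => A n `&` B n).
Proof.
move=> /wpa1P hA /wpa1P hB; apply/wpa1P => eta eta0.
have e2 : 0 < eta / 2 by lra.
by rewrite [eta]splitr; apply: hpI; [exact: hA|exact: hB].
Qed.

Lemma hp_wpa1 (a b : R) (A B : nat -> set T) : a < b ->
  hp a A -> wpa1 P B -> hp b (fun n => A n `&` B n).
Proof.
move=> ab hA /wpa1P hB; have -> : b = a + (b - a) by ring.
by apply: hpI => //; apply: hB; rewrite subr_gt0.
Qed.

Lemma oPP (X : nat -> T -> \bar R) (a : nat -> R) : oP P X a <->
  forall eps, 0 < eps -> wpa1 P (fun n => [set w | `|X n w| < (eps * a n)%:E]%E).
Proof.
have e eps n : ~` [set w | `|X n w| < (eps * a n)%:E]%E = [set w | (eps * a n)%:E <= `|X n w|]%E.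
  by apply/seteqP; split => w /=; rewrite leNgt => /negP.
by split => h eps /h cv; apply: cvg_trans cv; apply: near_eq_cvg;
  apply: nearW => n /=; rewrite e.
Qed.

Lemma le_oPP (X Y : nat -> T -> \bar R) (a : nat -> R) : le_oP P X Y a ->
  forall eps, 0 < eps -> wpa1 P (fun n => [set w | X n w <= Y n w + (eps * a n)%:E]%E).
Proof.
have e eps n : ~` [set w | X n w <= Y n w + (eps * a n)%:E]%E
    = [set w | Y n w + (eps * a n)%:E < X n w]%E.
  by apply/seteqP; split => w /=; rewrite ltNge => /negP.
by move=> h eps /h cv; apply: cvg_trans cv; apply: near_eq_cvg;
  apply: nearW => n /=; rewrite e.
Qed.

(** Outer probabilities of a set and of its complement add up to at least 1, so
    upper bounds with total 1 on both already give the limit. *)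
Lemma mu_ext_cvg_upper (A B : nat -> set T) (l : R) :
  (forall n, B n = ~` A n) ->
  (forall eta, 0 < eta -> \forall n \near \oo, pr (A n) <= l + eta) ->
  (forall eta, 0 < eta -> \forall n \near \oo, pr (B n) <= 1 - l + eta) ->
  mu_ext P (A n) @[n --> \oo] --> l%:E /\ mu_ext P (B n) @[n --> \oo] --> (1 - l)%:E.
Proof.
move=> eB hA hB; split; apply/mu_ext_cvgP => eta eta0;
  have := hB _ eta0; have := hA _ eta0; apply: filterS2 => n;
  have := prC_ge (A n); rewrite -eB => h1 h2 h3; rewrite ler_norml; lra.
Qed.

End OuterProbability.

(** * The normal and chi-squared limit laws *)

Section StandardNormal.
Context (R : realType).
Local Notation N := (@normal_prob R 0 1).

Definition Phi (x : R) : R := fine (N [set y | y <= x]).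

Lemma measurable_le (x : R) : measurable [set y : R | y <= x].
Proof.
have -> : [set y : R | y <= x] = `]-oo, x]%classic.
  by apply/seteqP; split => y /=; rewrite in_itv.
exact: measurable_itv.
Qed.

Lemma PhiE x : N [set y | y <= x] = (Phi x)%:E.
Proof.
by rewrite /Phi fineK //; apply: fin_num_measure; exact: measurable_le.
Qed.

Lemma Phi_itv a b : a <= b -> N `]a, b]%classic = (Phi b - Phi a)%:E.
Proof.
move=> ab.
have -> : `]a, b]%classic = [set y | y <= b] `\` [set y | y <= a].
  apply/seteqP; split => y /=; rewrite in_itv /=.
    by move=> /andP[ay yb]; split => //; apply/negP; rewrite -ltNge.
  by move=> [-> /negP]; rewrite -ltNge => ->.
have sub : [set y : R | y <= a] `<=` [set y | y <= b].
  by move=> y /= /le_trans; apply.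
rewrite measureD; try exact: measurable_le; last first.
  by rewrite [X in (X < _)%E]PhiE ltry.
by rewrite (setIidr sub) EFinB -!PhiE.
Qed.

(** The normal density is bounded, so its distribution function is Lipschitz. *)
Lemma Phi_lip a b : a <= b -> 0 <= Phi b - Phi a <= normal_peak (1 : R) * (b - a).
Proof.
move=> ab; rewrite -!lee_fin -Phi_itv // measure_ge0 /=.
rewrite /normal_prob.
apply: (@le_trans _ _ (\int[lebesgue_measure]_(x in `]a, b]%classic) (normal_peak (1:R))%:E)%E).
  apply: ge0_le_integral => //=.
  - by move=> x _; rewrite lee_fin normal_pdf_ge0.
  - by apply/measurable_funTS/measurable_EFinP; exact: measurable_normal_pdf.
  - by move=> x _; rewrite lee_fin normal_pdf_ub ?oner_eq0.
rewrite integral_cst //= lebesgue_measure_itv /=.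
case: ifPn; first by rewrite -EFinB -EFinM lexx.
by move=> _; rewrite mule0 lee_fin mulr_ge0 ?normal_peak_ge0 // subr_ge0.
Qed.

Lemma normal_atom x : N [set x] = 0%E.
Proof.
have h : N `<< (@lebesgue_measure R) := normal_prob_dominates 0 1.
apply: ((null_content_dominatesP _ _).1 h) => //.
exact: lebesgue_measure_set1.
Qed.

Lemma Phi_tails eta : 0 < eta ->
  exists K, [/\ 0 <= K, Phi (- K) <= eta & 1 - eta <= Phi K].
Proof.
move=> eta0.
have cvl : N [set y | y <= k%:R] @[k --> \oo] --> (1%:E : \bar R).
  have -> : 1%:E = N (\bigcup_k [set y | y <= k%:R]).
    transitivity (N setT); first by rewrite probability_setT.
    congr (N _); apply/esym/seteqP; split => // y _.
    by exists (Num.truncn y).+1 => //=; apply/ltW; exact: truncnS_gt.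
  apply: nondecreasing_cvg_mu.
  - by move=> k; exact: measurable_le.
  - by apply: bigcup_measurable => k _; exact: measurable_le.
  - apply/nondecreasing_seqP => k; apply/subsetPset => y /= /le_trans; apply.
    by rewrite ler_nat.
have cvr : N [set y | y <= - k%:R] @[k --> \oo] --> (0%:E : \bar R).
  have -> : 0%:E = N (\bigcap_k [set y | y <= - k%:R]).
    transitivity (N set0); first by rewrite measure0.
    congr (N _); apply/esym/seteqP; split => // y /= h.
    have := h (Num.truncn (- y)).+1 Logic.I; rewrite /= lerNr leNgt => /negP; apply.
    exact: truncnS_gt.
  apply: nonincreasing_cvg_mu.
  - by rewrite [X in (X < _)%E]PhiE ltry.
  - by move=> k; exact: measurable_le.
  - by apply: bigcap_measurable => // k _; exact: measurable_le.
  - apply/nonincreasing_seqP => k; apply/subsetPset => y /= /le_trans; apply.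
    by rewrite lerN2 ler_nat.
have /fine_cvgP[_ /= cl] := cvl; have /fine_cvgP[_ /= cr] := cvr.
have [k [h1 h2]] : exists k : nat, `|1 - Phi k%:R| <= eta /\ `|0 - Phi (- k%:R)| <= eta.
  have [k _ Hk] : \forall k \near \oo, `|1 - Phi k%:R| <= eta /\ `|0 - Phi (- k%:R)| <= eta.
    by near=> k; split; near: k; exact: cvgr_dist_le.
  by exists k; apply: (Hk k) => /=.
exists k%:R; split => //; move: h1 h2; rewrite !ler_norml; lra.
Unshelve. all: by end_near. Qed.

End StandardNormal.

Section ChiSquare.
Context (R : realType).
Local Notation N := (@normal_prob R 0 1).

Definition chi2_cdf (x : R) : R :=
  if 0 <= x then Phi (Num.sqrt x) - Phi (- Num.sqrt x) else 0.

Lemma sqr_le_sqrt (x y : R) : 0 <= x -> (y ^+ 2 <= x) = (- Num.sqrt x <= y <= Num.sqrt x).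
Proof.
move=> x0; rewrite -ler_norml -(@ler_pXn2r _ 2 _ `|y|) ?nnegrE ?sqrtr_ge0 //.
by rewrite sqr_sqrtr // real_normK ?num_real.
Qed.

Lemma chi2_le (x : R) : @chi2_1 R [set y | y <= x] = (chi2_cdf x)%:E.
Proof.
rewrite /chi2_1 /chi2_cdf /=; case: ifPn => x0; last first.
  rewrite -[RHS](measure0 N); congr (N _); apply/seteqP; split => // y /= yx.
  by move: x0; rewrite (le_trans (sqr_ge0 y) yx).
have s0 : - Num.sqrt x <= Num.sqrt x by have := sqrtr_ge0 x; lra.
have -> : [set y | y ^+ 2 <= x] = `]- Num.sqrt x, Num.sqrt x]%classic `|` [set - Num.sqrt x].
  apply/seteqP; split => y /=; rewrite in_itv /= sqr_le_sqrt //.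
    by move=> /andP[+ ->]; rewrite le_eqVlt => /orP[/eqP <-|->]; [right|left].
  by move=> [/andP[/ltW -> ->]|->] //; rewrite lexx.
rewrite -Phi_itv //.
have e (A B : set R) : measurable A -> measurable B -> A `&` B = set0 ->
  N (A `|` B) = (N A + N B)%E by move=> *; apply: measureU.
rewrite [LHS]e //; last first.
  by apply/seteqP; split => // y [/=]; rewrite in_itv /= => + yE; rewrite yE ltxx.
by rewrite normal_atom adde0.
Qed.

Lemma chi2_gt (x : R) : @chi2_1 R [set y | x < y] = (1 - chi2_cdf x)%:E.
Proof.
have m : measurable [set y : R | y ^+ 2 <= x].
  rewrite -[X in measurable X]setTI; apply: measurable_fun_ler => //.
transitivity (N (~` [set y : R | y ^+ 2 <= x])).
  rewrite /chi2_1; congr (N _); apply/seteqP; split => y /=; rewrite ltNge => /negP //.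
have e (A : set R) : measurable A -> N (~` A) = (1 - N A)%E by move=> mA; apply: probability_setC.
rewrite [LHS]e // EFinB; congr (_ - _)%E; exact: chi2_le.
Qed.

Context (d : measure_display) (T : measurableType d).
Variable P : probability T R.
Variable W : nat -> T -> R.
Hypotheses (mW : forall n, measurable_fun setT (W n))
  (hW : cvg_dist P (fun n w => (W n w)%:E) N).

Let cdf n x := pr P [set w | W n w <= x].

Let mcdf n x : measurable [set w | W n w <= x].
Proof.
by rewrite -[X in measurable X]setTI; apply: measurable_fun_ler.
Qed.

Let cdf_cvg x eta : 0 < eta -> \forall n \near \oo, `|cdf n x - Phi x| <= eta.
Proof.
move: eta; have [h _] := hW (normal_atom x).
have e : (fun n => mu_ext P [set w | (W n w)%:E <= x%:E]%E) =
  (fun n => mu_ext P [set w | W n w <= x]).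
  by apply/funext => n; congr (mu_ext P _); apply/seteqP; split => w /=; rewrite lee_fin.
have {}h : mu_ext P [set w | W n w <= x] @[n --> \oo] --> (Phi x)%:E.
  by rewrite -PhiE -e.
exact/mu_ext_cvgP.
Qed.

Lemma normal_limit_tight eta : 0 < eta ->
  exists2 K : R, 0 <= K & hp P eta (fun n => [set w | `|W n w| <= K]).
Proof.
move=> eta0; have e4 : 0 < eta / 4 by lra.
have [K [K0 h1 h2]] := Phi_tails e4; exists K => //.
have c1 := cdf_cvg (- K) e4; have c2 := cdf_cvg K e4.
near=> n.
have : `|cdf n (- K) - Phi (- K)| <= eta / 4 by near: n.
have : `|cdf n K - Phi K| <= eta / 4 by near: n.
rewrite !ler_norml => /andP[a1 _] /andP[_ a2].
have : pr P (~` [set w | `|W n w| <= K]) <=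
  pr P ([set w | W n w <= - K] `|` ~` [set w | W n w <= K]).
  apply: pr_mono => w /= /negP; rewrite -ltNge.
  have [Wk|kW] := leP (W n w) K; last by move=> _; right.
  move=> h; left; move: h; rewrite ltNge ler_norml Wk andbT -ltNge; exact: ltW.
move=> h; apply: (le_trans h); apply: (le_trans (prU _ _ _)).
rewrite (prC P (mcdf n K)) -/(cdf n K) -/(cdf n (-K)); lra.
Unshelve. all: by end_near. Qed.

(** The normal law has no atom at 0, so its distribution function differs from
    that of the constant 0 on one side of 0. *)
Lemma normal_limit_nonzero : \forall n \near \oo, exists w, W n w <> 0.
Proof.
have [x [eta [e0 Hx]]] : exists x eta : R, 0 < eta /\
    ((x < 0 /\ eta < Phi x) \/ (0 <= x /\ eta < 1 - Phi x)).
  have [P0|P0] := ltP (Phi 0 : R) 1.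
    by exists 0, ((1 - Phi 0) / 2); split; [lra|right; split => //; lra].
  pose k := normal_peak (1 : R) + 1.
  have k0 : 0 < k by rewrite ltr_wpDl // normal_peak_ge0.
  exists (- (1 / (2 * k))), (1 / 4); split; first lra.
  left; split; first by rewrite oppr_lt0 divr_gt0 // mulr_gt0.
  have : - (1 / (2 * k)) <= 0 by rewrite oppr_le0 divr_ge0 // mulr_ge0 // ltW.
  move=> /Phi_lip/andP[_].
  have : normal_peak (1 : R) * (0 - - (1 / (2 * k))) <= 1 / 2.
    rewrite sub0r opprK mulrA mulr1 ler_pdivrMr ?mulr_gt0 // /k; lra.
  lra.
have c := cdf_cvg x e0; near=> n.
have : `|cdf n x - Phi x| <= eta by near: n.
rewrite ler_norml => cn; apply: contrapT => no.
have W0 w : W n w = 0 by apply: contrapT => nw; apply: no; exists w.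
case: Hx => [[x0 h]|[x0 h]].
  have : cdf n x = 0.
    rewrite /cdf; have -> : [set w | W n w <= x] = set0; last exact: pr0.
    by apply/seteqP; split => // w /=; rewrite W0 leNgt x0.
  by lra.
have : cdf n x = 1.
  rewrite /cdf; have -> : [set w | W n w <= x] = setT; last exact: prT.
  by apply/seteqP; split => // w _ /=; rewrite W0.
by lra.
Unshelve. all: by end_near. Qed.

Variable X : nat -> T -> \bar R.
Hypothesis hX : oP P (fun n w => X n w - (W n w ^+ 2)%:E)%E (@one_seq R).

Let close eps n := [set w | `|X n w - (W n w ^+ 2)%:E| < (eps * 1)%:E]%E.

Let closeE eps n w : close eps n w -> exists2 r, X n w = r%:E & `|r - W n w ^+ 2| < eps.
Proof.
rewrite /close /= mulr1; case: (X n w) => [r|//|//].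
by rewrite -EFinB abse_EFin lte_fin; exists r.
Qed.

Let far eps eta : 0 < eps -> 0 < eta ->
  \forall n \near \oo, pr P (~` close eps n) <= eta.
Proof. by move=> e0 eta0; have /oPP/(_ eps e0)/wpa1P := hX; apply. Qed.

Let upper_le x eta : 0 < eta ->
  \forall n \near \oo, pr P [set w | X n w <= x%:E]%E <= chi2_cdf x + eta.
Proof.
move=> eta0; have e4 : 0 < eta / 4 by lra.
rewrite /chi2_cdf; case: ifPn => x0; last first.
  have nx : 0 < - x by rewrite oppr_gt0 ltNge.
  have f := far nx eta0; near=> n.
  have : pr P (~` close (- x) n) <= eta by near: n.
  rewrite add0r; apply: le_trans; apply: pr_mono => w /= Xx /closeE[r Xr].
  move: Xx; rewrite Xr lee_fin => rx; rewrite ltr_norml.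
  by have := sqr_ge0 (W n w) => ? /andP[? _]; lra.
pose h := eta / (8 * (normal_peak (1 : R) + 1)).
have p0 : 0 < normal_peak (1 : R) + 1 by rewrite ltr_wpDl // normal_peak_ge0.
have h0 : 0 < h by rewrite divr_gt0 // mulr_gt0.
have ph : normal_peak (1 : R) * h <= eta / 8.
  rewrite /h mulrA ler_pdivrMr ?mulr_gt0 //.
  have -> : eta / 8 * (8 * (normal_peak (1:R) + 1)) = (normal_peak (1:R) + 1) * eta by field.
  by rewrite ler_pM2r // lerDl.
set s := Num.sqrt x; pose b := s + h.
have s0 : 0 <= s by exact: sqrtr_ge0.
have b0 : 0 < b by rewrite /b; lra.
have hh : 0 < h ^+ 2 by rewrite exprn_gt0.
have f := far hh e4; have c1 := cdf_cvg b e4; have c2 := cdf_cvg (- b) e4.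
near=> n.
have far_n : pr P (~` close (h ^+ 2) n) <= eta / 4 by near: n.
have : `|cdf n b - Phi b| <= eta / 4 by near: n.
have : `|cdf n (- b) - Phi (- b)| <= eta / 4 by near: n.
have /Phi_lip/andP[_ l1] : s <= b by rewrite /b; lra.
have /Phi_lip/andP[_ l2] : - b <= - s by rewrite /b; lra.
have bs : b - s = h by rewrite /b; ring.
have bs' : - s - - b = h by rewrite /b; ring.
rewrite bs in l1; rewrite bs' in l2.
rewrite !ler_norml => /andP[a1 _] /andP[_ a2].
have sub : [set w | X n w <= x%:E]%E `<=`
    ([set w | W n w <= b] `\` [set w | W n w <= - b]) `|` ~` close (h ^+ 2) n.
  move=> w /= Xx; have [cl|ncl] := pselect (close (h ^+ 2) n w); last by right.
  left; have [r Xr rW] := closeE cl; move: Xx; rewrite Xr lee_fin => rx.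
  have : W n w ^+ 2 < b ^+ 2.
    have -> : b ^+ 2 = x + 2 * (s * h) + h ^+ 2.
      by rewrite /b -[x](sqr_sqrtr x0) -/s; ring.
    move: rW; rewrite ltr_norml => /andP[rW _].
    have : 0 <= s * h by rewrite mulr_ge0 // ltW.
    lra.
  rewrite -[ltLHS]real_normK ?num_real // ltr_pXn2r ?nnegrE ?(ltW b0) //.
  rewrite ltr_norml => /andP[w1 w2]; split; first exact: ltW.
  by apply/negP; rewrite -ltNge.
apply: (le_trans (pr_mono P sub)); apply: (le_trans (prU _ _ _)).
rewrite prD //; last by move=> w /= /le_trans; apply; lra.
rewrite -/(cdf n b) -/(cdf n (- b)); lra.
Unshelve. all: by end_near. Qed.

Let upper_gt x eta : 0 < eta ->
  \forall n \near \oo, pr P [set w | x%:E < X n w]%E <= 1 - chi2_cdf x + eta.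
Proof.
move=> eta0; have e4 : 0 < eta / 4 by lra.
have [x0|x0] := leP x 0.
  apply: nearW => n; apply: (le_trans (pr_le1 _ _)).
  rewrite /chi2_cdf; case: ifPn => x0'; last lra.
  have -> : x = 0 by lra.
  by rewrite sqrtr0 oppr0; lra.
rewrite /chi2_cdf (ltW x0).
set s := Num.sqrt x; have s0 : 0 < s by rewrite sqrtr_gt0.
have p0 : 0 < normal_peak (1 : R) + 1 by rewrite ltr_wpDl // normal_peak_ge0.
pose h := Num.min (s / 2) (eta / (8 * (normal_peak (1 : R) + 1))).
have h0 : 0 < h by rewrite lt_min divr_gt0 //= divr_gt0 // mulr_gt0.
have hs : h <= s / 2 by rewrite ge_min lexx.
have ph : normal_peak (1 : R) * h <= eta / 8.
  apply: (@le_trans _ _ ((normal_peak (1 : R) + 1) * h)).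
    by rewrite ler_pM2r // lerDl.
  rewrite mulrC -ler_pdivlMr //.
  have -> : eta / 8 / (normal_peak (1 : R) + 1) = eta / (8 * (normal_peak (1 : R) + 1)).
    by field; rewrite gt_eqF.
  by rewrite ge_min lexx orbT.
pose c := s - h; have c0 : 0 < c by rewrite /c; lra.
pose eps := x - c ^+ 2.
have eps0 : 0 < eps.
  have xs : x = s ^+ 2 by rewrite /s sqr_sqrtr // ltW.
  by rewrite subr_gt0 xs ltr_pXn2r ?nnegrE ?(ltW c0) ?(ltW s0) // /c; lra.
have f := far eps0 e4; have c1 := cdf_cvg c e4; have c2 := cdf_cvg (- c) e4.
near=> n.
have far_n : pr P (~` close eps n) <= eta / 4 by near: n.
have : `|cdf n c - Phi c| <= eta / 4 by near: n.
have : `|cdf n (- c) - Phi (- c)| <= eta / 4 by near: n.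
have /Phi_lip/andP[_ l1] : c <= s by rewrite /c; lra.
have /Phi_lip/andP[_ l2] : - s <= - c by rewrite /c; lra.
have bs : s - c = h by rewrite /c; ring.
have bs' : - c - - s = h by rewrite /c; ring.
rewrite bs in l1; rewrite bs' in l2.
rewrite !ler_norml => /andP[_ a1] /andP[a2 _].
have sub : [set w | x%:E < X n w]%E `<=`
    ([set w | W n w <= - c] `|` ~` [set w | W n w <= c]) `|` ~` close eps n.
  move=> w /= Xx; have [cl|ncl] := pselect (close eps n w); last by right.
  left; have [r Xr rW] := closeE cl; move: Xx; rewrite Xr lte_fin => rx.
  have : c ^+ 2 < W n w ^+ 2.
    by move: rW; rewrite ltr_norml /eps => /andP[_ rW]; lra.
  rewrite -[ltRHS]real_normK ?num_real // ltr_pXn2r ?nnegrE ?(ltW c0) // => cw.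
  have [Wc|cW] := leP (W n w) c; last by right.
  left => /=; move: cw; rewrite ltNge ler_norml Wc andbT -ltNge; exact: ltW.
apply: (le_trans (pr_mono P sub)); apply: (le_trans (prU _ _ _)).
have := prU P [set w | W n w <= - c] (~` [set w | W n w <= c]).
rewrite (prC P (mcdf n c)) -/(cdf n c) -/(cdf n (- c)); lra.
Unshelve. all: by end_near. Qed.

(** Both half-lines of X are contained, up to an event of small outer
    probability, in half-line events of W at points close to the two square
    roots of x; the normal distribution function is Lipschitz there. *)
Lemma cvg_dist_chi2 : cvg_dist P X (@chi2_1 R).
Proof.
move=> x _; rewrite chi2_le chi2_gt.
apply: mu_ext_cvg_upper => [n|eta|eta]; [|exact: upper_le|exact: upper_gt].
by apply/seteqP; split => w /=; rewrite ltNge => /negP.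
Qed.

End ChiSquare.

(** * Consistency and rate of the unrestricted estimator *)

Section Estimator.
Context (R : realType) (dy dx dth drho : nat)
  (H : completeNormedModType R) (d : measure_display)
  (Omega : measurableType d).
Variable M : psmd_model dy dx dth drho H Omega.
Local Notation L := (lawZ M).
Local Notation P := (prob M).
Local Notation a0 := (alpha0 M).
Local Notation E := ('rV[R]_dth * H)%type.
Hypotheses (Hm : model_setup M) (He : estimator_setup M) (Hl : local_setup M)
  (Hrz : riesz_setup M) (HID : cond_ID M) (HPEN : cond_PEN M) (HCRIT : cond_CRIT M)
  (HLOC : cond_LOC M) (HPHI : cond_PHI M) (HLQA : cond_LQA M).

Let Hpd : pathwise_diff M. Proof. by have [[]] := HLOC. Qed.

(** If the norm of vstar were 0, then ustar = 0 and the score Z_n would vanish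
    identically, which contradicts its normal limit. *)
Lemma near_nrm_sd_vstar : \forall n \near \oo, nrm_sd M (vstar M n) != 0.
Proof.
have [_ cv] := HLQA; have := normal_limit_nonzero cv.
apply: filterS => n [w nz]; apply/eqP => sd0; apply: nz.
have u0 : ustar M n = 0 by rewrite /ustar sd0 invr0 scale0r.
rewrite /sqrtnZn /Zn big1 ?mulr0 // => i _.
have -> : mdot M (obs M i w).2 (ustar M n) = 0.
  by apply/matrixP => k j; rewrite !mxE u0 derive0.
by rewrite /wform trmx0 !mul0mx mxE.
Qed.

Lemma sqrtnZn_meas n : measurable_fun setT (sqrtnZn M n).
Proof.
have [[mobs _ _] [_ [ce _]]] := Hm.
have Aa0 : Aset M a0 by exact: Theta_a0 Hm.
apply: measurable_funM => //; apply: measurable_funM => //.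
apply: measurable_sum => i.
pose F (z : borelV R dy * borelV R dx) :=
  wform (Sig M z.2) (mdot M z.2 (ustar M n)) (rho M z a0).
apply: (measurableT_comp (f := F) _ (mobs i)).
apply: measurable_wform; [exact: (Sig_meas Hm)|exact: (mdot_meas Hpd (ustar_Dir Hrz n))|].
move=> k j; rewrite (ord1 j); have [ig _ _ _] := ce _ Aa0 k.
by apply/measurable_EFinP; apply: (measurable_int L).
Qed.

Let Pen_ge0 h : (0 <= Pen M h)%E.
Proof. by have [_ [_ [_ [_ [+ _]]]]] := He; apply. Qed.

Let pen_Pia0 n : (Pen M (Pih0 M n) <= (M0 M)%:E)%E.
Proof.
have [_ [[Plt _] _]] := Hl.
by have /(pen_leE HPEN) := ltW (Plt n).
Qed.

Lemma pen_fin h : (Pen M h <= (M0 M)%:E)%E -> exists2 p, Pen M h = p%:E & 0 <= p <= M0 M.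
Proof.
have := Pen_ge0 h; case: (Pen M h) => [p|//|//]; rewrite !lee_fin => p0 p1.
by exists p => //; rewrite p0.
Qed.

(** Comparison of the estimator with the sieve approximation of alpha0: every
    term of the bound is of order delta_n^2. *)
Lemma Qhat_hata_rate : exists K0, wpa1 P (fun n => [set w |
  Qhat M (sample M n w) (hata_w M n w) <= K0 * delta M n ^+ 2 /\ pen_lt M n (hata_w M n w)]).
Proof.
have [[c0 c00 crit] _] := HCRIT; have [k k0 nk] := near_delta_rate Hl HLOC.
have [_ [[_ Ept] _]] := Hl.
have [_ [_ [_ [_ [_ [_ [_ [hAk min]]]]]]]] := He.
have Emin := le_oPP min ltr01; have Ecrit := le_oPP crit ltr01.
have dom := near_delta_dom HLOC (e := fun=> 0) _.
have {}dom : \forall n \near \oo, [/\ (Q M (Pia0 M n) <= (delta M n ^+ 2)%:E)%E,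
    lam M n <= delta M n ^+ 2 & 0 <= delta M n ^+ 2].
  by apply: dom; rewrite /little_o_inv; under eq_fun do rewrite mulr0; exact: cvg_cst.
exists (c0 + M0 M + 2 / k ^+ 2).
apply: wpa1_sub (wpa1I Ept (wpa1I Emin Ecrit)).
near=> n; move=> w [/= plt [h1 h2]]; split=> //; move: h1 h2.
have [Qd ld _] : [/\ (Q M (Pia0 M n) <= (delta M n ^+ 2)%:E)%E,
    lam M n <= delta M n ^+ 2 & 0 <= delta M n ^+ 2] by near: n.
have n0 : (0 < n)%N by near: n; exists 1%N.
have kd : k <= Num.sqrt n%:R * delta M n by near: n.
set zs := sample M n w; set a := hata_w M n w.
have lam0 := lam_gt0 HPEN n.
have nd : 1 * invn R n <= (k ^+ 2)^-1 * delta M n ^+ 2.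
  rewrite mul1r /invn mulrC ler_pdivlMr ?exprn_gt0 // mulrC ler_pdivrMr ?ltr0n //.
  have -> : delta M n ^+ 2 * n%:R = (Num.sqrt n%:R * delta M n) ^+ 2.
    by rewrite exprMn sqr_sqrtr ?ler0n // mulrC.
  by apply: lerXn2r => //; rewrite nnegrE ?(ltW k0) // (le_trans (ltW k0)).
have PA : Ak M (kn M n) (Pia0 M n).
  by split; [exact: Theta_a0 Hm|exact: Hk_Pih0 HID n].
move=> h1 h2.
have h3 : (penQ M zs a <= penQ M zs (Pia0 M n) + (1 * invn R n)%:E)%E.
  apply: (le_trans h1); rewrite leeD2r //.
  by apply: ereal_inf_lbound; exists (Pia0 M n).
have h4 : ((Qhat M zs (Pia0 M n))%:E <= (c0 * delta M n ^+ 2 + 1 * invn R n)%:E)%E.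
  apply: (le_trans h2); rewrite EFinD leeD2r //.
  by rewrite EFinM lee_pmul2l // lte_fin.
move: h3; rewrite /penQ.
have [pa -> /andP[pa0 _]] := pen_fin ((pen_leE HPEN _ _).1 (ltW plt)).
have [pp -> /andP[pp0 pp1]] := pen_fin (pen_Pia0 n).
rewrite -!EFinM -!EFinD !lee_fin => h3.
move: h4; rewrite lee_fin => h4.
have lp : lam M n * pp <= delta M n ^+ 2 * M0 M by apply: ler_pM => //; exact: ltW.
have lpa : 0 <= lam M n * pa by rewrite mulr_ge0 // ltW.
rewrite [leRHS]mulrDl mulrDl -mulrA; lra.
Unshelve. all: by end_near. Qed.

(** Consistency: Q tends to 0 at the estimator, while it stays away from 0
    outside the neighbourhood of alpha0 that Aos contains. *)
Lemma hata_Aosn : wpa1 P (fun n => [set w | Aosn M n (hata_w M n w)]).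
Proof.
have [K0 HK0] := Qhat_hata_rate; have [_ [c c_0 ulb]] := HCRIT.
have [[_ [_ [_ [e e0 nb]]]] [_ [[_ [db0 dbcv]] [[_ dcv] _]]]] := Hl.
have [_ [_ [_ [_ [_ [_ [_ [hAk _]]]]]]]] := He.
have [q q0 sep] := Q_separated Hm HID HPEN e0.
apply/wpa1P => eta eta0; have e2 : 0 < eta / 2 by lra.
have [C HC] := ulb _ e2.
have hpC : hp P (eta / 2) (fun n => [set w | forall a, AkM0 M n a ->
    (c%:E * Q M a - (C * deltabar M n ^+ 2)%:E <= (Qhat M (sample M n w) a)%:E)%E]).
  apply: filterS HC => n; rewrite mu_extE lee_fin; apply: le_trans; apply: pr_mono.
  move=> w /= h; apply: contrapT => no; apply: h => a Aa.
  by rewrite leNgt; apply/negP => lt; apply: no; exists a.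
have cv0 : (K0 * delta M n ^+ 2 + C * deltabar M n ^+ 2) @[n --> \oo] --> (0 : R).
  have sq (u : nat -> R) K : u n @[n --> \oo] --> (0 : R) ->
      K * u n ^+ 2 @[n --> \oo] --> (0 : R).
    move=> cu; rewrite -[X in _ --> X](mulr0 K); apply: cvgMr.
    by rewrite -[X in _ --> X](mulr0 (0 : R)); under eq_cvg do rewrite expr2; exact: cvgM.
  by rewrite -[X in _ --> X](addr0 (0 : R)); apply: cvgD; exact: sq.
have lt2 : eta / 2 < eta by lra.
apply: hp_sub (hp_wpa1 lt2 hpC HK0); near=> n; move=> w [/= lb [Qle plt]].
have Aa : Ak M (kn M n) (hata_w M n w) by exact: hAk.
split => //; apply: (nb n) => //; first by case: Aa.
rewrite ltNge; apply/negP => far.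
have pa := (pen_leE HPEN _ _).1 (ltW plt).
have Qq := sep _ Aa.1 pa far.
have := lb _ (conj Aa (ltW plt)); rewrite EFinN leeBlDr // -EFinD => up.
have : (c%:E * q%:E <= c%:E * Q M (hata_w M n w))%E by rewrite lee_pmul2l // lte_fin.
move/le_trans/(_ up); rewrite -EFinM lee_fin => bd.
have : `|K0 * delta M n ^+ 2 + C * deltabar M n ^+ 2| < c * q.
  by near: n; apply: cvgr0_norm_lt => //; rewrite mulr_gt0.
by rewrite ltr_norml => /andP[_]; lra.
Unshelve. all: by end_near. Qed.

Lemma nrm_rate_of_Q c K a r : 0 < c -> 0 <= K -> 0 <= r ->
  ((c * nrm M (a - a0) ^+ 2)%:E <= Q M a)%E -> (Q M a <= (K * r ^+ 2)%:E)%E ->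
  nrm M (a - a0) <= Num.sqrt (K / c) * r.
Proof.
move=> c0 K0 r0 h1 h2; have := le_trans h1 h2; rewrite lee_fin => h.
rewrite -(@ler_pXn2r _ 2) ?nnegrE ?mulr_ge0 ?sqrtr_ge0 //.
rewrite exprMn (@sqr_sqrtr _ (K / c)); last by rewrite divr_ge0 // ltW.
by rewrite mulrAC ler_pdivlMr // mulrC.
Qed.

Let strong_rate_sum (t dl u k1 k2 : R) : 0 <= (k1 + k2) * u -> 0 <= t * dl ->
  t * ((k1 + k2) * dl) + u <= (1 + k1 + k2) * (u + t * dl).
Proof. by move=> p1 p2; lra. Qed.

(** Rate of convergence: the criterion gives the rate in the weak norm, and the
    sieve measure of ill-posedness tau_n transfers it to the strong norm. *)
Lemma hata_Nosn : wpa1 P (fun n => [set w | Nosn M n (hata_w M n w)]).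
Proof.
have [K0 HK0] := Qhat_hata_rate; have [_ [[c1 [c2 [c10 LQ]]] [[[c c_0 ulb] _] _]]] := HLOC.
apply/wpa1P => eta eta0; have e2 : 0 < eta / 2 by lra.
have [C HC] := ulb _ e2.
have hpC : hp P (eta / 2) (fun n => [set w | forall a, Aosn M n a ->
    (c%:E * Q M a - (C * delta M n ^+ 2)%:E <= (Qhat M (sample M n w) a)%:E)%E]).
  apply: filterS HC => n; rewrite mu_extE lee_fin; apply: le_trans; apply: pr_mono.
  move=> w /= h; apply: contrapT => no; apply: h => a Aa.
  by rewrite leNgt; apply/negP => lt; apply: no; exists a.
have dom : \forall n \near \oo, [/\ (Q M (Pia0 M n) <= (delta M n ^+ 2)%:E)%E,
    lam M n <= delta M n ^+ 2 & 0 <= delta M n ^+ 2].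
  apply: (near_delta_dom HLOC (e := fun=> 0)).
  by rewrite /little_o_inv; under eq_fun do rewrite mulr0; exact: cvg_cst.
pose K := Num.max 0 ((K0 + C) / c).
have K_0 : 0 <= K by rewrite le_max lexx.
pose k1 := Num.sqrt (K / c1); pose k2 := Num.sqrt (1 / c1).
have k10 : 0 <= k1 := sqrtr_ge0 _; have k20 : 0 <= k2 := sqrtr_ge0 _.
have nM := near_Mn_ge Hm He Hl Hrz HID HLOC HPHI (1 + k1 + k2).
have nt := near_tau Hm He Hl Hrz HID HLOC HPHI.
have nV := near_Vbark_hullk He Hrz.
have nP := near_Pia0_Aosn Hm Hl HID.
have ip_p := ip_props Hm HID HLOC.
have lt2 : eta / 2 < eta by lra.
apply: hp_sub (hp_wpa1 lt2 hpC (wpa1I HK0 hata_Aosn)); near=> n.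
move=> w [/= lb [[Qle plt] Aa]]; set a := hata_w M n w in Aa lb Qle plt *.
have [Qd ld _] : [/\ (Q M (Pia0 M n) <= (delta M n ^+ 2)%:E)%E,
    lam M n <= delta M n ^+ 2 & 0 <= delta M n ^+ 2] by near: n.
have [t0 tle] : 0 < tau M n /\
  forall a, Aosn M n a -> nrm M (a - Pia0 M n) != 0 ->
    norm_s (a - Pia0 M n) <= tau M n * nrm M (a - Pia0 M n) by near: n.
have [eV _] : Vbark M (kn M n) = hullk M (kn M n) /\
  exists2 m, (1 < m)%N & has_dim (hullk M (kn M n)) m by near: n.
have PA : Aosn M n (Pia0 M n) by near: n.
have MK : 1 + k1 + k2 <= Mn M n by near: n.
have d0 := delta_gt0 Hl n.
have Qa : (Q M a <= (K * delta M n ^+ 2)%:E)%E.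
  have := lb _ Aa; rewrite EFinN leeBlDr // -EFinD => up.
  have : (c%:E * Q M a <= (c * (K * delta M n ^+ 2))%:E)%E.
    apply: (le_trans up); rewrite lee_fin.
    apply: (@le_trans _ _ ((K0 + C) * delta M n ^+ 2)); first by rewrite mulrDl; lra.
    rewrite [c * _]mulrA ler_pM2r ?exprn_gt0 // mulrC -ler_pdivrMr //.
    by rewrite le_max lexx orbT.
  by rewrite [X in (_ <= X)%E]EFinM lee_pmul2l // lte_fin.
have rate : nrm M (a - a0) <= k1 * delta M n.
  apply: (nrm_rate_of_Q c10 K_0 (ltW d0) _ Qa).
  by have /andP[] := LQ _ Aa.1.
have rateP : nrm M (Pia0 M n - a0) <= k2 * delta M n.
  apply: (nrm_rate_of_Q c10 ler01 (ltW d0)); last by rewrite mul1r.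
  by have /andP[] := LQ _ PA.1.
have ha : hullk M (kn M n) (a - Pia0 M n).
  by apply: subspaceB; [exact: subspace_hullk|case: Aa => _ []|exact: Pia0_hullk HID n].
have sa : norm_s (a - Pia0 M n) <= tau M n * ((k1 + k2) * delta M n).
  have [n0|n0] := eqVneq (nrm M (a - Pia0 M n)) 0.
    rewrite (nrm_hullk_eq0 HPHI eV ha n0) -[0](scale0r (0 : E)) norm_sZ normr0 mul0r.
    by apply: mulr_ge0; [exact: ltW|apply: mulr_ge0; [exact: addr_ge0|exact: ltW]].
  apply: (le_trans (tle _ Aa n0)); rewrite ler_pM2l // mulrDl.
  have -> : a - Pia0 M n = (a - a0) - (Pia0 M n - a0) by rewrite opprB addrA subrK.
  apply: (le_trans (nrmB_le Hm HID HLOC (Aos_Dir Aa.1) (Aos_Dir PA.1))).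
  exact: lerD.
have ds : 0 <= delta_s M n.
  by rewrite addr_ge0 //; apply: mulr_ge0; exact: ltW.
split; last by case: Aa.
split; first by case: Aa => _ [].
- apply: (le_trans rate); rewrite ler_pM2r //; apply: le_trans MK.
  by rewrite -addrA addrCA lerDl addr_ge0.
- apply: (@le_trans _ _ ((1 + k1 + k2) * delta_s M n)); last by rewrite ler_wpM2r.
  have -> : a - a0 = (a - Pia0 M n) + (Pia0 M n - a0) by rewrite addrA subrK.
  apply: (le_trans (norm_sD_le _ _)); rewrite norm_s_Pia0.
  have p1 : 0 <= (k1 + k2) * `|a0.2 - Pih0 M n|.
    by apply: mulr_ge0 => //; exact: addr_ge0.
  have p2 : 0 <= tau M n * delta M n by apply: mulr_ge0; exact: ltW.
  apply: (le_trans (lerD sa (lexx _))); rewrite /delta_s.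
  exact: strong_rate_sum p1 p2.
- exact: ltW.
Unshelve. all: by end_near. Qed.

End Estimator.

(** * The expansion of the statistic *)

Lemma near_ereal_le (R : realType) (f : nat -> \bar R) (e : R) :
  f n @[n --> \oo] --> (0 : \bar R)%E -> 0 < e -> \forall n \near \oo, (f n <= e%:E)%E.
Proof.
move=> /fine_cvgP[ffin /= cv] e0; near=> n.
have fn : f n \is a fin_num by near: n.
rewrite -(fineK fn) lee_fin; apply: (le_trans (ler_norm _)); near: n.
exact: cvgr0_norm_le.
Unshelve. all: by end_near. Qed.

Section Expansion.
Context (R : realType) (dy dx dth drho : nat)
  (H : completeNormedModType R) (d : measure_display)
  (Omega : measurableType d).
Variable M : psmd_model dy dx dth drho H Omega.
Local Notation L := (lawZ M).
Local Notation P := (prob M).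
Local Notation a0 := (alpha0 M).
Local Notation E := ('rV[R]_dth * H)%type.
Hypotheses (Hm : model_setup M) (He : estimator_setup M) (Hre : restricted_estimator_setup M)
  (Hl : local_setup M)
  (Hrz : riesz_setup M) (HID : cond_ID M) (HPEN : cond_PEN M) (HCRIT : cond_CRIT M)
  (HLOC : cond_LOC M) (HPHI : cond_PHI M) (HLQA : cond_LQA M)
  (HB : Bn_consistent M) (HPP : pen_perturbation M)
  (HR : wpa1 P (fun n => [set w | Nosn M n (hataR_w M n w)]))
  (H0 : phi M a0 = phi0 M).

Local Notation sq n := (Num.sqrt n%:R : R).

Let pen_close e n := forall a t b, NT M n (a, t) -> Nosn M n b ->
  exists p q, [/\ Pen M (pert M n a t).2 = p%:E, Pen M b.2 = q%:E &
    n%:R * lam M n * (p - q) <= e].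

Lemma near_pen_close e : 0 < e -> \forall n \near \oo, pen_close e n.
Proof.
move=> e0; have le := near_ereal_le HPP e0.
near=> n; have len : ((n%:R * lam M n)%:E *
     ereal_sup [set `|Pen M (pert M n p.1.1 p.1.2).2 - Pen M p.2.2|
                  | p in NT M n `*` Nosn M n] <= e%:E)%E by near: n.
move=> a t b nt nb; have n0 : (0 < n)%N by near: n; exists 1%N.
have nl : 0 < n%:R * lam M n by rewrite mulr_gt0 ?ltr0n // (lam_gt0 HPEN).
have [q qE _] := pen_fin He ((pen_leE HPEN n b).1 (let: And4 _ _ _ h := nb.1 in h)).
have : ((n%:R * lam M n)%:E * `|Pen M (pert M n a t).2 - Pen M b.2| <= e%:E)%E.
  apply: le_trans len.
  rewrite lee_pmul2l // ?lte_fin //; apply: ereal_sup_ubound.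
  by exists ((a, t), b).
rewrite qE; have [_ [_ [_ [_ [/(_ (pert M n a t).2) p0 _]]]]] := He.
move: p0; case: (Pen M (pert M n a t).2) => [p _|_|//]; last first.
  by rewrite /= mulry gtr0_sg // mul1e.
rewrite -EFinB abse_EFin -EFinM lee_fin => h; exists p, q; split => //.
by apply: le_trans h; rewrite ler_pM2l // ler_norm.
Unshelve. all: by end_near. Qed.

Let scaled_compare (n l e qx qp p q : R) : 0 < n ->
  qx + l * q <= qp + l * p + e * n^-1 -> n * l * (p - q) <= e -> n * (qx - qp) <= 2 * e.
Proof.
move=> n0 h1 h2.
have : n * (qx + l * q) <= n * (qp + l * p + e * n^-1) by rewrite ler_pM2l.
rewrite !mulrDr; have -> : n * (e * n^-1) = e by field; rewrite gt_eqF.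
lra.
Qed.

(** The penalty drops out of the comparison of an approximate minimiser with a
    perturbed local point, as it oscillates by o(1/n). *)
Lemma pert_compare e n zs x a t : (0 < n)%N -> pen_close e n ->
  NT M n (a, t) -> Nosn M n x ->
  (penQ M (zs : n.-tuple _) x <= penQ M zs (pert M n a t) + (e * invn R n)%:E)%E ->
  n%:R * (Qhat M zs x - Qhat M zs (pert M n a t)) <= 2 * e.
Proof.
move=> n0 pc nt nx; have [p [q [pE qE pq]]] := pc _ _ _ nt nx.
rewrite /penQ pE qE -!EFinM -!EFinD lee_fin => h.
by apply: scaled_compare h pq; rewrite ltr0n.
Qed.

(** The unspecified o(1/n) sequence in the remainder rate is eventually below
    1/n. *)
Lemma wpa1_lqa e : 0 < e -> wpa1 P (fun n => [set w | forall a t, NT M n (a, t) ->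
  `|LQA_rem M n w a t| <= e * Num.max (t ^+ 2) (Num.max (t / sq n) n%:R^-1)]).
Proof.
move=> e0; have [[_ [[en [en0 eno] lqa] _]] _] := HLQA.
have {}lqa := (oPP _ _ _).1 lqa e e0.
apply: wpa1_sub lqa; near=> n; move=> w /=; rewrite mulr1 => lt a t nt.
have n0 : (0 < n)%N by near: n; exists 1%N.
have enn : en n <= n%:R^-1.
  rewrite -[leRHS]mul1r ler_pdivlMr ?ltr0n // mulrC.
  apply: (le_trans (ler_norm _)); near: n; exact: cvgr0_norm_le.
set m := Num.max (t ^+ 2) (Num.max (t / sq n) (en n)).
have m0 : 0 < m by rewrite !lt_max en0 !orbT.
have mm : m <= Num.max (t ^+ 2) (Num.max (t / sq n) n%:R^-1).
  by rewrite ge_max le_max lexx /= ge_max !le_max lexx enn !orbT.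
apply: (@le_trans _ _ (e * m)); last by rewrite ler_pM2l.
rewrite -ler_pdivrMr // mulrC -lee_fin.
apply: le_trans (ltW lt); apply: le_trans (lee_abs _).
by apply: ereal_sup_ubound; exists (a, t).
Unshelve. all: by end_near. Qed.

Let scaled_lqa (s n q1 q2 t z y B e rem : R) : 0 < s -> n = s ^+ 2 -> 0 < e ->
  rem = 2^-1 * (q1 - q2) - t / s * (z + y) - B / 2 * (t / s) ^+ 2 ->
  `|rem| <= e * Num.max ((t / s) ^+ 2) (Num.max (t / s / s) n^-1) ->
  `|n * (q1 - q2) - (2 * t * (s * z + s * y) + B * t ^+ 2)| <= 2 * e * (1 + t ^+ 2).
Proof.
move=> s0 -> e0 -> h.
have e1 : s ^+ 2 * (q1 - q2) - (2 * t * (s * z + s * y) + B * t ^+ 2) =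
  2 * s ^+ 2 * (2^-1 * (q1 - q2) - t / s * (z + y) - B / 2 * (t / s) ^+ 2).
  by field; rewrite gt_eqF.
rewrite e1 normrM ger0_norm; last by rewrite mulr_ge0 // sqr_ge0.
have s2 : 0 < s ^+ 2 by rewrite exprn_gt0.
apply: (@le_trans _ _ (2 * s ^+ 2 * (e * ((1 + t ^+ 2) / s ^+ 2)))).
  apply: ler_wpM2l; first by rewrite mulr_ge0 // ltW.
  apply: (le_trans h); rewrite ler_pM2l // !ge_max !ler_pdivlMr //.
  have -> : (t / s) ^+ 2 * s ^+ 2 = t ^+ 2 by field; rewrite gt_eqF.
  have -> : t / s / s * s ^+ 2 = t by field; rewrite gt_eqF.
  rewrite mulVf ?gt_eqF //; have := sqr_ge0 t; have := sqr_ge0 (t - 1).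
  by rewrite sqrrB expr1n mulr1; move=> h1 h2; apply/and3P; split; lra.
by rewrite le_eqVlt; apply/orP; left; apply/eqP; field; rewrite gt_eqF.
Qed.

Let lqa_expansion e n w a t : (0 < n)%N -> 0 < e -> NT M n (a, t / sq n) ->
  (forall a t, NT M n (a, t) ->
    `|LQA_rem M n w a t| <= e * Num.max (t ^+ 2) (Num.max (t / sq n) n%:R^-1)) ->
  `|n%:R * (Qhat M (sample M n w) (pert M n a (t / sq n)) - Qhat M (sample M n w) a)
    - (2 * t * (sqrtnZn M n w + sq n * ip M (ustar M n) (a - a0))
       + Bn M (sample M n w) * t ^+ 2)| <= 2 * e * (1 + t ^+ 2).
Proof.
move=> n0 e0 nt lqa.
have s0 : 0 < sq n by rewrite sqrtr_gt0 ltr0n.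
have ns : n%:R = sq n ^+ 2 :> R by rewrite sqr_sqrtr // ler0n.
exact: scaled_lqa s0 ns e0 (erefl (LQA_rem M n w a (t / sq n))) (lqa _ _ nt).
Qed.

Let scaled_phi (s sd nv nu f p pa y U t k e : R) : 0 < s -> 0 < sd -> 0 < e -> 0 < nv ->
  nu = nv / sd -> 0 <= k -> nu <= k ->
  s * `|f - p - t / s * (sd * U)| / nv <= e ->
  s * `|pa| / nv <= e -> y = (p - pa) / sd ->
  `|s * f / sd - (s * y + t * U)| <= 2 * e * k.
Proof.
move=> s0 sd0 e0 nv0 nuE k0 nuk h1 h2 ->.
have -> : s * f / sd - (s * ((p - pa) / sd) + t * U) =
  (s / nv * (f - p - t / s * (sd * U)) + s / nv * pa) * nu.
  by rewrite nuE; field; rewrite !gt_eqF.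
have nu0 : 0 <= nu by rewrite nuE divr_ge0 // ltW.
rewrite normrM (ger0_norm nu0); apply: ler_pM => //.
have sn0 : 0 <= s / nv by rewrite divr_ge0 // ltW.
apply: (le_trans (ler_normD _ _)); rewrite !(normrM (s / nv)) (ger0_norm sn0).
move: h1 h2; rewrite mulrAC => h1; rewrite mulrAC => h2; lra.
Qed.

(** The linearisation error and the projection bias are of order
    o(n^{-1/2}) relative to the norm of vstar, and the two norms of vstar are
    equivalent. *)
Lemma near_phi_expansion e T : 0 < e -> 0 < T -> \forall n \near \oo,
  forall a t, Nosn M n a -> `|t| <= T ->
  `|sq n * (phi M (pert M n a (t / sq n)) - phi M a0) / nrm_sd M (vstar M n)
    - (sq n * ip M (ustar M n) (a - a0) + t * nrm M (ustar M n) ^+ 2)| <= e.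
Proof.
move=> e0 T0.
have [k1 [k2 [k10 k12 ub]]] := nrm_ustar_bounds Hm Hrz HID HLOC.
pose k := Num.sqrt k2 + 1; have kp : 0 < k by rewrite ltr_wpDl // sqrtr_ge0.
pose e' := e / (2 * k); have e'0 : 0 < e' by rewrite divr_gt0 // mulr_gt0.
have [_ [HP1 HP2]] := HPHI.
have P1 := near_ereal_le HP1 e'0.
have nV := near_Vbark_hullk He Hrz; have nsd := near_nrm_sd_vstar HLQA.
have nT := near_Tn Hm He Hl Hrz HID HLOC HPHI T0.
near=> n; have TT : forall t, `|t| <= T -> Tn M n (t / sq n) by near: n.
move=> a t na tT; have n0 : (0 < n)%N by near: n; exists 1%N.
have s0 : 0 < sq n by rewrite sqrtr_gt0 ltr0n.
have [eV _] : Vbark M (kn M n) = hullk M (kn M n) /\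
  exists2 m, (1 < m)%N & has_dim (hullk M (kn M n)) m by near: n.
have sd0 : nrm_sd M (vstar M n) != 0 by near: n.
have sdp : 0 < nrm_sd M (vstar M n) by rewrite lt_neqAle eq_sym sd0 sqrtr_ge0.
have tTn : Tn M n (t / sq n) := TT t tT.
have le1 : (ereal_sup [set (Num.sqrt n%:R
       * `|phi M (pert M n p.1 p.2) - phi M a0
           - phidot M (pert M n p.1 p.2 - a0)|
       / nrm M (vstar M n))%:E | p in NT M n] <= e'%:E)%E by near: n.
have le2 : Num.sqrt n%:R * `|phidot M (alpha0k M (kn M n) - a0)| / nrm M (vstar M n) <= e'.
  by apply: (le_trans (ler_norm _)); near: n; exact: cvgr0_norm_le.
have ha : hullk M (kn M n) a by case: na => _ [].
have Da : Dir M (a - a0) := hullk_subDir ha.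
have Du := ustar_Dir Hrz n.
have /andP[u1 u2] := ub n sd0.
have nuE := nrm_ustar Hm Hrz HID HLOC n.
have un0 : 0 < nrm M (ustar M n).
  rewrite lt_neqAle nrm_ge0 andbT; apply: contraTneq u1 => <-.
  by rewrite expr0n -ltNge.
have nv0 : 0 < nrm M (vstar M n).
  by move: un0; rewrite nuE pmulr_lgt0 // invr_gt0.
have uk : nrm M (ustar M n) <= k.
  apply: (@le_trans _ _ (Num.sqrt k2)); last by rewrite lerDl.
  by rewrite -[leLHS]ger0_norm ?nrm_ge0 // -sqrtr_sqr ler_wsqrtr.
have pE : phidot M (pert M n a (t / sq n) - a0) = phidot M (a - a0) +
    t / sq n * (nrm_sd M (vstar M n) * nrm M (ustar M n) ^+ 2).
  rewrite [RHS]addrC -(phidot_ustar Hm Hrz HID HLOC) // -(phidot_lin Hrz) //.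
  by rewrite /pert addrAC [in RHS]addrC.
have h1 : sq n * `|phi M (pert M n a (t / sq n)) - phi M a0 - phidot M (a - a0)
    - t / sq n * (nrm_sd M (vstar M n) * nrm M (ustar M n) ^+ 2)| / nrm M (vstar M n) <= e'.
  rewrite -lee_fin; apply: le_trans le1; apply: ereal_sup_ubound.
  by exists (a, t / sq n) => //=; rewrite pE opprD addrA.
have -> : e = 2 * e' * k by rewrite /e'; field; rewrite gt_eqF.
exact: (scaled_phi s0 sdp e'0 nv0 nuE (ltW kp) uk h1 le2
  (ip_ustar Hm Hrz HID HLOC eV ha)).
Unshelve. all: by end_near. Qed.

Lemma continuous_phi_pert n a :
  continuous (fun t : R => sq n * (phi M (pert M n a (t / sq n)) - phi M a0)
                           / nrm_sd M (vstar M n)).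
Proof.
have [cphi _] := Hrz.
have cp : continuous (fun t : R => pert M n a (t / sq n)).
  have -> : (fun t : R => pert M n a (t / sq n)) =
    (fun=> a) \+ (fun t : R => (t / sq n) *: ustar M n) by [].
  move=> t; apply: continuousD; first exact: cst_continuous.
  apply: (@continuous_comp _ _ _ (fun t : R => t / sq n) (fun c => c *: ustar M n));
    last exact: scalel_continuous.
  by apply: continuousM; [by move=> ?|exact: cst_continuous].
have cf : continuous (fun t : R => phi M (pert M n a (t / sq n))).
  by move=> t; apply: (continuous_comp (cp t)); exact: cphi.
have -> : (fun t : R => sq n * (phi M (pert M n a (t / sq n)) - phi M a0)
                           / nrm_sd M (vstar M n)) =
  ((fun=> sq n) \* ((fun t : R => phi M (pert M n a (t / sq n))) \- (fun=> phi M a0)))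
    \* (fun=> (nrm_sd M (vstar M n))^-1) by [].
move=> t; apply: continuousM; last exact: cst_continuous.
apply: continuousM; first exact: cst_continuous.
by apply: continuousB; [exact: cf|exact: cst_continuous].
Qed.

Let X n w : R := n%:R * (Qhat M (sample M n w) (hataR_w M n w)
           - Qhat M (sample M n w) (hata_w M n w)).

(** The score is bounded by a constant K up to probability gam / 2; K fixes the
    accuracy e and the range T of the perturbations, for which all remaining
    events have probability tending to 1. *)
Lemma QLR_hat_expansion : oP P (fun n w =>
  ((nrm M (ustar M n) ^+ 2)%:E * QLR_hat M n w - (sqrtnZn M n w ^+ 2)%:E)%E) (@one_seq R).
Proof.
apply/oPP => eta eta0; apply/wpa1P => gam gam0.
have [k1 [k2 [k10 k12 ub]]] := nrm_ustar_bounds Hm Hrz HID HLOC.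
have g2 : 0 < gam / 2 by lra.
have [_ cvZ] := HLQA.
have [K K0 hK] := normal_limit_tight (sqrtnZn_meas Hm Hrz HLOC) cvZ g2.
have [e [T [e0 T0 det]]] := qlr_expansion k10 k12 K0 eta0.
have e2 : 0 < e / 2 by lra.
have npc := near_pen_close e2.
have nphi := near_phi_expansion e0 T0.
have nsd := near_nrm_sd_vstar HLQA.
have nT := near_Tn Hm He Hl Hrz HID HLOC HPHI T0.
have [[nAk _] _] := HLQA.
have [nAkR minR] := Hre.
have [_ [_ [_ [_ [_ [_ [_ [_ min]]]]]]]] := He.
have E1 := le_oPP min e2; have E2 := le_oPP minR e2.
have E3 := wpa1_lqa e2.
have E4 := (oPP _ _ _).1 HB e e0.
have E5 := hata_Nosn Hm He Hl Hrz HID HPEN HCRIT HLOC HPHI.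
have g3 : gam / 2 < gam by lra.
apply: hp_sub (hp_wpa1 g3 hK (wpa1I E1 (wpa1I E2 (wpa1I E3 (wpa1I E4 (wpa1I E5 HR)))))).
near=> n; move=> w [/= zK [min1 [min2 [lqa [BU [Na NR]]]]]].
have n0 : (0 < n)%N by near: n; exists 1%N.
have s0 : 0 < sq n by rewrite sqrtr_gt0 ltr0n.
have sd0 : nrm_sd M (vstar M n) != 0 by near: n.
have tTn : forall t, `|t| <= T -> Tn M n (t / sq n) by near: n.
have pc : pen_close (e / 2) n by near: n.
have inAk : forall p, NT M n p -> Ak M (kn M n) (pert M n p.1 p.2) by near: n.
have inAkR : forall zs, AkR M n (hataR M (n := n) zs) by near: n.
have ph : forall a t, Nosn M n a -> `|t| <= T ->
  `|sq n * (phi M (pert M n a (t / sq n)) - phi M a0) / nrm_sd M (vstar M n)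
    - (sq n * ip M (ustar M n) (a - a0) + t * nrm M (ustar M n) ^+ 2)| <= e by near: n.
set zs := sample M n w in min1 min2 lqa BU *.
set a := hata_w M n w in Na min1 *; set aR := hataR_w M n w in NR min2 *.
have nt b t : Nosn M n b -> `|t| <= T -> NT M n (b, t / sq n).
  by move=> nb tT; split => //; exact: tTn.
have ee : 2 * (e / 2) = e by field.
have opt b t : Nosn M n b -> `|t| <= T ->
    n%:R * (Qhat M zs a - Qhat M zs (pert M n b (t / sq n))) <= e.
  move=> nb tT; rewrite -ee; apply: pert_compare n0 pc (nt _ _ nb tT) Na _.
  apply: (le_trans min1); rewrite leeD2r //; apply: ereal_inf_lbound.
  by exists (pert M n b (t / sq n)) => //; exact: (inAk (b, t / sq n) (nt _ _ nb tT)).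
have lq b t : Nosn M n b -> `|t| <= T ->
    `|n%:R * (Qhat M zs (pert M n b (t / sq n)) - Qhat M zs b)
    - (2 * t * (sqrtnZn M n w + sq n * ip M (ustar M n) (b - a0))
       + Bn M zs * t ^+ 2)| <= e * (1 + t ^+ 2).
  by move=> nb tT; rewrite -ee; apply: lqa_expansion => //; exact: nt.
suff bound : `|nrm M (ustar M n) ^+ 2 * X n w - sqrtnZn M n w ^+ 2| < eta.
  have : (`|(nrm M (ustar M n) ^+ 2 * X n w - sqrtnZn M n w ^+ 2)%:E| <
          (eta * one_seq R n)%:E)%E by rewrite mulr1 abse_EFin lte_fin.
  exact.
apply: (det _ (Bn M zs) _ (sq n * ip M (ustar M n) (a - a0))
   (sq n * ip M (ustar M n) (aR - a0)) _
   (fun t => n%:R * (Qhat M zs (pert M n a (t / sq n)) - Qhat M zs a))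
   (fun t => n%:R * (Qhat M zs (pert M n aR (t / sq n)) - Qhat M zs aR))
   (fun t => sq n * (phi M (pert M n a (t / sq n)) - phi M a0) / nrm_sd M (vstar M n))).
- exact: ub.
- move: BU; rewrite /one_seq mulr1 /= lte_fin normr_id; exact: ltW.
- exact: zK.
- have := ph aR 0 NR; rewrite normr0 => /(_ (ltW T0)).
  rewrite /pert mul0r scale0r addr0 (inAkR _).2 H0 subrr mulr0 mul0r mul0r addr0.
  by rewrite sub0r normrN.
- by move=> t tT; apply: lq.
- by move=> t tT; apply: lq.
- by move=> t tT; rewrite lerNl -mulrN opprB; apply: opt.
- move=> t tT; rewrite lerNl opprD addrC.
  have -> : - (n%:R * (Qhat M zs (pert M n aR (t / sq n)) - Qhat M zs aR)) - X n w =
    n%:R * (Qhat M zs a - Qhat M zs (pert M n aR (t / sq n))).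
    by rewrite /X -/zs -/a -/aR; ring.
  exact: opt.
- exact: continuous_phi_pert.
- by move=> t tT; apply: ph.
- move=> t tT F0.
  have -> : X n w - n%:R * (Qhat M zs (pert M n a (t / sq n)) - Qhat M zs a) =
    n%:R * (Qhat M zs aR - Qhat M zs (pert M n a (t / sq n))).
    by rewrite /X -/zs -/a -/aR; ring.
  rewrite -ee; apply: pert_compare n0 pc (nt _ _ Na tT) NR _.
  apply: (le_trans min2); rewrite leeD2r //; apply: ereal_inf_lbound.
  exists (pert M n a (t / sq n)) => //; split; first exact: (inAk (a, t / sq n) (nt _ _ Na tT)).
  have /eqP := F0; rewrite mulf_eq0 invr_eq0 (negbTE sd0) orbF mulf_eq0 gt_eqF //=.
  by rewrite subr_eq0 H0 => /eqP.
Unshelve. all: by end_near. Qed.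

(* Here r and x are the values of the two formulas for the statistic. *)
Let perturbed_bound (U r x z k eps : R) : 0 <= U -> U <= k -> 0 < eps ->
  `|r - x| < eps / (2 * (k + 1)) -> `|U * x - z| < eps / 2 -> `|U * r - z| < eps.
Proof.
move=> U0 Uk e0 h1 h2.
have k0 : 0 < 2 * (k + 1) by lra.
have h3 : `|U * (r - x)| <= eps / 2.
  rewrite normrM (ger0_norm U0); apply: (@le_trans _ _ ((k + 1) * (eps / (2 * (k + 1))))).
    by apply: ler_pM => //; [lra|exact: ltW].
  have -> : (k + 1) * (eps / (2 * (k + 1))) = eps / 2 by field; lra.
  exact: lexx.
have -> : U * r - z = U * (r - x) + (U * x - z) by ring.
apply: (le_lt_trans (ler_normD _ _)); lra.
Qed.

Lemma QLR_expansion (QLR : nat -> Omega -> \bar R) : QLR_statistic M QLR ->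
  oP P (fun n w =>
  ((nrm M (ustar M n) ^+ 2)%:E * QLR n w - (sqrtnZn M n w ^+ 2)%:E)%E) (@one_seq R).
Proof.
move=> [->|[-> hinf]]; first exact: QLR_hat_expansion.
apply/oPP => eps e0.
have [k1 [k2 [k10 k12 ub]]] := nrm_ustar_bounds Hm Hrz HID HLOC.
have nsd := near_nrm_sd_vstar HLQA.
have k20 : 0 < k2 by exact: lt_le_trans k12.
have e1 : 0 < eps / (2 * (k2 + 1)) by rewrite divr_gt0 // mulr_gt0 // ltr_wpDl // ltW.
have e2 : 0 < eps / 2 by rewrite divr_gt0.
have W1 := (oPP _ _ _).1 hinf _ e1; have W2 := (oPP _ _ _).1 QLR_hat_expansion _ e2.
apply: wpa1_sub (wpa1I W1 W2); near=> n; move=> w [].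
have sd0 : nrm_sd M (vstar M n) != 0 by near: n.
have /andP[_ uk] := ub n sd0.
rewrite /= /QLR_hat mulr1; case: (QLR_inf M n w) => [r|//|//].
rewrite -EFinM -!EFinD !abse_EFin !lte_fin /one_seq !mulr1 => h1 h2.
by apply: perturbed_bound h1 h2 => //; exact: sqr_ge0.
Unshelve. all: by end_near. Qed.

Lemma wilks_scaled (QLR : nat -> Omega -> \bar R) : QLR_statistic M QLR ->
  wilks M (fun n w => (nrm M (ustar M n) ^+ 2)%:E * QLR n w)%E.
Proof.
move=> hQ; have ex := QLR_expansion hQ; split => //.
by apply: cvg_dist_chi2 ex; [exact: (sqrtnZn_meas Hm Hrz HLOC)|case: HLQA].
Qed.

Lemma wilks_optimal (QLR : nat -> Omega -> \bar R) : QLR_statistic M QLR ->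
  (forall x, suppX M x -> Sig M x = Sig0 M x) -> wilks M QLR.
Proof.
move=> hQ SS.
have ex : oP P (fun n w => QLR n w - (sqrtnZn M n w ^+ 2)%:E)%E (@one_seq R).
  apply/oPP => eps e0; have nsd := near_nrm_sd_vstar HLQA.
  apply: wpa1_sub ((oPP _ _ _).1 (QLR_expansion hQ) _ e0); near=> n; move=> w /=.
  have sd0 : nrm_sd M (vstar M n) != 0 by near: n.
  by rewrite (ustar_opt Hm Hrz HID HLOC) // expr1n mul1e.
split => //.
by apply: cvg_dist_chi2 ex; [exact: (sqrtnZn_meas Hm Hrz HLOC)|case: HLQA].
Unshelve. all: by end_near. Qed.

End Expansion.

Unset Implicit Arguments.

Theorem theorem4p3 (R : realType) (dy dx dth drho : nat)
  (H : completeNormedModType R) (d : measure_display) (Omega : measurableType d)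
  (M : psmd_model dy dx dth drho H Omega) (QLR : nat -> Omega -> \bar R) :
  model_setup M ->
  estimator_setup M ->
  restricted_estimator_setup M ->
  local_setup M ->
  riesz_setup M ->
  cond_ID M ->
  cond_PEN M ->
  cond_CRIT M ->
  cond_LOC M ->
  cond_PHI M ->
  cond_LQA M ->
  Bn_consistent M ->
  pen_perturbation M ->
  wpa1 (prob M) (fun n => [set w | Nosn M n (hataR_w M n w)]) ->
  QLR_statistic M QLR ->
  (phi M (alpha0 M) = phi0 M ->
     wilks M (fun n w => ((nrm M (ustar M n) ^+ 2)%:E * QLR n w)%E))
  /\
  ((forall x, suppX M x -> Sig M x = Sig0 M x) ->
   phi M (alpha0 M) = phi0 M ->
     wilks M QLR).
Proof.
move=> Hm He Hre Hl Hrz HID HPEN HCRIT HLOC HPHI HLQA HB HPP HR hQ; split.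
- by move=> H0; apply: wilks_scaled hQ.
- by move=> SS H0; apply: wilks_optimal hQ SS.
Qed.
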